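(* Let the speed be $v=1$. The intensity of the tropical interference handover point process $\mathcal V_{\mathcal I}$ is $\lambda_{\mathcal I}=\frac{6\sqrt\lambda}{\pi}$.
   Context: Model. Let $\lambda>0$. $\Phi=\sum_i\delta_{X_i}$ is a homogeneous Poisson point process of intensity $\lambda$ on $\mathbb R^2$ and $(\Theta_i)$ are i.i.d. uniform angles on $[-\pi,\pi)$, independent of $\Phi$. Base station (BS) $i$ is at $X_i^t=X_i+vt(\cos\Theta_i,\sin\Theta_i)$ at time $t\in\mathbb R$, with $v$ the common speed; $d_i(t)=\|X_i^t\|$ is its distance to the user at the origin. The tropical interference handover point process $\mathcal V_{\mathcal I}$ is the point process on the time axis $\mathbb R$ consisting of the times $s$ for which there is an unordered pair $i\neq j$ with $d_i(s)=d_j(s)=h$ and exactly one BS $l$ with $d_l(s)<h$ (i.e. the second and third nearest BSs are swapped). It is stationary; its intensity is the mean number of its points in $[0,1]$. *)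

(* Defs.v *)
From mathcomp Require Import all_boot all_order all_algebra finmap.
From mathcomp Require Import all_classical all_reals all_analysis measurable_realfun.
Set Implicit Arguments.
Unset Strict Implicit.
Unset Printing Implicit Defensive.
Import Order.TTheory GRing.Theory Num.Theory.
Import numFieldNormedType.Exports.
Local Open Scope classical_set_scope.
Local Open Scope ring_scope.

Definition sigma_rv (d d' : measure_display) (T : measurableType d)
    (T' : measurableType d') (X : T -> T') : set_system T :=
  preimage_set_system setT X measurable.

(* For a point process given through an enumeration [X] of its points, this is
   the sigma-algebra of the enumeration, possibly finer than that of the random
   measure. Marks attached to the indices have to be independent of it: an
   enumeration correlated with the marks would not give an i.i.d. marking. *)
Definition sigma_seq (d d' : measure_display) (T : measurableType d)
    (T' : measurableType d') (X : nat -> T -> T') : set_system T :=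
  <<s \bigcup_i sigma_rv (X i) >>.

Definition mutually_independent (d : measure_display) (T : measurableType d)
    (R : realType) (P : probability T R) (I : choiceType)
    (G : I -> set_system T) : Prop :=
  forall (J : {fset I}) (E : I -> set T),
    (forall i, i \in J -> G i (E i)) ->
    P (\bigcap_(i in [set` J]) E i) = (\prod_(i <- J) P (E i))%E.

Definition independent2 (d : measure_display) (T : measurableType d)
    (R : realType) (P : probability T R) (G H : set_system T) : Prop :=
  forall A B, G A -> H B -> P (A `&` B) = (P A * P B)%E.

(* [R * R] with its Borel sigma-algebra. Its library norm is the sup norm,
   hence the separate [euclidean_norm] below. *)
Definition plane (R : realType) := (measurableTypeR R * measurableTypeR R)%type.

Definition euclidean_norm (R : realType) (x : plane R) : R :=
  Num.sqrt (x.1 ^+ 2 + x.2 ^+ 2).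

Definition area (R : realType) : set (plane R) -> \bar R :=
  (@lebesgue_measure R \x @lebesgue_measure R)%E.

(* The random measure \sum_i \delta_(X_i), evaluated at the outcome [w]. *)
Definition point_measure (d : measure_display) (T : measurableType d)
    (R : realType) (X : nat -> T -> plane R) (w : T) : set (plane R) -> \bar R :=
  mseries (fun i => \d_(X i w)) 0.

(* The mass function is spelled out because [poisson_pmf] takes the value 1
   everywhere at rate 0, a case that occurs for sets of zero area.
   Enumerating the points by [nat] loses nothing: a homogeneous process of
   positive intensity on the plane a.s. has infinitely many points. *)
Definition is_poisson_point_process (d : measure_display)
    (T : measurableType d) (R : realType) (P : probability T R) (lambda : R)
    (X : nat -> {RV P >-> plane R}) : Prop :=
  (forall B : set (plane R), measurable B -> (area B < +oo)%E ->
     forall k : nat,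
       let m := lambda * fine (area B) in
       P [set w | point_measure X w B = k%:R%:E] =
       (m ^+ k / k`!%:R * expR (- m))%:E) /\
  (forall (n : nat) (B : 'I_n -> set (plane R)),
     (forall i, measurable (B i)) -> trivIset setT B ->
     mutually_independent P
       (fun i => sigma_rv (T' := \bar R) (fun w => point_measure X w (B i)))).

Lemma ltNpi_pi (R : realType) : - pi < pi :> R.
Proof. by rewrite gtrN// pi_gt0. Qed.

(* [uniform_prob] on [-pi, pi] is also the uniform law on [-pi, pi[. *)
Definition is_iid_uniform_angles (d : measure_display) (T : measurableType d)
    (R : realType) (P : probability T R)
    (Theta : nat -> {RV P >-> measurableTypeR R}) : Prop :=
  mutually_independent P (fun i => sigma_rv (Theta i)) /\
  (forall (i : nat) (B : set (measurableTypeR R)), measurable B ->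
     distribution P (Theta i) B = uniform_prob (ltNpi_pi R) B).

Definition bs_position (R : realType) (v : R) (x : plane R) (theta t : R) :
    plane R :=
  (x.1 + v * t * cos theta, x.2 + v * t * sin theta).

Definition bs_distance (R : realType) (v : R) (x : plane R) (theta t : R) : R :=
  euclidean_norm (bs_position v x theta t).

Definition interference_handovers (R : realType) (dist : nat -> R -> R) :
    set R :=
  [set s | exists i j h, [/\ i != j, dist i s = h, dist j s = h &
                             exists! l, dist l s < h]].

Definition tropical_interference_process (T : Type) (R : realType) (v : R)
    (X : nat -> T -> plane R) (Theta : nat -> T -> R) (w : T) : set R :=
  interference_handovers (fun i => bs_distance v (X i w) (Theta i w)).

(* For a stationary point process on the line, given as a random set. The
   points are counted by a function that may fail to be measurable on a null
   event (for [tropical_interference_process]: two stations whose distances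
   agree at all times); this does not affect the integral, which for
   nonnegative functions is the supremum over simple functions below. *)
Definition intensity (d : measure_display) (T : measurableType d)
    (R : realType) (P : probability T R) (V : T -> set R) : \bar R :=
  (\int[P]_w counting (V w `&` `[0%R, 1%R]))%E.

(* Main.v *)
Require Import Defs.
From HB Require Import structures.
From mathcomp Require Import all_boot all_order all_algebra finmap.
From mathcomp Require Import all_classical all_reals all_analysis measurable_realfun.
From mathcomp Require Import ring lra.

(** Rotate station [i] about the user by its angle, so that it moves along the
    first axis. Its distance to the user at time [s] is then the distance of the
    fixed point [Y i = static_point X Theta i] to [(- s, 0)]: the stations stand
    still and the user walks. Area is invariant under rotations and the angles are
    independent of everything else, so the points [Y i] still form a Poisson field
    of intensity [lambda] ([static_point_pgfl]).

    Two points [y] and [z] with [y.1 < z.1] are equidistant from the user exactly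
    once, at [crossing_time y z], at squared distance [crossing_sqdist y z], and
    the points then closer to the user fill a disc, [closer_disc y z]. A handover is
    a pair whose disc contains exactly one point of the field. Since a disc of area
    [a] contains one point with probability [m * expR (- m)], where
    [m = lambda * a], the mean number of pairs with crossing time in [S] is the
    integral of [lambda ^+ 2 * (m * expR (- m))] over the pairs in the plane with
    [y.1 < z.1] and crossing time in [S], where
    [m = lambda * pi * crossing_sqdist y z] ([campbell_crossing]). In coordinates
    suited to the pair this integral is the length of [S] times a product of
    integrals on the line, a fourth Gaussian moment and twice the integral of
    [(1 + t ^+ 2) ^ (- 3 / 2)]; this gives [6 * Num.sqrt lambda / pi] for [S] of
    length 1 ([crossing_intensity]).

    The formula for the mean number of pairs comes from the generating functional,
    the limit of the means of the products of [g (Y i)], which is the exponential of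
    [- lambda] times the integral of [1 - g]. Step functions [g] give the joint law
    of the counts of disjoint sets [A], [C1], [C2], and hence the mean of the product
    of the counts of [C1] and [C2] on the event that [A] has one point
    ([integral_one_point_weight]). This says that the pair measure, restricted to that
    event and to pairs off [A], is a multiple of area squared
    ([campbell_count_eq1]). As the disc depends on the pair, it is approximated from
    inside by regions taking countably many values ([campbell_random_region]).

    Almost surely no two points [Y i] have the same abscissa, no three are
    equidistant from the user at a nonzero time, and no handover occurs at time 0:
    given all the rest, the law of the abscissa of a rotated point has no atoms
    ([static_point_avoids]). On this event the handovers in an interval correspond one
    to one to the pairs above ([counting_handovers]). The number of handovers, possibly
    not measurable, thus equals a measurable function off a null set, which determines
    its integral ([integral_eq_off_null]). *)

Set Implicit Arguments.
Unset Strict Implicit.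
Unset Printing Implicit Defensive.
Import Order.TTheory GRing.Theory Num.Theory.
Import numFieldNormedType.Exports.
Local Open Scope classical_set_scope.
Local Open Scope ring_scope.

(** * Image measures and affine substitutions *)

Section image_measure.
Context d d' (T1 : measurableType d) (T2 : measurableType d') (R : realType).
Variables (m : {measure set T1 -> \bar R}) (f : T1 -> T2).
Hypothesis mf : measurable_fun [set: T1] f.

(** The measurability proof is an argument so that the measure structure can be
    attached to this constant. *)
Definition image_measure : set T2 -> \bar R :=
  let _ := mf in pushforward m f.

Let image_measure0 : image_measure set0 = 0%E.
Proof. by rewrite /image_measure /pushforward preimage_set0 measure0. Qed.

Let image_measure_ge0 A : (0 <= image_measure A)%E.
Proof. exact: measure_ge0. Qed.

Let image_measure_sigma_additive : semi_sigma_additive image_measure.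
Proof.
move=> F mF tF mUF; rewrite /image_measure /pushforward preimage_bigcup.
apply: measure_semi_sigma_additive.
- by move=> n; rewrite -[X in measurable X]setTI; exact: mf.
- apply/trivIsetP => /= i j _ _ ij; rewrite -preimage_setI.
  by move/trivIsetP : tF => /(_ _ _ _ _ ij) ->//; rewrite preimage_set0.
- by rewrite -preimage_bigcup -[X in measurable X]setTI; exact: mf.
Qed.

HB.instance Definition _ := isMeasure.Build _ _ _ image_measure
  image_measure0 image_measure_ge0 image_measure_sigma_additive.

Lemma ge0_integral_image_measure (g : T2 -> \bar R) :
  measurable_fun setT g -> (forall y, 0 <= g y)%E ->
  (\int[image_measure]_y g y = \int[m]_x g (f x))%E.
Proof.
by move=> mg g0; rewrite ge0_integral_pushforward.
Qed.

End image_measure.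

Section affine_change_of_variable.
Context (R : realType).
Local Notation mu := (@lebesgue_measure R).

Let measurable_affine (a b : R) :
  measurable_fun [set: measurableTypeR R] ((fun x : R => a * x + b) : measurableTypeR R -> measurableTypeR R).
Proof. by apply: measurable_funD => //; exact: measurable_funM. Qed.

(** Lebesgue measure is the only measure giving intervals their length, and the
    image of Lebesgue measure under [x |-> a * x + b], multiplied by the norm of
    [a], does so. *)
Lemma ge0_integral_affine (a b : R) (f : measurableTypeR R -> \bar R) : a != 0 ->
  measurable_fun setT f -> (forall x, 0 <= f x)%E ->
  (\int[mu]_x f x = `|a|%:E * \int[mu]_x f (a * x + b)%R)%E.
Proof.
move=> a0 mf f0.
have na0 : 0 <= `|a| by [].
pose m' := mscale (NngNum na0) (image_measure mu (measurable_affine a b)).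
rewrite (eq_measure_integral m').
  rewrite ge0_integral_mscale// (ge0_integral_image_measure _ (measurable_affine a b))//.
move=> A mA _; apply: lebesgue_measure_unique => // _ [[u v] /= _ <-].
rewrite /m' /mscale/= /image_measure/= /pushforward.
have [apos|aneg] := ltP 0 a.
  rewrite (_ : _ @^-1` _ = `](u - b) / a, (v - b) / a]%classic); last first.
    apply/seteqP; split=> x /=; rewrite !in_itv/= ltr_pdivrMr// ler_pdivlMr//; lra.
  rewrite !lebesgue_measure_itv/= !lte_fin gtr0_norm//.
  rewrite ltr_pM2r ?invr_gt0// ltrD2r; case: ifPn => uv; last by rewrite mule0.
  by rewrite -!EFinB -EFinM; congr (_%:E); field.
have {}aneg : a < 0 by rewrite lt_neqAle a0.
rewrite (_ : _ @^-1` _ = `[(v - b) / a, (u - b) / a[%classic); last first.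
  apply/seteqP; split=> x /=; rewrite !in_itv/= ltr_ndivlMr// ler_ndivrMr//; lra.
rewrite !lebesgue_measure_itv/= !lte_fin ltr0_norm//.
rewrite ltr_nM2r ?invr_lt0// ltrD2r; case: ifPn => uv; last by rewrite mule0.
by rewrite -!EFinB -EFinM; congr (_%:E); field.
Qed.

End affine_change_of_variable.

(** * Rotation invariance of area *)

Lemma sigma_finite_product_measure d1 d2 (T1 : measurableType d1)
    (T2 : measurableType d2) (R : realType)
    (m1 : {sigma_finite_measure set T1 -> \bar R})
    (m2 : {sigma_finite_measure set T2 -> \bar R}) :
  sigma_finite setT (m1 \x m2)%E.
Proof.
have /sigma_finiteP[F [TF ndF Foo]] := sigma_finiteT m1.
have /sigma_finiteP[G [TG ndG Goo]] := sigma_finiteT m2.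
exists (fun n => F n `*` G n).
  rewrite -setXTT TF TG predeqE => -[x y]; split.
    move=> [/= [n _ Fnx] [k _ Gky]]; exists (maxn n k) => //; split.
    - by move: x Fnx; exact/subsetPset/ndF/leq_maxl.
    - by move: y Gky; exact/subsetPset/ndG/leq_maxr.
  by move=> [n _ []/= ? ?]; split; exists n.
move=> k; have [mF Fk] := Foo k; have [mG Gk] := Goo k.
split; first exact: measurableX.
by rewrite product_measure1E// lte_mul_pinfty// ge0_fin_numE.
Qed.

HB.instance Definition _ (R : realType) := Measure.on (@area R).
HB.instance Definition _ (R : realType) :=
  Measure_isSigmaFinite.Build _ _ _ (@area R)
    (sigma_finite_product_measure (@lebesgue_measure R) (@lebesgue_measure R)).

Section rotation.
Context (R : realType).
Local Notation mu := (@lebesgue_measure R).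
Local Notation mu2 := (@area R).

Definition rotate (theta : R) (x : plane R) : plane R :=
  (x.1 * cos theta + x.2 * sin theta, - x.1 * sin theta + x.2 * cos theta).

Lemma ge0_integral_area (f : plane R -> \bar R) :
  measurable_fun setT f -> (forall x, 0 <= f x)%E ->
  (\int[mu2]_x f x = \int[mu]_x \int[mu]_y f (x, y))%E.
Proof. by move=> mf f0; rewrite fubini_tonelli1. Qed.

Lemma ge0_integral_area2 (f : plane R -> \bar R) :
  measurable_fun setT f -> (forall x, 0 <= f x)%E ->
  (\int[mu2]_x f x = \int[mu]_y \int[mu]_x f (x, y))%E.
Proof. by move=> mf f0; rewrite fubini_tonelli2. Qed.

Lemma measurable_lincomb d (T : measurableType d) (a b : R) (f g : T -> R) :
  measurable_fun setT f -> measurable_fun setT g ->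
  measurable_fun setT (fun x => f x * a + g x * b).
Proof.
by move=> mf mg; apply: measurable_funD; apply: measurable_funM.
Qed.

Lemma measurable_rotate theta : measurable_fun setT (rotate theta).
Proof.
apply/measurable_fun_pairP; split.
  exact: measurable_lincomb.
apply: measurable_lincomb => //.
exact: measurableT_comp.
Qed.

(** When the cosine [c] is nonzero, a rotation is a product of two shears and a
    scaling: for fixed [y] substitute [u = x * c + y * s], then for fixed [u]
    substitute in [y]. The factors of the two affine substitutions cancel. When
    [c] vanishes the rotation exchanges the axes up to signs. *)
Lemma ge0_integral_rotate theta (f : plane R -> \bar R) :
  measurable_fun setT f -> (forall x, 0 <= f x)%E ->
  (\int[mu2]_x f (rotate theta x) = \int[mu2]_x f x)%E.
Proof.
move=> mf f0; have mr := measurable_rotate theta.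
have := cos2Dsin2 theta; rewrite /rotate.
set c := cos theta; set s := sin theta => cs1.
have [c0|c0] := eqVneq c 0.
  have s2 : s ^+ 2 = 1 by rewrite -cs1 c0; ring.
  have s0 : s != 0 by apply: contra_eq_neq s2 => ->; rewrite expr0n/= eq_sym oner_eq0.
  have ns : `|s| = 1.
    by have /eqP := s2; rewrite sqrf_eq1 => /orP[]/eqP ->; rewrite ?normrN normr1.
  rewrite ge0_integral_area; last 2 first.
  - exact: (measurableT_comp mf mr).
  - by move=> ?.
  rewrite [RHS]ge0_integral_area2//.
  rewrite [RHS] (@ge0_integral_affine _ (- s) 0)//; last 3 first.
  - by rewrite oppr_eq0.
  - exact: (measurable_fun_fubini_tonelli_G (m1 := mu) f mf f0).
  - by move=> y; apply: integral_ge0 => x _; exact: f0.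
  rewrite normrN ns mul1e; apply: eq_integral => x _.
  rewrite [RHS](@ge0_integral_affine _ s 0)//; last exact: measurableT_comp.
  rewrite ns mul1e; apply: eq_integral => y _; congr (f _).
  by rewrite c0 /=; congr pair; ring.
rewrite ge0_integral_area2; last 2 first.
- exact: (measurableT_comp mf mr).
- by move=> ?.
have maff (a b : R) : measurable_fun setT ((fun u : R => a * u + b) : measurableTypeR R -> measurableTypeR R).
  by apply: measurable_funD => //; exact: measurable_funM.
pose F (z : plane R) := f (z.1, z.1 * - (s / c) + z.2 * c^-1).
have mF : measurable_fun setT F.
  apply: measurableT_comp => //; apply/measurable_fun_pairP; split.
    exact: measurable_fst.
  by apply: measurable_lincomb.
have F0 z : (0 <= F z)%E by exact: f0.
have nc0 : `|c| != 0 by rewrite normr_eq0.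
transitivity (\int[mu]_y (`|c|^-1%:E * \int[mu]_u F (u, y)))%E.
  apply: eq_integral => y _.
  rewrite [in RHS](@ge0_integral_affine _ c (y * s))//; last first.
    exact: (measurableT_comp mF (pair2_measurable y)).
  rewrite muleA -EFinM mulVf// mul1e; apply: eq_integral => x _.
  rewrite /F/= (mulrC x); congr (f (_, _)).
  have -> : y / c = y * c + y * s ^+ 2 / c.
    by rewrite -[in LHS](mulr1 y) -cs1; field.
  by field.
rewrite ge0_integralZl//; last 2 first.
- exact: (measurable_fun_fubini_tonelli_G (m1 := mu) F mF F0).
- by move=> y _; apply: integral_ge0 => x _; exact: F0.
rewrite -(fubini_tonelli (m1 := mu) (m2 := mu) F mF F0) ge0_integral_area//.
rewrite -ge0_integralZl//; last 2 first.
- exact: (measurable_fun_fubini_tonelli_F (m2 := mu) F mF F0).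
- by move=> y _; apply: integral_ge0 => x _; exact: F0.
apply: eq_integral => u _.
rewrite [RHS](@ge0_integral_affine _ c^-1 (- (s / c) * u)) ?invr_eq0//; last first.
  exact: (measurableT_comp mf (pair1_measurable u)).
rewrite normfV; congr (_ * _)%E; apply: eq_integral => y _; congr (f (_, _)).
by rewrite /= addrC (mulrC u) (mulrC y).
Qed.

End rotation.

(** * Integrals on the line *)

Section one_dimensional_integrals.
Context (R : realType).
Local Notation mu := (@lebesgue_measure R).

Lemma cvg_at_infty0 (f : R -> R) (k : R) :
  (forall x, 1 <= x -> `|f x| <= k / x) -> f x @[x --> +oo] --> 0.
Proof.
move=> fk; apply/cvgr0Pnorm_le => e e0; near=> x.
have x1 : 1 <= x by near: x; exact: nbhs_pinfty_ge.
apply: (le_trans (fk _ x1)); rewrite ler_pdivrMr ?(lt_le_trans _ x1)//.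
by rewrite mulrC -ler_pdivrMr//; near: x; exact: nbhs_pinfty_ge.
Unshelve. all: by end_near. Qed.

Lemma continuous_expRN : continuous (fun x : R => 3 * expR (- x)).
Proof.
move=> x; apply: cvgM; first exact: cvg_cst.
by apply: continuous_comp; [apply: cvgN; exact: cvg_id|exact: continuous_expR].
Qed.

Lemma integral0y_expRN : (\int[mu]_(x in `[0%R, +oo[) (3 * expR (- x))%:E = 3%:E)%E.
Proof.
rewrite (@ge0_continuous_FTC2y _ _ (fun x => - 3 * expR (- x)) 0 0).
- by rewrite oppr0 expR0 -EFinB; congr EFin; ring.
- by move=> x _; rewrite mulr_ge0// expR_ge0.
- exact: continuous_subspaceT continuous_expRN.
- rewrite -(mulr0 (-3)); apply: cvgM; first exact: cvg_cst.
  exact: cvgr_expR.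
- by move=> x _; exact: ex_derive.
- apply: cvg_at_right_filter; apply: cvgM; first exact: cvg_cst.
  by apply: continuous_comp; [apply: cvgN; exact: cvg_id|exact: continuous_expR].
- move=> x _; rewrite derive1E derive_val /= /GRing.scale/=; ring.
Qed.

Lemma is_derive_gauss (x : R) :
  is_derive x 1 (fun x : R => expR (- x ^+ 2)) (- 2 * x * expR (- x ^+ 2)).
Proof.
have dsq : is_derive x 1 (fun x : R => - x ^+ 2) (- 2 * x).
  by apply: is_derive_eq; rewrite /GRing.scale/=; ring.
have := @is_derive1_comp _ expR (fun x : R => - x ^+ 2) x _ _ (is_derive_expR _) dsq.
by move=> h; apply: is_derive_eq; ring.
Qed.

(** Two integrations by parts reduce the fourth moment of the Gaussian to its
    integral: [- (x ^+ 3 / 2 + 3 / 4 * x) * expR (- x ^+ 2)] is a primitive of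
    [(x ^+ 4 - 3 / 4) * expR (- x ^+ 2)]. This last function changes sign; adding
    [3 * expR (- x)] makes it nonnegative, as the fundamental theorem on a
    half-line used here requires. *)
Lemma integral0y_gauss4 :
  (\int[mu]_(x in `[0%R, +oo[) (x ^+ 4 * expR (- x ^+ 2))%:E =
   (3 * Num.sqrt pi / 8)%:E)%E.
Proof.
have cG : continuous (fun x : R => expR (- x ^+ 2)).
  by move=> x; exact: (@continuous_gauss_fun R).
have c4 : continuous (fun x : R => x ^+ 4 * expR (- x ^+ 2)).
  by move=> x; apply: cvgM; [exact: exprn_continuous|exact: cG].
have cE := continuous_expRN.
have mE (f : R -> R) : continuous f -> measurable_fun (`[0%R, +oo[ : set (measurableTypeR R)) (fun x => (f x)%:E).
  move=> cf; apply/measurable_EFinP; apply: measurable_funTS.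
  exact: continuous_measurable_fun.
pose f x : R := (x ^+ 4 - 3 / 4) * expR (- x ^+ 2) + 3 * expR (- x).
pose F x : R := - (x ^+ 3 / 2 + 3 / 4 * x) * expR (- x ^+ 2) - 3 * expR (- x).
have cf : continuous f.
  move=> x; apply: cvgD; last exact: cE.
  apply: cvgM; last exact: cG.
  by apply: cvgB; [exact: exprn_continuous|exact: cvg_cst].
have cF : continuous F.
  move=> x; apply: cvgB; last exact: cE.
  apply: cvgM; last exact: cG.
  apply: cvgN; apply: cvgD; apply: cvgM; try exact: cvg_cst.
    exact: exprn_continuous.
  exact: cvg_id.
have dF (x : R) : is_derive x 1 F (f x).
  have dG := is_derive_gauss x.
  have dE : is_derive x 1 (fun x : R => 3 * expR (- x)) (- 3 * expR (- x)).
    by apply: is_derive_eq; rewrite /GRing.scale/=; ring.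
  have dP : is_derive x 1 (fun x : R => - (x ^+ 3 / 2 + 3 / 4 * x)) (- (3 / 2 * x ^+ 2 + 3 / 4)).
    by apply: is_derive_eq; rewrite /GRing.scale/=; field.
  have dPG := is_deriveM dP dG.
  have := is_deriveB dPG dE.
  by move=> h; apply: is_derive_eq; rewrite /f /GRing.scale/=; field.
have f0 x : 0 <= x -> 0 <= f x.
  move=> x0; rewrite /f; have [x1|x1] := leP 1 x.
    rewrite addr_ge0// mulr_ge0 ?expR_ge0// subr_ge0.
    by rewrite (le_trans _ (exprn_ege1 4 x1))//; lra.
  have e1 : expR (- x ^+ 2) <= 1 by rewrite -expR0 ler_expR oppr_le0 sqr_ge0.
  have e2 : 4^-1 <= expR (- x).
    have -> : - x = - (x / 2) + - (x / 2) by field.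
    rewrite expRD; have := expR_ge1Dx (- (x / 2)); nra.
  have := expR_ge0 (- x ^+ 2); have := exprn_ge0 4 x0; nra.
have If : (\int[mu]_(x in `[0%R, +oo[) (f x)%:E = 3%:E)%E.
  rewrite (@ge0_continuous_FTC2y _ f F 0 0)//.
  - rewrite /F !expr0n/= oppr0 expR0 -EFinB; congr EFin; ring.
  - exact: continuous_subspaceT.
  - rewrite -(subr0 0); apply: cvgB; last first.
      rewrite -(mulr0 3); apply: cvgM; [exact: cvg_cst|exact: cvgr_expR].
    apply: (@cvg_at_infty0 _ (5 / 2)) => x x1.
    have x0 : 0 < x by rewrite (lt_le_trans _ x1).
    have x20 : 0 < x ^+ 2 by rewrite exprn_gt0.
    rewrite normrM normrN (ger0_norm (expR_ge0 _)) ger0_norm; last first.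
      by rewrite addr_ge0// ?mulr_ge0 ?exprn_ge0// ltW.
    rewrite expRN ler_pdivrMr ?expR_gt0// [leRHS]mulrAC ler_pdivlMr//.
    have := expR_ge1Dxn 1 (ltW x20); rewrite -exprM /= => h.
    apply: (@le_trans _ _ (5 / 2 * (x ^+ 4 / 2))); last first.
      rewrite ler_wpM2l//; apply: le_trans h; have -> : 2`! = 2%N by []; lra.
    have : 1 <= x ^+ 2 by rewrite exprn_ege1.
    nra.
  - by apply: cvg_at_right_filter; exact: cF.
  - by move=> x _; rewrite derive1E; have [_ ->] := dF x.
have ge4 (x : R) : 0 <= x ^+ 4 * expR (- x ^+ 2).
  by rewrite mulr_ge0 ?expR_ge0// (exprM x 2 2) sqr_ge0.
have : (\int[mu]_(x in `[0%R, +oo[) (x ^+ 4 * expR (- x ^+ 2) + 3 * expR (- x))%:E =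
        \int[mu]_(x in `[0%R, +oo[) (f x + 3 / 4 * expR (- x ^+ 2))%:E)%E.
  by apply: eq_integral => x _; rewrite /f; congr EFin; ring.
under eq_integral do rewrite EFinD.
under [in RHS]eq_integral do rewrite EFinD.
rewrite ge0_integralD; last 5 first.
- by [].
- by move=> x _; rewrite lee_fin; exact: ge4.
- exact: mE.
- by move=> x _; rewrite lee_fin mulr_ge0// expR_ge0.
- exact: mE.
rewrite ge0_integralD; last 5 first.
- by [].
- by move=> x; rewrite /= in_itv/= andbT lee_fin; exact: f0.
- exact: mE.
- by move=> x _; rewrite lee_fin mulr_ge0// expR_ge0.
- apply: mE => x; apply: cvgM; [exact: cvg_cst|exact: cG].
have -> : (\int[mu]_(x in `[0%R, +oo[) (3 / 4 * expR (- x ^+ 2))%:E =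
    (3 / 4 * (Num.sqrt pi / 2))%:E)%E.
  under eq_integral do rewrite EFinM.
  rewrite ge0_integralZl; last 4 first.
  - by [].
  - exact: mE.
  - by move=> x _; rewrite lee_fin expR_ge0.
  - by rewrite lee_fin.
  by rewrite (@integral0y_gauss R) -EFinM.
rewrite integral0y_expRN If [in RHS]addeC.
move=> /(congr1 (fun x => x - 3%:E)%E); rewrite !addeK//= => ->.
by congr EFin; field.
Qed.

End one_dimensional_integrals.

Section more_integrals.
Context (R : realType).
Local Notation mu := (@lebesgue_measure R).

Lemma ge0_integral_even (f : measurableTypeR R -> \bar R) :
  measurable_fun setT f -> (forall x, 0 <= f x)%E -> (forall x, f (- x) = f x) ->
  (\int[mu]_x f x = 2%:E * \int[mu]_(x in `[0%R, +oo[) f x)%E.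
Proof.
move=> mf f0 fN.
rewrite -[in LHS](setUv `[0%R, +oo[%classic) ge0_integral_setU; last 5 first.
- by [].
- exact: measurableC.
- by apply: measurable_funS mf.
- by [].
- exact/disj_setPCl.
rewrite mule_natl mule2n; congr (_ + _)%E.
rewrite setCitvr/= integral_itv_bndo_bndc; last exact: measurable_funS mf.
rewrite ge0_integration_by_substitution0//.
by apply: eq_integral => x _; rewrite fN.
Qed.

Definition sqrt1Dsqr (t : R) := Num.sqrt (1 + t ^+ 2).

Lemma sqrt1Dsqr_gt0 t : 0 < sqrt1Dsqr t.
Proof. by rewrite sqrtr_gt0 ltr_pwDl// sqr_ge0. Qed.

Lemma sqr_sqrt1Dsqr t : sqrt1Dsqr t ^+ 2 = 1 + t ^+ 2.
Proof. by rewrite sqr_sqrtr// addr_ge0// sqr_ge0. Qed.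

Lemma continuous_sqrt1Dsqr : continuous sqrt1Dsqr.
Proof.
move=> t; apply: continuous_comp; last exact: sqrt_continuous.
by apply: cvgD; [exact: cvg_cst|exact: exprn_continuous].
Qed.

Lemma is_derive_sqrt1Dsqr (t : R) :
  is_derive t 1 sqrt1Dsqr (t / sqrt1Dsqr t).
Proof.
have dsq : is_derive t 1 (fun x : R => 1 + x ^+ 2) (2 * t).
  by apply: is_derive_eq; rewrite /GRing.scale/=; ring.
have p : 0 < 1 + t ^+ 2 by rewrite ltr_pwDl// sqr_ge0.
have := @is_derive1_comp _ Num.sqrt (fun x : R => 1 + x ^+ 2) t _ _ (is_derive1_sqrt p) dsq.
move=> h; apply: is_derive_eq; rewrite /sqrt1Dsqr; field.
by rewrite gt_eqF// sqrtr_gt0.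
Qed.

(** A primitive is [x / sqrt1Dsqr x], whose limits at infinity are [1] and [-1]. *)
Lemma integral_sqrt1DsqrVX3 :
  (\int[mu]_x (sqrt1Dsqr x ^- 3)%:E = 2%:E)%E.
Proof.
have cw := continuous_sqrt1Dsqr.
have w0 x : sqrt1Dsqr x != 0 by rewrite gt_eqF// sqrt1Dsqr_gt0.
have c3 : continuous (fun x : R => sqrt1Dsqr x ^- 3).
  move=> x; apply: cvgV; first by rewrite expf_neq0.
  exact: (continuous_comp (cw x) (@exprn_continuous _ 3 _)).
have g3 x : 0 <= sqrt1Dsqr x ^- 3 by rewrite invr_ge0 exprn_ge0// ltW ?sqrt1Dsqr_gt0.
rewrite ge0_integral_even; last 3 first.
- by apply/measurable_EFinP; exact: continuous_measurable_fun.
- by move=> x; rewrite lee_fin.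
- by move=> x; rewrite /sqrt1Dsqr sqrrN.
pose F x : R := x / sqrt1Dsqr x.
have cF : continuous F.
  by move=> x; apply: cvgM; [exact: cvg_id|apply: cvgV => //; exact: cw].
have dF (x : R) : is_derive x 1 F (sqrt1Dsqr x ^- 3).
  have dw := is_derive_sqrt1Dsqr x.
  have dV : is_derive x 1 (fun x => (sqrt1Dsqr x)^-1) (- (sqrt1Dsqr x) ^- 2 *: (x / sqrt1Dsqr x)).
    exact: is_deriveV.
  have := is_deriveM (is_derive_id x 1) dV.
  move=> h; apply: is_derive_eq; rewrite /GRing.scale/=.
  have -> : sqrt1Dsqr x ^- 3 = (sqrt1Dsqr x ^+ 2 - x ^+ 2) * sqrt1Dsqr x ^- 3.
    by rewrite sqr_sqrt1Dsqr addrK mul1r.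
  by field.
rewrite (@ge0_continuous_FTC2y _ _ F 0 1).
- by rewrite /F mul0r sube0 -EFinM mulr1.
- by [].
- exact: continuous_subspaceT.
- rewrite -[X in _ --> X]add0r -[X in X @ _ --> _](subrK (cst 1)).
  apply: cvgD; last exact: cvg_cst.
  apply: (@cvg_at_infty0 _ _ 1) => x x1.
  have x0 : 0 < x by rewrite (lt_le_trans _ x1).
  have wx : x <= sqrt1Dsqr x.
    have := sqr_sqrt1Dsqr x; have := sqrt1Dsqr_gt0 x; nra.
  have := sqr_sqrt1Dsqr x; have := sqrt1Dsqr_gt0 x.
  rewrite /F /=; set w := sqrt1Dsqr x => wp w2.
  rewrite -[X in `|_ - X|](divff (w0 x)) -mulrBl normrM normfV (gtr0_norm wp) distrC ger0_norm ?subr_ge0//.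
  rewrite ler_pdivrMr// mulrAC ler_pdivlMr// mul1r.
  have w1 : 1 <= w by nra.
  have : 0 <= (w - x) * w by rewrite mulr_ge0 ?subr_ge0// ltW.
  by rewrite -/w; nra.
- by move=> x _; have [] := dF x.
- by apply: cvg_at_right_filter; exact: cF.
- by move=> x _; rewrite derive1E; have [_ ->] := dF x.
Qed.

End more_integrals.

(** * Area of a disc *)

Section measurable_arithmetic.
Context d (T : measurableType d) (R : realType).
Implicit Types f g : T -> measurableTypeR R.

Lemma measurable_addR f g : measurable_fun setT f -> measurable_fun setT g ->
  measurable_fun setT ((fun x => f x + g x) : T -> measurableTypeR R).
Proof. exact: measurable_funD. Qed.

Lemma measurable_mulR f g : measurable_fun setT f -> measurable_fun setT g ->
  measurable_fun setT ((fun x => f x * g x) : T -> measurableTypeR R).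
Proof. exact: measurable_funM. Qed.

Lemma measurable_oppR f : measurable_fun setT f ->
  measurable_fun setT ((fun x => - f x) : T -> measurableTypeR R).
Proof. by move=> mf; exact: measurableT_comp. Qed.

Lemma measurable_expnR f n : measurable_fun setT f ->
  measurable_fun setT ((fun x => f x ^+ n) : T -> measurableTypeR R).
Proof. exact: measurable_funX. Qed.

Lemma measurable_invR f : measurable_fun setT f ->
  measurable_fun setT ((fun x => (f x)^-1) : T -> measurableTypeR R).
Proof.
move=> mf; apply: (measurableT_comp _ mf).
rewrite -(setUv [set 0 : R]); apply/measurable_funU => //.
  exact: measurableC.
split; first exact: measurable_fun_set1.
apply: open_continuous_measurable_fun; first exact: closed_openC.
by move=> x; rewrite inE/= => /eqP x0; exact: inv_continuous.
Qed.

Lemma measurable_normR f : measurable_fun setT f ->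
  measurable_fun setT ((fun x => `|f x|) : T -> measurableTypeR R).
Proof. by move=> mf; exact: measurableT_comp. Qed.

Lemma measurable_ltR f g : measurable_fun setT f -> measurable_fun setT g ->
  measurable [set x | f x < g x].
Proof.
move=> mf mg; rewrite -[X in measurable X]setTI.
have h := measurable_fun_ltr mf mg; exact: (h measurableT [set true]).
Qed.

Lemma measurable_leR f g : measurable_fun setT f -> measurable_fun setT g ->
  measurable [set x | f x <= g x].
Proof.
move=> mf mg; rewrite -[X in measurable X]setTI.
have h := measurable_fun_ler mf mg; exact: (h measurableT [set true]).
Qed.

End measurable_arithmetic.

Lemma indic_pred (T : Type) (R : pzRingType) (p : T -> bool) x :
  \1_[set x | p x] x = (p x)%:R :> R.
Proof. by rewrite indicE; congr (nat_of_bool _)%:R; apply/idP/idP; rewrite inE. Qed.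

Section area_disc.
Context (R : realType).
Local Notation mu := (@lebesgue_measure R).
Local Notation mR := (measurableTypeR R).

Lemma integral_norm_disc (b : R) : 0 < b ->
  (\int[mu]_x (`|x : R| * \1_[set x : R | `|x| < b] x)%:E = (b ^+ 2)%:E)%E.
Proof.
move=> b0.
have mnorm : measurable_fun setT ((fun x : R => `|x|) : mR -> mR).
  exact: measurable_normR.
rewrite ge0_integral_even; last 3 first.
- apply/measurable_EFinP; apply: measurable_mulR => //.
  by apply: measurable_indic; exact: measurable_ltR.
- by move=> x; rewrite lee_fin mulr_ge0.
- by move=> x; rewrite normrN !indic_pred normrN.
transitivity (2%:E * \int[mu]_(x in `[0%R, b[) (x : R)%:E)%E.
  congr (_ * _)%E; rewrite [RHS]integral_mkcond [LHS]integral_mkcond.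
  apply: eq_integral => x _; rewrite !patchE/= !mem_setE !in_itv/= andbT.
  have [x0|x0]/= := boolP (0 <= x); last by [].
  rewrite indic_pred (ger0_norm x0).
  by case: (x < b); rewrite ?mulr1 ?mulr0.
rewrite integral_itv_bndo_bndc; last by apply/measurable_EFinP.
rewrite (@continuous_FTC2 _ (fun x => x) (fun x => x ^+ 2 / 2))//.
- by rewrite -EFinB -EFinM; congr EFin; field.
- by apply: continuous_subspaceT => x; exact: cvg_id.
- have cF : continuous (fun x : R => x ^+ 2 / 2).
    by move=> x; apply: cvgM; [exact: exprn_continuous|exact: cvg_cst].
  split.
  + by move=> x _; exact: ex_derive.
  + by apply: cvg_at_right_filter; exact: cF.
  + by apply: cvg_at_left_filter; exact: cF.
- by move=> x _; rewrite derive1E derive_val /GRing.scale/=; field.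
Qed.

(** The open disc centred at [(- s, 0)], of squared radius [rho + s ^+ 2]. In this
    form the condition is affine in the pair [(s, rho)], which makes monotone
    approximation in these parameters easy. *)
Definition disc (s rho : R) : set (plane R) :=
  [set y | y.1 ^+ 2 + y.2 ^+ 2 + 2 * s * y.1 < rho].

Lemma measurable_disc s rho : measurable (disc s rho).
Proof.
apply: measurable_ltR => //; apply: measurable_addR; first apply: measurable_addR.
- by apply: measurable_expnR; exact: measurable_fst.
- by apply: measurable_expnR; exact: measurable_snd.
- by apply: measurable_mulR => //; exact: measurable_fst.
Qed.

(** After centring, the substitution [y = x * t] at fixed [x != 0] has factor [`|x|]
    and turns the disc into [x ^+ 2 * (1 + t ^+ 2) < r]. Integrating first in [x]
    leaves the integral of [r / (1 + t ^+ 2)]. *)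
Lemma area_disc (s rho : R) : 0 <= rho + s ^+ 2 ->
  area (disc s rho) = (pi * (rho + s ^+ 2))%:E.
Proof.
set r := rho + s ^+ 2; rewrite le_eqVlt => /predU1P[r0|r0].
  have -> : disc s rho = set0.
    apply/seteqP; split => // y; rewrite /disc/=.
    move: r0; rewrite /r => r0; have := sqr_ge0 (y.1 + s); have := sqr_ge0 y.2; nra.
  by rewrite /area measure0 -r0 mulr0.
have mE := measurable_disc s rho.
pose g (z : plane R) : \bar R := (\1_(disc s rho) z)%:E.
have mg : measurable_fun setT g by apply/measurable_EFinP; exact: measurable_indic.
have g0 z : (0 <= g z)%E by rewrite lee_fin.
have gE x y : g (x, y) = ((x + s) ^+ 2 + y ^+ 2 < r)%R%:R%:E.
  rewrite /g /disc indic_pred/=; congr (nat_of_bool _)%:R%:E.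
  by rewrite -(ltrD2r (s ^+ 2)) -/r; congr (_ < _); ring.
transitivity (\int[@area R]_z g z)%E.
  by rewrite /g integral_indic// setIT.
rewrite ge0_integral_area// -/r.
rewrite [LHS](@ge0_integral_affine _ 1 (- s)); last 3 first.
- by rewrite oner_eq0.
- exact: (measurable_fun_fubini_tonelli_F (m2 := mu) g mg g0).
- by move=> x; apply: integral_ge0 => y _; exact: g0.
rewrite normr1 mul1e.
pose h (z : plane R) : \bar R := (`|z.1| * \1_[set z : plane R | z.1 ^+ 2 * (1 + z.2 ^+ 2) < r] z)%:E.
have mh : measurable_fun setT h.
  apply/measurable_EFinP; apply: measurable_mulR.
    by apply: measurable_normR; exact: measurable_fst.
  apply: measurable_indic; apply: measurable_ltR => //; apply: measurable_mulR.
    by apply: measurable_expnR; exact: measurable_fst.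
  apply: measurable_addR => //; apply: measurable_expnR; exact: measurable_snd.
have h0 z : (0 <= h z)%E by rewrite lee_fin mulr_ge0.
transitivity (\int[mu]_x \int[mu]_t h (x, t))%E.
  apply: ge0_ae_eq_integral => //.
  - apply: (measurable_fun_fubini_tonelli_F (m2 := mu) (fun z : plane R => g (1 * z.1 - s, z.2))).
      apply: (measurableT_comp mg); apply/measurable_fun_pairP; split.
        apply: measurable_addR => //; apply: measurable_mulR => //; exact: measurable_fst.
      exact: measurable_snd.
    by move=> z; exact: g0.
  - exact: (measurable_fun_fubini_tonelli_F (m2 := mu) h mh h0).
  - by move=> x _; apply: integral_ge0 => y _; exact: g0.
  - by move=> x _; apply: integral_ge0 => y _; exact: h0.
  exists [set 0]; split => //; first exact: lebesgue_measure_set1.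
  move=> x/= /not_implyP[_]; apply: contra_notP => /eqP x0.
  rewrite (@ge0_integral_affine _ x 0 (fun y => g (1 * x - s, y)))//; last first.
    exact: (measurableT_comp mg (pair1_measurable _)).
  rewrite -ge0_integralZl//.
    apply: eq_integral => t _; rewrite gE /h indic_pred/= -EFinM addr0 mul1r subrK exprMn.
    by rewrite mulrDr mulr1.
  apply: (measurableT_comp mg); apply/measurable_fun_pairP; split; first exact: measurable_cst.
  by apply: measurable_addR => //; exact: measurable_mulR.
rewrite (fubini_tonelli (m1 := mu) (m2 := mu) _ mh h0).
transitivity (\int[mu]_t (r%:E * (oneDsqr t)^-1%:E))%E.
  apply: eq_integral => t _.
  have w0 := sqrt1Dsqr_gt0 t.
  pose b := Num.sqrt r / sqrt1Dsqr t.
  have b0 : 0 < b by rewrite divr_gt0// sqrtr_gt0.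
  transitivity (b ^+ 2)%:E; last first.
    by rewrite /b expr_div_n sqr_sqrtr 1?ltW// sqr_sqrt1Dsqr EFinM.
  rewrite -integral_norm_disc//; apply: eq_integral => x _.
  rewrite /h !indic_pred/=; congr (_ * (nat_of_bool _)%:R)%:E.
  have -> : (`|x| < b) = (x ^+ 2 < b ^+ 2).
    by rewrite -[x ^+ 2]real_normK ?num_real// ltr_pXn2r// nnegrE ltW.
  rewrite /b expr_div_n sqr_sqrtr 1?ltW// sqr_sqrt1Dsqr ltr_pdivlMr//.
  by rewrite ltr_pwDl// sqr_ge0.
rewrite ge0_integralZl; last 4 first.
- by [].
- apply/measurable_EFinP; apply: continuous_measurable_fun; exact: continuous_oneDsqrV.
- by move=> t _; rewrite lee_fin invr_ge0.
- by rewrite lee_fin ltW.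
rewrite ge0_integral_even; last 3 first.
- apply/measurable_EFinP; apply: continuous_measurable_fun; exact: continuous_oneDsqrV.
- by move=> t; rewrite lee_fin invr_ge0.
- by move=> t; rewrite /oneDsqr sqrrN.
by rewrite integral0y_oneDsqr -!EFinM; congr EFin; field.
Qed.

Lemma area_bounded_lty (r : R) (B : set (plane R)) :
  measurable B -> B `<=` disc 0 r -> (area B < +oo)%E.
Proof.
move=> mB Bd; have r0 : 0 <= Num.max r 0 by rewrite le_max lexx orbT.
apply: (@le_lt_trans _ _ (area (disc 0 (Num.max r 0)))); last first.
  by rewrite area_disc ?ltry// expr0n addr0.
apply: le_measure; rewrite ?inE//; first exact: measurable_disc.
by move=> x /Bd; rewrite /disc/= => h; rewrite lt_max h.
Qed.

End area_disc.

(** * The integral over pairs of stations *)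

Definition volume3 (R : realType) :
    set (measurableTypeR R * (measurableTypeR R * measurableTypeR R)) -> \bar R :=
  (@lebesgue_measure R \x @area R)%E.
HB.instance Definition _ (R : realType) := Measure.on (@volume3 R).
HB.instance Definition _ (R : realType) :=
  Measure_isSigmaFinite.Build _ _ _ (@volume3 R)
    (sigma_finite_product_measure (@lebesgue_measure R) (@area R)).

Section four_fold_integrals.
Context (R : realType).
Local Notation mu := (@lebesgue_measure R).
Local Notation mR := (measurableTypeR R).
Local Notation R3 := (mR * (mR * mR))%type.
Local Notation R4 := (mR * (mR * (mR * mR)))%type.

Lemma ge0_integral3 (f : R3 -> \bar R) :
  measurable_fun setT f -> (forall x, 0 <= f x)%E ->
  (\int[@volume3 R]_z f z =
   \int[mu]_b \int[mu]_c \int[mu]_d f (b, (c, d)))%E.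
Proof.
move=> mf f0.
rewrite /volume3 (fubini_tonelli1 (m1 := mu) (m2 := @area R) f mf f0).
apply: eq_integral => b _.
rewrite /fubini_F (fubini_tonelli1 (m1 := mu) (m2 := mu) (fun z => f (b, z)))//.
exact: (measurableT_comp mf (pair1_measurable b)).
Qed.

Lemma ge0_integral_rotate4 (f : R4 -> \bar R) :
  measurable_fun setT f -> (forall x, 0 <= f x)%E ->
  (\int[mu]_a \int[mu]_b \int[mu]_c \int[mu]_d f (a, (b, (c, d))) =
   \int[mu]_b \int[mu]_c \int[mu]_d \int[mu]_a f (a, (b, (c, d))))%E.
Proof.
move=> mf f0.
transitivity (\int[mu]_a \int[@volume3 R]_z f (a, z))%E.
  apply: eq_integral => a _; rewrite ge0_integral3//.
  exact: (measurableT_comp mf (pair1_measurable a)).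
rewrite (fubini_tonelli (m1 := mu) (m2 := @volume3 R) f mf f0) ge0_integral3//.
  exact: (measurable_fun_fubini_tonelli_G (m1 := mu) f mf f0).
by move=> z; apply: integral_ge0 => a _; exact: f0.
Qed.

Lemma ge0_integral_plane2 (f : plane R * plane R -> \bar R) :
  measurable_fun setT f -> (forall x, 0 <= f x)%E ->
  (\int[(@area R \x @area R)%E]_z f z =
   \int[mu]_a \int[mu]_b \int[mu]_c \int[mu]_d f ((a, b), (c, d)))%E.
Proof.
move=> mf f0; pose g x := (\int[@area R]_y f (x, y))%E.
have mg : measurable_fun setT g.
  exact: (measurable_fun_fubini_tonelli_F (m2 := @area R) f mf f0).
have g0 x : (0 <= g x)%E by apply: integral_ge0 => y _; exact: f0.
transitivity (\int[@area R]_x g x)%E.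
  exact: (fubini_tonelli1 (m1 := @area R) (m2 := @area R) f mf f0).
rewrite (ge0_integral_area mg g0); apply: eq_integral => a _; apply: eq_integral => b _.
rewrite /g (@ge0_integral_area _ (fun y => f ((a, b), y)))//.
exact: (measurableT_comp mf (pair1_measurable (a, b))).
Qed.

End four_fold_integrals.

Section iterated_integral4.
Context (R : realType).
Local Notation mu := (@lebesgue_measure R).
Local Notation mR := (measurableTypeR R).
Local Notation R4 := (mR * (mR * (mR * mR)))%type.
Implicit Types F : R -> R -> R -> R -> R.

(** Changes of variables act on the innermost variable of this iterated integral,
    after [iterint4_rotate] has moved the wanted one there. *)
Definition iterint4 F : \bar R :=
  (\int[mu]_a \int[mu]_b \int[mu]_c \int[mu]_d (F a b c d)%:E)%E.

Definition measurable4 F :=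
  measurable_fun setT ((fun z : R4 => F z.1 z.2.1 z.2.2.1 z.2.2.2) : R4 -> mR).

Definition nonneg4 F := forall a b c d, 0 <= F a b c d.

Lemma measurable4_comp d (T : measurableType d) F (f g h k : T -> mR) :
  measurable4 F -> measurable_fun setT f -> measurable_fun setT g ->
  measurable_fun setT h -> measurable_fun setT k ->
  measurable_fun setT ((fun x => F (f x) (g x) (h x) (k x)) : T -> mR).
Proof.
move=> mF mf mg mh mk.
apply: (@measurableT_comp _ _ _ _ _ _ _ _ (fun x => (f x, (g x, (h x, k x)))) mF).
by do 3! (apply: measurable_fun_pair => //).
Qed.

Lemma measurable4_proj : [/\ measurable_fun setT ((fun z : R4 => z.1) : R4 -> mR),
  measurable_fun setT ((fun z : R4 => z.2.1) : R4 -> mR),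
  measurable_fun setT ((fun z : R4 => z.2.2.1) : R4 -> mR) &
  measurable_fun setT ((fun z : R4 => z.2.2.2) : R4 -> mR)].
Proof.
split.
- exact: measurable_fst.
- exact: (measurableT_comp measurable_fst measurable_snd).
- exact: (measurableT_comp measurable_fst (measurableT_comp measurable_snd measurable_snd)).
- exact: (measurableT_comp measurable_snd (measurableT_comp measurable_snd measurable_snd)).
Qed.

Lemma measurable4_rotate F : measurable4 F -> measurable4 (fun b c d a => F a b c d).
Proof. by move=> mF; have [? ? ? ?] := measurable4_proj; exact: (measurable4_comp mF). Qed.

Lemma iterint4_rotate F : measurable4 F -> nonneg4 F ->
  iterint4 F = iterint4 (fun b c d a => F a b c d).
Proof.
move=> mF F0.
apply: (@ge0_integral_rotate4 R (fun z => (F z.1 z.2.1 z.2.2.1 z.2.2.2)%:E)).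
  exact/measurable_EFinP.
by move=> z; rewrite lee_fin.
Qed.

(** The slope [u] and the intercept [v] of the substitution in the innermost
    variable may depend on the outer ones; where the slope vanishes so must the
    integrand. *)
Lemma iterint4_affine F (u v : R -> R -> R -> R) : measurable4 F -> nonneg4 F ->
  (forall a b c, u a b c = 0 -> forall d, F a b c d = 0) ->
  iterint4 F = iterint4 (fun a b c d => `|u a b c| * F a b c (u a b c * d + v a b c)).
Proof.
move=> mF F0 u0; apply: eq_integral => a _; apply: eq_integral => b _.
apply: eq_integral => c _.
have mFd : measurable_fun setT (fun d => (F a b c d)%:E).
  by apply/measurable_EFinP; exact: (measurable4_comp mF).
have [/u0 F00|ne0] := eqVneq (u a b c) 0.
  by apply: eq_integral => d _; rewrite !F00 mulr0.
rewrite (@ge0_integral_affine _ (u a b c) (v a b c) (fun d => (F a b c d)%:E))//.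
  rewrite -ge0_integralZl//.
  by apply/measurable_EFinP; apply: (measurable4_comp mF) => //;
    apply: measurable_addR => //; apply: measurable_mulR.
by move=> d; rewrite lee_fin.
by move=> d; rewrite lee_fin.
Qed.

End iterated_integral4.

Section crossing_integral.
Context (R : realType).
Local Notation mu := (@lebesgue_measure R).
Local Notation mR := (measurableTypeR R).
Local Notation R4 := (mR * (mR * (mR * mR)))%type.

Definition sqnorm (y : plane R) : R := y.1 ^+ 2 + y.2 ^+ 2.

(** The user is at [(- s, 0)] at time [s], so its squared distance to [y] is
    [sqnorm y + 2 * s * y.1 + s ^+ 2]; the term [s ^+ 2] is common to all points
    and equidistance from [y] and [z] is an affine equation in [s]. *)
Definition crossing_time (y z : plane R) : R :=
  (sqnorm y - sqnorm z) / (2 * (z.1 - y.1)).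

Definition crossing_sqdist (y z : plane R) : R :=
  (y.1 + crossing_time y z) ^+ 2 + y.2 ^+ 2.

Lemma measurable_sqnorm d (T : measurableType d) (f : T -> plane R) :
  measurable_fun setT f -> measurable_fun setT ((fun x => sqnorm (f x)) : T -> mR).
Proof.
move=> mf; apply: measurable_addR; apply: measurable_expnR.
  exact: (measurableT_comp measurable_fst mf).
exact: (measurableT_comp measurable_snd mf).
Qed.

Lemma measurable_crossing_time d (T : measurableType d) (f g : T -> plane R) :
  measurable_fun setT f -> measurable_fun setT g ->
  measurable_fun setT ((fun x => crossing_time (f x) (g x)) : T -> mR).
Proof.
move=> mf mg; apply: measurable_mulR.
  apply: measurable_addR; first exact: measurable_sqnorm.
  by apply: measurable_oppR; exact: measurable_sqnorm.
apply: measurable_invR; apply: measurable_mulR => //; apply: measurable_addR.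
  exact: (measurableT_comp measurable_fst mg).
by apply: measurable_oppR; exact: (measurableT_comp measurable_fst mf).
Qed.

Lemma measurable_crossing_sqdist d (T : measurableType d) (f g : T -> plane R) :
  measurable_fun setT f -> measurable_fun setT g ->
  measurable_fun setT ((fun x => crossing_sqdist (f x) (g x)) : T -> mR).
Proof.
move=> mf mg; apply: measurable_addR; apply: measurable_expnR.
  apply: measurable_addR; first exact: (measurableT_comp measurable_fst mf).
  exact: measurable_crossing_time.
exact: (measurableT_comp measurable_snd mf).
Qed.

Variables (S : set mR) (phi : mR -> mR).
Hypotheses (mS : measurable S) (mphi : measurable_fun setT phi)
  (phi0 : forall x, 0 <= phi x).

Let G p1 q1 p2 q2 : R := \1_[set x : R | 0 < x] (p2 - p1) *
  (\1_S (crossing_time (p1, q1) (p2, q2)) * phi (crossing_sqdist (p1, q1) (p2, q2))).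

Let mG : measurable4 G.
Proof.
have [mA mB mC mD] := measurable4_proj R.
have mAB := measurable_fun_pair mA mB.
have mCD := measurable_fun_pair mC mD.
apply: measurable_mulR.
  apply: (measurableT_comp (f := \1_[set x : R | 0 < x] : mR -> mR)).
    by apply: measurable_indic; exact: measurable_ltR.
  by apply: measurable_addR => //; exact: measurable_oppR.
apply: measurable_mulR.
  apply: (measurableT_comp (f := \1_S : mR -> mR)); first exact: measurable_indic.
  exact: measurable_crossing_time.
by apply: (measurableT_comp mphi); exact: measurable_crossing_sqdist.
Qed.

Let G0 : nonneg4 G.
Proof. by move=> a b c d; rewrite /G !mulr_ge0. Qed.

(** Coordinates for a pair of points: [D] is the difference of the abscissas,
    [q1 - q2 = D * tau], [q1 + q2 = D * sigma], and the abscissa [p1] of the first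
    point enters the crossing time only as a translation. The Jacobian is
    [D ^+ 2 / 2], and the squared distance at the crossing factors as
    [D ^+ 2 * ((1 + sigma ^+ 2) * (1 + tau ^+ 2)) / 4]. *)
Definition crossing_kernel (sigma D tau : R) : R :=
  \1_[set x : R | 0 < x] D * (D ^+ 2 / 2 *
    phi (D ^+ 2 * ((1 + sigma ^+ 2) * (1 + tau ^+ 2)) / 4)).

(** The variables are replaced one at a time, each substitution being affine in
    its own variable: [q2] by [tau], [q1] by [sigma], [p2] by [D]. *)
Lemma crossing_integral_coordinates :
  iterint4 G = iterint4 (fun sigma D tau p1 =>
    crossing_kernel sigma D tau * \1_S (- p1 + (- (D / 2) + D * sigma * tau / 2))).
Proof.
have [mA mB mC mD] := measurable4_proj R.
pose F1 p1 q1 p2 tau := `|- (p2 - p1)| * G p1 q1 p2 (- (p2 - p1) * tau + q1).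
have mF1 : measurable4 F1.
  apply: measurable_mulR; first by apply: measurable_normR; apply: measurable_oppR; apply: measurable_addR => //; exact: measurable_oppR.
  apply: (measurable4_comp mG) => //; apply: measurable_addR => //; apply: measurable_mulR => //.
  by apply: measurable_oppR; apply: measurable_addR => //; exact: measurable_oppR.
have F10 : nonneg4 F1 by move=> *; apply: mulr_ge0 => //; exact: G0.
have GE p1 q1 p2 q2 : p2 - p1 = 0 -> G p1 q1 p2 q2 = 0.
  by move=> e; rewrite /G e indic_pred ltxx mul0r.
have -> : iterint4 G = iterint4 F1.
  apply: (@iterint4_affine _ G (fun p1 q1 p2 => - (p2 - p1)) (fun p1 q1 p2 => q1)) => //.
  by move=> p1 q1 p2 /eqP; rewrite oppr_eq0 => /eqP e q2; exact: GE.
rewrite (iterint4_rotate mF1 F10).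
have mF1r : measurable4 (fun b c d a => F1 a b c d) by exact: measurable4_rotate mF1.
have mF1rr : measurable4 (fun c d a b => F1 a b c d) by exact: measurable4_rotate mF1r.
rewrite (@iterint4_rotate _ (fun b c d a => F1 a b c d) mF1r (fun b c d a => F10 a b c d)).
pose F2 p2 tau p1 sigma := `|(p2 - p1) / 2| * F1 p1 ((p2 - p1) / 2 * sigma + (p2 - p1) / 2 * tau) p2 tau.
have mF2 : measurable4 F2.
  have mh : measurable_fun setT ((fun z : R4 => (z.1 - z.2.2.1) / 2) : R4 -> mR).
    by apply: measurable_mulR => //; apply: measurable_addR => //; exact: measurable_oppR.
  apply: measurable_mulR; first exact: measurable_normR.
  by apply: (measurable4_comp mF1) => //; apply: measurable_addR => //; exact: measurable_mulR.
have F20 : nonneg4 F2 by move=> *; apply: mulr_ge0.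
have -> : iterint4 (fun c d a b => F1 a b c d) = iterint4 F2.
  apply: (@iterint4_affine _ (fun c d a b => F1 a b c d) (fun p2 tau p1 => (p2 - p1) / 2)
    (fun p2 tau p1 => (p2 - p1) / 2 * tau)) => // p2 tau p1 h q1.
  by rewrite /F1 GE ?mulr0//; lra.
rewrite (iterint4_rotate mF2 F20).
have mF2r : measurable4 (fun b c d a => F2 a b c d) by exact: measurable4_rotate mF2.
rewrite (@iterint4_affine _ (fun b c d a => F2 a b c d) (fun _ _ _ => 1)
    (fun tau p1 sigma => p1) mF2r (fun b c d a => F20 a b c d)); last first.
  by move=> tau p1 sigma /eqP; rewrite oner_eq0.
set F3 := (X in iterint4 X).
have mF3 : measurable4 F3.
  apply: measurable_mulR => //.
  by apply: (measurable4_comp mF2) => //; apply: measurable_addR => //; exact: measurable_mulR.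
have F30 : nonneg4 F3 by move=> *; apply: mulr_ge0.
rewrite (iterint4_rotate mF3 F30).
have mF3r : measurable4 (fun b c d a => F3 a b c d) by exact: measurable4_rotate mF3.
rewrite (@iterint4_rotate _ (fun b c d a => F3 a b c d) mF3r (fun b c d a => F30 a b c d)).
apply: eq_integral => sigma _; apply: eq_integral => D _.
apply: eq_integral => tau _; apply: eq_integral => p1 _; congr EFin.
rewrite /F3 /F2 /F1 normr1 !mul1r addrK normrN /G addrK /crossing_kernel.
rewrite !indic_pred; have [D0|_] := ltP 0 D; last by rewrite !mul0r !mulr0.
have Dn0 : D != 0 by rewrite gt_eqF.
have -> : crossing_time (p1, D / 2 * sigma + D / 2 * tau) (D + p1, - D * tau + (D / 2 * sigma + D / 2 * tau))
    = - p1 + (- (D / 2) + D * sigma * tau / 2).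
  rewrite /crossing_time /sqnorm/= addrK.
  by field.
have -> : crossing_sqdist (p1, D / 2 * sigma + D / 2 * tau) (D + p1, - D * tau + (D / 2 * sigma + D / 2 * tau))
    = D ^+ 2 * ((1 + sigma ^+ 2) * (1 + tau ^+ 2)) / 4.
  rewrite /crossing_sqdist /crossing_time /sqnorm/= addrK.
  by field.
rewrite (gtr0_norm D0) gtr0_norm ?divr_gt0//; field.
by [].
Qed.

End crossing_integral.

Section crossing_intensity.
Context (R : realType).
Local Notation mu := (@lebesgue_measure R).
Local Notation mR := (measurableTypeR R).
Local Notation R3 := (mR * (mR * mR))%type.
Variables (a : R) (S : set mR).
Hypotheses (a0 : 0 < a) (mS : measurable S).

(** The norm keeps the function nonnegative on the whole line; on nonnegative
    arguments this is the probability that a Poisson variable of mean [m] is 1. *)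
Definition one_point_mass (m : R) := `|m| * expR (- m).

Let phi (r : mR) : mR := one_point_mass (a * r).

Let mphi : measurable_fun setT phi.
Proof.
have mar : measurable_fun setT ((fun r : mR => a * r) : mR -> mR).
  exact: measurable_mulR.
apply: measurable_mulR; first exact: measurable_normR.
by apply: (measurableT_comp (@measurable_expR R)); exact: measurable_oppR.
Qed.

Let phi0 r : 0 <= phi r. Proof. by rewrite mulr_ge0// expR_ge0. Qed.

Let K := crossing_kernel phi.

Let mK : measurable_fun setT ((fun z : R3 => K z.1 z.2.1 z.2.2) : R3 -> mR).
Proof.
have mA : measurable_fun setT ((fun z : R3 => z.1) : R3 -> mR) by exact: measurable_fst.
have mB : measurable_fun setT ((fun z : R3 => z.2.1) : R3 -> mR).
  exact: (measurableT_comp measurable_fst measurable_snd).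
have mC : measurable_fun setT ((fun z : R3 => z.2.2) : R3 -> mR).
  exact: (measurableT_comp measurable_snd measurable_snd).
apply: measurable_mulR.
  apply: (measurableT_comp (f := \1_[set x : R | 0 < x] : mR -> mR)) => //.
  by apply: measurable_indic; exact: measurable_ltR.
apply: measurable_mulR.
  by apply: measurable_mulR => //; exact: measurable_expnR.
apply: (measurableT_comp mphi); apply: measurable_mulR => //.
apply: measurable_mulR; first exact: measurable_expnR.
by apply: measurable_mulR; apply: measurable_addR => //; exact: measurable_expnR.
Qed.

Let K0 b c d : 0 <= K b c d.
Proof.
rewrite /K /crossing_kernel; apply: mulr_ge0 => //; apply: mulr_ge0; last exact: phi0.
by rewrite divr_ge0 ?sqr_ge0.
Qed.

(** The scaling [u = c * D] turns the kernel into [u ^+ 4 * expR (- u ^+ 2)] on the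
    positive half-line; [c] contains both factors [sqrt1Dsqr], and the power [-3]
    of each comes out. *)
Let integral_kernelD (sigma tau : R) :
  (\int[mu]_D (K sigma D tau)%:E =
   (3 * Num.sqrt pi / (2 * (a * Num.sqrt a)))%:E *
     ((sqrt1Dsqr sigma ^- 3)%:E * (sqrt1Dsqr tau ^- 3)%:E))%E.
Proof.
have ws := sqrt1Dsqr_gt0 sigma; have wt := sqrt1Dsqr_gt0 tau.
have sa : 0 < Num.sqrt a by rewrite sqrtr_gt0.
have asq : a = Num.sqrt a ^+ 2 by rewrite sqr_sqrtr// ltW.
pose c := Num.sqrt a * sqrt1Dsqr sigma * sqrt1Dsqr tau / 2.
have c0 : 0 < c by rewrite !mulr_gt0.
pose g (u : mR) : \bar R := (\1_[set x : R | 0 < x] u * (u ^+ 4 * expR (- u ^+ 2)))%:E.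
have mg : measurable_fun setT g.
  apply/measurable_EFinP; apply: measurable_mulR.
    by apply: measurable_indic; exact: measurable_ltR.
  apply: measurable_mulR; first exact: measurable_expnR.
  apply: (measurableT_comp (@measurable_expR R)).
  by apply: measurable_oppR; exact: measurable_expnR.
have g0 u : (0 <= g u)%E.
  rewrite lee_fin; apply: mulr_ge0 => //; apply: mulr_ge0; last exact: expR_ge0.
  by rewrite (exprM u 2 2) sqr_ge0.
have Ig : (\int[mu]_u g u = (3 * Num.sqrt pi / 8)%:E)%E.
  rewrite -integral0y_gauss4 -integral_itv_obnd_cbnd; last first.
    apply/measurable_EFinP; apply: measurable_funTS.
    apply: measurable_mulR; first exact: measurable_expnR.
    apply: (measurableT_comp (@measurable_expR R)).
    by apply: measurable_oppR; exact: measurable_expnR.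
  rewrite [RHS]integral_mkcond; apply: eq_integral => u _.
  rewrite patchE/= mem_setE in_itv/= andbT /g indic_pred.
  by case: (0 < u); rewrite ?mul1r ?mul0r.
have KE D : ((K sigma D tau)%:E = ((2 * c ^+ 2)^-1)%:E * g (c * D + 0)%R)%E.
  rewrite /K /crossing_kernel /phi /one_point_mass /g -EFinM !indic_pred addr0 pmulr_rgt0//; congr EFin.
  have -> : a * (D ^+ 2 * ((1 + sigma ^+ 2) * (1 + tau ^+ 2)) / 4) = (c * D) ^+ 2.
    by rewrite -!sqr_sqrt1Dsqr {1}asq /c; field.
  rewrite ger0_norm ?sqr_ge0//; field.
  by rewrite gt_eqF.
under eq_integral do rewrite KE.
rewrite ge0_integralZl; last 4 first.
- by [].
- apply: (measurableT_comp mg); apply: measurable_addR => //; exact: measurable_mulR.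
- by move=> D _; exact: g0.
- by rewrite lee_fin invr_ge0 mulr_ge0// sqr_ge0.
have := Ig; rewrite (@ge0_integral_affine _ c 0 g) ?gt_eqF// gtr0_norm//.
move=> /(congr1 (fun x => (c^-1)%:E * x)%E); rewrite muleA -EFinM mulVf ?gt_eqF// mul1e => ->.
rewrite -!EFinM; congr EFin; rewrite {1}asq /c; field.
by rewrite !gt_eqF.
Qed.

Let measurable_integrand : measurable_fun setT (fun z : plane R * plane R =>
  (\1_[set x : R | 0 < x] (z.2.1 - z.1.1) *
     (\1_S (crossing_time z.1 z.2) *
      one_point_mass (a * crossing_sqdist z.1 z.2)))%:E).
Proof.
apply/measurable_EFinP; apply: measurable_mulR.
  apply: (measurableT_comp (f := \1_[set x : R | 0 < x] : mR -> mR)).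
    by apply: measurable_indic; exact: measurable_ltR.
  apply: measurable_addR; first exact: (measurableT_comp measurable_fst measurable_snd).
  by apply: measurable_oppR; exact: (measurableT_comp measurable_fst measurable_fst).
apply: measurable_mulR.
  apply: (measurableT_comp (f := \1_S : mR -> mR)); first exact: measurable_indic.
  by apply: measurable_crossing_time; [exact: measurable_fst|exact: measurable_snd].
apply: (measurableT_comp mphi).
by apply: measurable_crossing_sqdist; [exact: measurable_fst|exact: measurable_snd].
Qed.

Let mw : measurable_fun setT ((fun t => (sqrt1Dsqr t ^- 3)%:E) : mR -> \bar R).
Proof.
apply/measurable_EFinP; apply: measurable_invR; apply: measurable_expnR.
by apply: continuous_measurable_fun; exact: continuous_sqrt1Dsqr.
Qed.

Let w0 (t : R) : (0 <= (sqrt1Dsqr t ^- 3)%:E)%E.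
Proof. by rewrite lee_fin invr_ge0 exprn_ge0// ltW// sqrt1Dsqr_gt0. Qed.

(** The integral in [p1] gives the measure of [S] whatever the other coordinates
    are, since the crossing time is a reflected translate of [p1]. The remaining
    triple integral is a product: a Gaussian fourth moment in [D] and twice the
    integral [2] of [sqrt1Dsqr t ^- 3], in [sigma] and in [tau]. *)
Lemma crossing_intensity :
  (\int[(@area R \x @area R)%E]_z
     (\1_[set x : R | 0 < x] (z.2.1 - z.1.1) *
      (\1_S (crossing_time z.1 z.2) *
       one_point_mass (a * crossing_sqdist z.1 z.2)))%:E =
   (6 * Num.sqrt pi / (a * Num.sqrt a))%:E * mu S)%E.
Proof.
rewrite (ge0_integral_plane2 measurable_integrand); last first.
  by move=> z; rewrite lee_fin !mulr_ge0 ?expR_ge0.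
etransitivity; first exact: (crossing_integral_coordinates mS mphi phi0).
transitivity (\int[@volume3 R]_z ((K z.1 z.2.1 z.2.2)%:E * mu S))%E.
  rewrite ge0_integral3; last 2 first.
  - by apply: emeasurable_funM => //; exact/measurable_EFinP.
  - by move=> z; rewrite mule_ge0// lee_fin.
  apply: eq_integral => sigma _; apply: eq_integral => D _; apply: eq_integral => tau _.
  under eq_integral do rewrite EFinM.
  rewrite ge0_integralZl; last 4 first.
  - by [].
  - apply/measurable_EFinP; apply: (measurableT_comp (f := \1_S : mR -> mR)).
      exact: measurable_indic.
    by apply: measurable_addR => //; exact: measurable_oppR.
  - by move=> p _; rewrite lee_fin.
  - by rewrite lee_fin K0.
  congr (_ * _)%E; rewrite -[in RHS](setIT S) -integral_indic//.
  rewrite [RHS](@ge0_integral_affine _ (-1) (- (D / 2) + D * sigma * tau / 2))//; last first.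
    by apply/measurable_EFinP; exact: measurable_indic.
  by rewrite normrN1 mul1e; apply: eq_integral => p _; rewrite mulN1r.
rewrite ge0_integralZr//; last 2 first.
- exact/measurable_EFinP.
- by move=> z _; rewrite lee_fin.
congr (_ * _)%E.
rewrite (@ge0_integral3 _ (fun z : R3 => (K z.1 z.2.1 z.2.2)%:E)); last 2 first.
- exact/measurable_EFinP.
- by move=> z; rewrite lee_fin.
pose k := 3 * Num.sqrt pi / (2 * (a * Num.sqrt a)).
have k0 : 0 <= k.
  by rewrite divr_ge0 ?mulr_ge0 ?sqrtr_ge0// ltW.
transitivity (\int[mu]_sigma ((k * 2)%:E * (sqrt1Dsqr sigma ^- 3)%:E))%E.
  apply: eq_integral => sigma _.
  rewrite (fubini_tonelli (m1 := mu) (m2 := mu) (fun z : mR * mR => (K sigma z.1 z.2)%:E)); last 2 first.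
  - by apply/measurable_EFinP; exact: (measurableT_comp mK (pair1_measurable sigma)).
  - by move=> z; rewrite lee_fin.
  under eq_integral do rewrite integral_kernelD muleA.
  rewrite ge0_integralZl; last 4 first.
  - by [].
  - exact: mw.
  - by [].
  - by rewrite mule_ge0.
  by rewrite integral_sqrt1DsqrVX3 muleAC -EFinM.
rewrite ge0_integralZl; last 4 first.
- by [].
- exact: mw.
- by [].
- by rewrite lee_fin mulr_ge0.
rewrite integral_sqrt1DsqrVX3 -EFinM; congr EFin; rewrite /k; field.
by rewrite !gt_eqF// sqrtr_gt0.
Qed.

End crossing_intensity.

(** * Products of independent discrete variables *)

Lemma nneseries_mull (R : realType) (c : \bar R) (f : nat -> \bar R) :
  (0 <= c)%E -> (forall m, 0 <= f m)%E ->
  (\sum_(0 <= m <oo) (c * f m) = c * \sum_(0 <= m <oo) f m)%E.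
Proof.
move=> c0 f0; case: c c0 => [r|_|//]; first by move=> _; rewrite nneseriesZl.
have [h|/existsNP[m0 hm0]] := pselect (forall m, f m = 0%E).
  by rewrite !eseries0// => [|m _ _]; rewrite ?mule0 ?h ?mule0.
have fm0 : (0 < f m0)%E by rewrite lt_neqAle f0 andbT eq_sym; apply/eqP.
have le (g : nat -> \bar R) : (forall m, 0 <= g m)%E -> (g m0 <= \sum_(0 <= m <oo) g m)%E.
  move=> g0; rewrite (@nneseriesD1 _ _ m0)//.
  by rewrite leeDl//; exact: nneseries_ge0.
rewrite [RHS]gt0_mulye; last by rewrite (lt_le_trans fm0)// le.
apply/eqP; rewrite eq_le leey/=; apply: le_trans (le _ _); first by rewrite gt0_mulye.
by move=> m; rewrite mule_ge0.
Qed.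

Section independent_products.
Context d (Omega : measurableType d) (R : realType) (P : probability Omega R).

Lemma emeasurable_prod (I : Type) (s : seq I) (Q : pred I) (h : I -> Omega -> \bar R) :
  (forall i, Q i -> measurable_fun setT (h i)) ->
  measurable_fun setT (fun w => \prod_(i <- s | Q i) h i w)%E.
Proof.
move=> mh; elim: s => [|i s IH].
  by under eq_fun do rewrite big_nil; exact: measurable_cst.
have [Qi|nQi] := boolP (Q i).
  under eq_fun do rewrite big_cons Qi.
  by apply: emeasurable_funM => //; exact: mh.
by under eq_fun do rewrite big_cons (negbTE nQi).
Qed.

Lemma prod_indic (I : finType) (E : I -> set Omega) w :
  (\prod_(i : I) (\1_(E i) w : R)%:E = (\1_(\bigcap_i E i) w)%:E)%E.
Proof.
have [h|h] := pselect (forall i, E i w).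
  rewrite [in RHS]indicE mem_set; last by move=> i _; exact: h.
  by apply: big1 => i _; rewrite indicE mem_set//; exact: h.
have /existsNP[i hi] := h.
rewrite (bigD1 i)//= indicE memNset// mul0e indicE memNset//.
by move=> /(_ i Logic.I); exact: hi.
Qed.

(** When the sets [F m] partition the space, this is the function equal to [a m]
    on [F m]. *)
Definition discrete_fun (a : nat -> R) (F : nat -> set Omega) (w : Omega) : \bar R :=
  (\sum_(0 <= m <oo) (a m)%:E * (\1_(F m) w)%:E)%E.

Lemma measurable_discrete_fun a F : (forall m, 0 <= a m) ->
  (forall m, measurable (F m)) -> measurable_fun setT (discrete_fun a F).
Proof.
move=> a0 mF; apply: ge0_emeasurable_sum => [m w _|m _].
  by rewrite mule_ge0 ?lee_fin.
by apply: measurable_funeM; apply/measurable_EFinP; exact: measurable_indic.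
Qed.

Lemma discrete_fun_ge0 a F w : (forall m, 0 <= a m) -> (0 <= discrete_fun a F w)%E.
Proof. by move=> a0; apply: nneseries_ge0 => m _ _; rewrite mule_ge0 ?lee_fin. Qed.

Lemma integral_discrete_fun a F : (forall m, 0 <= a m) ->
  (forall m, measurable (F m)) ->
  (\int[P]_w discrete_fun a F w = \sum_(0 <= m <oo) (a m)%:E * P (F m))%E.
Proof.
move=> a0 mF; rewrite integral_nneseries//; last 2 first.
- by move=> m; apply: measurable_funeM; apply/measurable_EFinP; exact: measurable_indic.
- by move=> m w _; rewrite mule_ge0 ?lee_fin.
apply: eq_eseriesr => m _; rewrite ge0_integralZl; last 4 first.
- by [].
- by apply/measurable_EFinP; exact: measurable_indic.
- by move=> w _; rewrite lee_fin.
- by rewrite lee_fin.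
by rewrite integral_indic// setIT.
Qed.

Lemma integral_mul_discrete_fun (W : Omega -> \bar R) (c : \bar R) a F :
  measurable_fun setT W -> (forall w, 0 <= W w)%E -> (0 <= c)%E ->
  (forall m, 0 <= a m) -> (forall m, measurable (F m)) ->
  (forall m, \int[P]_w (W w * (\1_(F m) w)%:E) = c * P (F m))%E ->
  (\int[P]_w (W w * discrete_fun a F w) = c * \int[P]_w discrete_fun a F w)%E.
Proof.
move=> mW W0 c0 a0 mF WF.
rewrite integral_discrete_fun// -nneseries_mull//; last by move=> m; rewrite mule_ge0 ?lee_fin.
transitivity (\int[P]_w \sum_(0 <= m <oo) ((a m)%:E * (W w * (\1_(F m) w)%:E)))%E.
  apply: eq_integral => w _; rewrite -nneseries_mull//; last by move=> m; rewrite mule_ge0 ?lee_fin.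
  by apply: eq_eseriesr => m _; rewrite muleCA.
have mWF m : measurable_fun setT (fun w => W w * (\1_(F m) w)%:E)%E.
  by apply: emeasurable_funM => //; apply/measurable_EFinP; exact: measurable_indic.
have WF0 m w : (0 <= W w * (\1_(F m) w)%:E)%E by rewrite mule_ge0 ?lee_fin.
rewrite integral_nneseries//; last 2 first.
- by move=> m; exact: measurable_funeM.
- by move=> m w _; rewrite mule_ge0 ?lee_fin.
apply: eq_eseriesr => m _; rewrite ge0_integralZl//; last by rewrite lee_fin.
by rewrite WF muleCA.
Qed.

(** The product rule for events extends to discrete functions one factor at a
    time: the induction on [k] has the first [k] factors equal to the functions
    and the others equal to indicators of events. *)
Lemma integral_prod_discrete_fun n (G : 'I_n -> set_system Omega)
    (a : 'I_n -> nat -> R) (F : 'I_n -> nat -> set Omega) :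
  mutually_independent P G -> (forall i A, G i A -> measurable A) ->
  (forall i m, 0 <= a i m) -> (forall i m, G i (F i m)) ->
  (forall i, G i setT) ->
  (\int[P]_w \prod_(i < n) discrete_fun (a i) (F i) w =
   \prod_(i < n) \int[P]_w discrete_fun (a i) (F i) w)%E.
Proof.
move=> indG mG a0 GF GT.
have mF i m : measurable (F i m) by exact: mG (GF i m).
pose f i w := discrete_fun (a i) (F i) w.
have f0 i w : (0 <= f i w)%E by exact: discrete_fun_ge0.
have mf i : measurable_fun setT (f i) by exact: measurable_discrete_fun.
suff H k (E : 'I_n -> set Omega) : (k <= n)%N -> (forall i, G i (E i)) ->
  (\int[P]_w \prod_(i < n) (if (i < k)%N then f i w else (\1_(E i) w)%:E) =
   \prod_(i < n) (if (i < k)%N then \int[P]_w f i w else P (E i)))%E.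
  have := H n (fun=> setT) (leqnn n) GT.
  under eq_integral do under eq_bigr do rewrite ltn_ord.
  by under [in RHS]eq_bigr do rewrite ltn_ord.
elim: k E => [E _ GE|k IH E kn GE].
  rewrite /=; under eq_integral do rewrite prod_indic.
  have mE : measurable (\bigcap_i E i).
    by apply: fin_bigcap_measurable => // i _; exact: mG.
  rewrite integral_indic// setIT.
  pose J := [fset i | i in enum 'I_n]%fset.
  have JT i : i \in J by rewrite /J !inE/= mem_enum.
  have := indG J E (fun i _ => GE i).
  rewrite (perm_big (index_enum 'I_n)); last first.
    apply: uniq_perm; [exact: fset_uniq|exact: index_enum_uniq|].
    by move=> i; rewrite mem_index_enum; exact: JT.
  move=> <-; congr (P _); apply/seteqP; split => w h i _;
    [exact: (h i Logic.I)|exact: (h i (JT i))].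
pose i0 := Ordinal kn.
have splitp (u v : 'I_n -> \bar R) : (\prod_(i < n) (if (i < k.+1)%N then u i else v i) =
   (\prod_(i < n | i != i0) (if (i < k)%N then u i else v i)) * u i0)%E.
  rewrite (bigD1 i0)//= ltnSn muleC; congr (_ * _)%E; apply: eq_bigr => i ii0.
  by rewrite ltnS leq_eqVlt -[k]/(nat_of_ord i0) (inj_eq val_inj) (negbTE ii0).
have splitq (u v : 'I_n -> \bar R) : (\prod_(i < n) (if (i < k)%N then u i else v i) =
   (\prod_(i < n | i != i0) (if (i < k)%N then u i else v i)) * v i0)%E.
  by rewrite (bigD1 i0)//= ltnn muleC.
rewrite splitp; under eq_integral do rewrite splitp.
apply: integral_mul_discrete_fun => //.
- apply: emeasurable_prod => // i _; case: (i < k)%N => //.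
  by apply/measurable_EFinP; apply: measurable_indic; exact: mG.
- by move=> w; apply: prode_ge0 => i _; case: ifPn => // _; rewrite lee_fin.
- by apply: prode_ge0 => i _; case: ifPn => // _; exact: integral_ge0.
move=> m; pose E' i := if i == i0 then F i0 m else E i.
have E'0 : E' i0 = F i0 m by rewrite /E' eqxx.
have GE' i : G i (E' i) by rewrite /E'; case: eqP => // ->.
have := IH E' (ltnW kn) GE'.
rewrite splitq E'0 => IHE.
transitivity (\int[P]_w
    \prod_(i < n) (if (i < k)%N then f i w else (\1_(E' i) w)%:E))%E.
  apply: eq_integral => w _; rewrite splitq E'0; congr (_ * _)%E.
  by apply: eq_bigr => i ii0; rewrite /E' (negbTE ii0).
rewrite IHE; congr (_ * _)%E.
by apply: eq_bigr => i ii0; rewrite /E' (negbTE ii0).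
Qed.

End independent_products.

(** * Counting the points of a process *)

Section counting_points.
Context d (Omega : measurableType d) (R : realType).
Variable Y : nat -> Omega -> plane R.
Hypothesis mY : forall i, measurable_fun setT (Y i).

Lemma point_measureE w B :
  point_measure Y w B = (\sum_(0 <= i <oo) (\1_B (Y i w))%:E)%E.
Proof. by []. Qed.

Lemma measurable_indic_point B i : measurable B ->
  measurable_fun setT (fun w => (\1_B (Y i w))%:E : \bar R).
Proof.
move=> mB; apply/measurable_EFinP.
apply: (measurableT_comp (f := \1_B : plane R -> measurableTypeR R)); last exact: mY.
exact: measurable_indic.
Qed.

Lemma measurable_point_measure B : measurable B ->
  measurable_fun setT (fun w => point_measure Y w B).
Proof.
move=> mB; apply: ge0_emeasurable_sum => [i w _|i _].
  by rewrite lee_fin.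
exact: measurable_indic_point.
Qed.

Definition count_eq B k := [set w | point_measure Y w B = k%:R%:E].

Lemma sigma_rv_count_eq B k :
  sigma_rv (T' := \bar R) (fun w => point_measure Y w B) (count_eq B k).
Proof. by exists [set k%:R%:E] => //; rewrite setTI. Qed.

Lemma measurable_count_eq B k : measurable B -> measurable (count_eq B k).
Proof.
move=> mB; rewrite -[X in measurable X]setTI.
exact: (measurable_point_measure mB measurableT (emeasurable_set1 k%:R%:E)).
Qed.

(** Counting among the first [n] points of the enumeration gives natural numbers,
    whose supremum is the possibly infinite value of the point measure. *)
Definition first_points (B : set (plane R)) (w : Omega) (n : nat) : nat := (\sum_(0 <= i < n) (Y i w \in B))%N.

Lemma first_pointsE B w n :
  (first_points B w n)%:R%:E = (\sum_(0 <= i < n) (\1_B (Y i w))%:E)%E :> \bar R.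
Proof. by rewrite /first_points natr_sum -sumEFin. Qed.

Lemma nd_first_points B w : nondecreasing_seq (first_points B w).
Proof.
move=> m n mn; rewrite /first_points (big_cat_nat (leq0n m) mn)/=.
exact: leq_addr.
Qed.

Lemma first_points_le B w n :
  ((first_points B w n)%:R%:E <= point_measure Y w B)%E.
Proof. by rewrite first_pointsE; apply: nneseries_lim_ge => i _; rewrite lee_fin. Qed.

Lemma count_eq_near B w k : count_eq B k w ->
  exists n0, forall n, (n0 <= n)%N -> first_points B w n = k.
Proof.
move=> Bk; have le n : (first_points B w n <= k)%N.
  by have := first_points_le B w n; rewrite Bk lee_fin ler_nat.
have [[n0 n0k]|none] := pselect (exists n0, first_points B w n0 = k).
  by exists n0 => n /(nd_first_points B w); rewrite n0k => kn; apply/eqP; rewrite eqn_leq le.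
have lt n : (first_points B w n < k)%N.
  by rewrite ltn_neqAle le andbT; apply/eqP => h; apply: none; exists n.
have : (point_measure Y w B <= k.-1%:R%:E)%E.
  apply: lime_le; first by apply: is_cvg_nneseries => i _ _; rewrite lee_fin.
  apply: nearW => n; rewrite -first_pointsE lee_fin ler_nat.
  by have := lt n; case: (k).
rewrite Bk lee_fin ler_nat => kk; exfalso; move: kk (lt 0%N).
by case: (k) => // m; rewrite ltnn.
Qed.

Lemma discrete_fun_count B (c : nat -> R) w k : (forall m, 0 <= c m) ->
  count_eq B k w -> discrete_fun c (count_eq B) w = (c k)%:E.
Proof.
move=> c0 Bk; have other m : m != k -> \1_(count_eq B m) w = 0 :> R.
  move=> mk; rewrite indicE memNset//= => Bm; move: mk; apply/negP; rewrite negbK.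
  by move: Bk; rewrite /count_eq/= Bm => -[] /eqP; rewrite eqr_nat.
rewrite /discrete_fun (@nneseriesD1 _ _ k)//; last by move=> m _; rewrite mule_ge0 ?lee_fin.
rewrite eseries0 ?adde0 => [|m _ /= mk]; last by rewrite other// mule0.
by rewrite indicE mem_set// mule1.
Qed.

End counting_points.

Section poisson_pgf.
Context d (Omega : measurableType d) (R : realType) (P : probability Omega R).
Variables (lambda : R) (X : nat -> {RV P >-> plane R}).
Hypotheses (lambda_ge0 : 0 <= lambda) (X_poisson : is_poisson_point_process lambda X).

Let mX i : measurable_fun setT (X i). Proof. by []. Qed.

Definition mean_count (B : set (plane R)) : R := lambda * fine (area B).

Lemma mean_count_ge0 B : 0 <= mean_count B.
Proof. by rewrite mulr_ge0// fine_ge0. Qed.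

Lemma expR_eseries (x : R) : 0 <= x ->
  (\sum_(0 <= n <oo) (x ^+ n / n`!%:R)%:E = (expR x)%:E)%E.
Proof.
move=> x0; rewrite expRE -EFin_lim; last first.
  rewrite /pseries/=; under eq_fun do rewrite mulrC.
  exact: is_cvg_series_exp_coeff.
apply/congr_lim/funext => n/=; rewrite /pseries/= /series/= -sumEFin//.
by under eq_bigr do rewrite mulrC.
Qed.

(** The exponential series of the generating function of the Poisson law. *)
Lemma integral_pgf_count B (c : R) : measurable B -> (area B < +oo)%E -> 0 <= c ->
  (\int[P]_w discrete_fun (fun m => c ^+ m)%R (count_eq X B) w =
   (expR (- ((1 - c) * mean_count B)))%:E)%E.
Proof.
move=> mB fB c0; rewrite integral_discrete_fun; last 2 first.
- by move=> m; exact: exprn_ge0.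
- by move=> m; exact: measurable_count_eq.
have m0 := mean_count_ge0 B.
transitivity (\sum_(0 <= m <oo) (expR (- mean_count B))%:E *
    (((c * mean_count B) ^+ m / m`!%:R))%:E)%E.
  apply: eq_eseriesr => m _.
  have [/(_ B mB fB m)/= -> _] := X_poisson.
  rewrite -!EFinM /mean_count !exprMn; congr EFin; ring.
rewrite nneseriesZl; last first.
  by move=> m _; rewrite lee_fin divr_ge0// exprn_ge0// mulr_ge0.
have cm0 : 0 <= c * mean_count B by exact: mulr_ge0.
rewrite (expR_eseries cm0) -EFinM -expRD; congr (expR _)%:E; ring.
Qed.

Definition finite_count B := \bigcup_k count_eq X B k.

(** The Poisson masses sum to 1, by [integral_pgf_count] at [c = 1]. *)
Lemma finite_count_ae B : measurable B -> (area B < +oo)%E ->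
  P (~` finite_count B) = 0.
Proof.
move=> mB fB; have mF k := measurable_count_eq mX k mB.
have mU : measurable (finite_count B) by exact: bigcupT_measurable.
rewrite probability_setC// /finite_count measure_bigcup//; last first.
  apply/trivIsetP => i j _ _ ij; apply/seteqP; split => // w []; rewrite /count_eq/= => e1 e2.
  by move: e1; rewrite e2 => -[] /eqP; rewrite eqr_nat eq_sym (negbTE ij).
have := integral_pgf_count mB fB ler01.
rewrite integral_discrete_fun; last 2 first.
- by move=> m; exact: exprn_ge0.
- by move=> m; exact: mF.
rewrite subrr mul0r oppr0 expR0.
move=> h; rewrite (_ : (\sum_(_ <= _ <oo | _) _)%E = 1%E) ?subee// -h.
rewrite (@eq_eseriesl _ _ xpredT); last by move=> k; rewrite in_setT.
by apply: eq_eseriesr => m _; rewrite expr1n mul1e.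
Qed.

End poisson_pgf.

(** * The generating functional of a Poisson process *)

Section step_functions.
Context (R : realType) (T : Type) (n : nat).
Variables (K : 'I_n -> set T) (c : 'I_n -> R).

(** With disjoint sets [K j] this is the function equal to [c j] on [K j] and to [1]
    elsewhere. The product form makes [prod_step_fun] an exchange of products. *)
Definition step_fun (x : T) : R := \prod_(j < n) (if x \in K j then c j else 1).

Lemma step_fun_in j x : trivIset setT K -> K j x -> step_fun x = c j.
Proof.
move=> tK Kx; rewrite /step_fun (bigD1 j)//= mem_set// big1 ?mulr1// => i ij.
rewrite memNset// => Kix; move/trivIsetP : tK => /(_ i j Logic.I Logic.I ij).
by apply/eqP/set0P; exists x.
Qed.

Lemma step_fun_out x : (forall j, ~ K j x) -> step_fun x = 1.
Proof. by move=> nK; rewrite /step_fun big1// => j _; rewrite memNset//; exact: nK. Qed.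

Lemma one_sub_step_fun x : trivIset setT K ->
  1 - step_fun x = \sum_(j < n) (1 - c j) * \1_(K j) x.
Proof.
move=> tK; have [[j Kx]|nK] := pselect (exists j, K j x).
  rewrite (step_fun_in tK Kx) (bigD1 j)//= indicE mem_set// mulr1 big1 ?addr0// => i ij.
  rewrite indicE memNset ?mulr0// => Kix.
  move/trivIsetP : tK => /(_ i j Logic.I Logic.I ij).
  by apply/eqP/set0P; exists x.
rewrite step_fun_out; last by move=> j Kx; apply: nK; exists j.
rewrite subrr big1// => j _; rewrite indicE memNset ?mulr0// => Kx.
by apply: nK; exists j.
Qed.

Lemma step_fun_ge0 x : (forall j, 0 <= c j) -> 0 <= step_fun x.
Proof. by move=> c0; apply: prodr_ge0 => j _; case: ifPn. Qed.

Lemma step_fun_le1 x : (forall j, 0 <= c j <= 1) -> step_fun x <= 1.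
Proof.
move=> c01; apply: prodr_ile1 => j _; case: ifPn => // _.
by rewrite ler01 lexx.
Qed.

End step_functions.

Section step_functions_on_the_plane.
Context (R : realType) (n : nat) (K : 'I_n -> set (plane R)) (c : 'I_n -> R).

Lemma prod_step_fun d (Omega : measurableType d) (Y : nat -> Omega -> plane R) w N :
  \prod_(i < N) step_fun K c (Y i w) = \prod_(j < n) c j ^+ first_points Y (K j) w N.
Proof.
rewrite exchange_big/=; apply: eq_bigr => j _; rewrite /first_points big_mkord.
elim: N => [|N IH]; first by rewrite !big_ord0 expr0.
by rewrite !big_ord_recr/= IH exprD; congr (_ * _); case: (_ \in _).
Qed.

Hypotheses (mK : forall j, measurable (K j)) (tK : trivIset setT K).

Lemma measurable_step_fun : measurable_fun setT (step_fun K c).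
Proof.
rewrite (_ : step_fun K c = fun x => 1 - \sum_(j < n) (1 - c j) * \1_(K j) x); last first.
  by apply/funext => x; rewrite -one_sub_step_fun// subKr.
apply: measurable_funB => //; apply: measurable_sum => j.
by apply: measurable_funM => //; exact: measurable_indic.
Qed.

Hypotheses (fK : forall j, (area (K j) < +oo)%E) (c01 : forall j, 0 <= c j <= 1).

Lemma integral_one_sub_step_fun :
  (\int[@area R]_x (1 - step_fun K c x)%:E =
   (\sum_(j < n) (1 - c j) * fine (area (K j)))%:E)%E.
Proof.
under eq_integral do rewrite one_sub_step_fun// -sumEFin.
rewrite ge0_integral_sum; last 3 first.
- by [].
- move=> j; apply/measurable_EFinP; apply: measurable_funM => //; exact: measurable_indic.
- by move=> j x _; rewrite lee_fin mulr_ge0// subr_ge0; have /andP[] := c01 j.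
rewrite -sumEFin; apply: eq_bigr => j _.
under eq_integral do rewrite EFinM.
rewrite ge0_integralZl; last 4 first.
- by [].
- by apply/measurable_EFinP; exact: measurable_indic.
- by move=> x _; rewrite lee_fin.
- by rewrite lee_fin subr_ge0; have /andP[] := c01 j.
by rewrite integral_indic// setIT EFinM fineK// ge0_fin_numE.
Qed.

End step_functions_on_the_plane.

Section step_pgfl.
Context d (Omega : measurableType d) (R : realType) (P : probability Omega R).
Variables (lambda : R) (X : nat -> {RV P >-> plane R}).
Hypotheses (lambda_ge0 : 0 <= lambda) (X_poisson : is_poisson_point_process lambda X).
Variables (n : nat) (K : 'I_n -> set (plane R)) (c : 'I_n -> R).
Hypotheses (mK : forall j, measurable (K j)) (fK : forall j, (area (K j) < +oo)%E)
  (tK : trivIset setT K) (c01 : forall j, 0 <= c j <= 1).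

Let mX i : measurable_fun setT (X i). Proof. by []. Qed.

(** The partial products converge to the product of the [c j] raised to the counts
    of the [K j], which are independent; each factor has mean given by
    [integral_pgf_count]. *)
Lemma step_pgfl :
  (fun N => \int[P]_w (\prod_(i < N) step_fun K c (X i w))%:E)%E @ \oo -->
  (expR (- \sum_(j < n) (1 - c j) * mean_count lambda (K j)))%:E.
Proof.
have c0 j : 0 <= c j by have /andP[] := c01 j.
pose phi w := (\prod_(j < n) discrete_fun (fun m => c j ^+ m)%R (count_eq X (K j)) w)%E.
have -> : (expR (- \sum_(j < n) (1 - c j) * mean_count lambda (K j)))%:E =
    (\int[P]_w phi w)%E.
  rewrite /phi (@integral_prod_discrete_fun _ _ _ P n
     (fun j => sigma_rv (T' := \bar R) (fun w => point_measure X w (K j)))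
     (fun j m => c j ^+ m) (fun j => count_eq X (K j))).
  - rewrite (eq_bigr (fun j => (expR (- ((1 - c j) * mean_count lambda (K j))))%:E)).
      by rewrite -sumrN expR_sum -prodEFin.
    by move=> j _; exact: integral_pgf_count.
  - by have [_ /(_ n K mK tK)] := X_poisson.
  - move=> j A [B mB <-]; exact: (measurable_point_measure mX (mK j) measurableT).
  - by move=> j m; rewrite exprn_ge0.
  - by move=> j m; exact: sigma_rv_count_eq.
  - by move=> j; exists setT => //; rewrite setTI preimage_setT.
have [] // := @dominated_convergence _ _ _ P setT measurableT
  (fun N w => (\prod_(i < N) step_fun K c (X i w))%:E) phi (fun=> 1%E).
- move=> N; apply/measurable_EFinP; apply: measurable_prod => i _.
  exact: (measurableT_comp (measurable_step_fun c mK tK) (mX i)).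
- apply: emeasurable_prod => j _; apply: measurable_discrete_fun => m.
    by rewrite exprn_ge0.
  exact: measurable_count_eq.
- have : \forall w \ae P, forall k, forall h : (k < n)%N, finite_count X (K (Ordinal h)) w.
    apply: ae_foralln => k; have [h|h] := pselect (k < n)%N; last first.
      by apply: aeW => w h'; exfalso; exact: h.
    have mF : measurable (finite_count X (K (Ordinal h))).
      by apply: bigcupT_measurable => m; exact: measurable_count_eq.
    exists (~` finite_count X (K (Ordinal h))); split.
    - exact: measurableC.
    - exact: (finite_count_ae lambda_ge0 X_poisson (mK _) (fK _)).
    - move=> w /= nall fw; apply: nall => h'.
      by rewrite (_ : Ordinal h' = Ordinal h)//; exact: val_inj.
  apply: filterS => w fin _.
  have /choice[k kP] : forall j, exists k, count_eq X (K j) k w.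
    move=> j; have [k _ kw] := fin j (ltn_ord j); exists k.
    by move: kw; rewrite (_ : Ordinal _ = j)//; exact: val_inj.
  have -> : phi w = (\prod_(j < n) c j ^+ k j)%:E.
    rewrite /phi -prodEFin; apply: eq_bigr => j _.
    by rewrite (discrete_fun_count _ (kP j))// => m; exact: exprn_ge0.
  have /choice[n0 n0P] : forall j, exists n0, forall N, (n0 <= N)%N ->
      first_points X (K j) w N = k j.
    by move=> j; exact: count_eq_near (kP j).
  apply: cvg_near_cst; exists (\max_j n0 j)%N => // N /= nN.
  rewrite (@prod_step_fun R n K c _ _ (fun i => X i)); congr EFin; apply: eq_bigr => j _; rewrite n0P//.
  by rewrite (leq_trans _ nN)//; exact: leq_bigmax.
- exact: finite_measure_integrable_cst.
- apply: aeW => w N _; rewrite lee_fin ger0_norm; last first.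
    by apply: prodr_ge0 => i _; exact: step_fun_ge0.
  apply: prodr_ile1 => i _; rewrite step_fun_ge0//=; exact: step_fun_le1.
Qed.

End step_pgfl.

Section poisson_pgfl.
Context d (Omega : measurableType d) (R : realType) (P : probability Omega R).
Variables (lambda : R) (X : nat -> {RV P >-> plane R}).
Hypotheses (lambda_ge0 : 0 <= lambda) (X_poisson : is_poisson_point_process lambda X).
Variables (g : plane R -> R) (K : set (plane R)).
Hypotheses (mg : measurable_fun setT g) (g01 : forall x, 0 <= g x <= 1)
  (mK : measurable K) (fK : (area K < +oo)%E) (gK : forall x, ~ K x -> g x = 1).

Let k := fine (area K).
Let kE : area K = k%:E. Proof. by rewrite fineK// ge0_fin_numE. Qed.

Let mX i : measurable_fun setT (X i). Proof. by []. Qed.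

Let int1g := (\int[@area R]_x (1 - g x)%:E)%E.

Let m1g (h : plane R -> R) : measurable_fun setT h ->
  measurable_fun setT (fun x => (1 - h x)%:E : \bar R).
Proof. by move=> mh; apply/measurable_EFinP; exact: measurable_funB. Qed.

Let integral_indicK (e : R) : 0 <= e ->
  (\int[@area R]_x (e * \1_K x)%:E = (e * k)%:E)%E.
Proof.
move=> e0; under eq_integral do rewrite EFinM.
rewrite ge0_integralZl; last 4 first.
- by [].
- by apply/measurable_EFinP; exact: measurable_indic.
- by move=> x _; rewrite lee_fin.
- by rewrite lee_fin.
rewrite integral_indic// setIT EFinM; congr (_ * _)%E; exact: kE.
Qed.

Let int1g_fin : int1g \is a fin_num.
Proof.
rewrite ge0_fin_numE; last first.
  by apply: integral_ge0 => x _; rewrite lee_fin subr_ge0; have /andP[] := g01 x.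
apply: (@le_lt_trans _ _ (1 * k)%:E); last by rewrite ltry.
rewrite -integral_indicK//; apply: ge0_le_integral => //.
- by move=> x _; rewrite lee_fin subr_ge0; have /andP[] := g01 x.
- exact: m1g.
- by apply/measurable_EFinP; apply: measurable_funM => //; exact: measurable_indic.
- move=> x _; rewrite lee_fin mul1r; have [Kx|Kx] := pselect (K x).
    by rewrite indicE mem_set// gerBl; have /andP[] := g01 x.
  by rewrite gK// subrr.
Qed.

Let I := fine int1g.
Let IE : int1g = I%:E. Proof. by rewrite fineK. Qed.

Section cells.
Variable m : nat.
(** Level sets of [g] on a grid of mesh [m.+1%:R^-1]; the value [1] falls in the
    last one, hence [m.+2] of them. *)
Let cell (j : 'I_m.+2) := K `&` [set x | j%:R <= m.+1%:R * g x < j.+1%:R].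

Let mcell j : measurable (cell j).
Proof.
apply: measurableI => //.
rewrite (_ : [set x | _] = [set x | j%:R <= m.+1%:R * g x] `&`
    [set x | m.+1%:R * g x < j.+1%:R]).
  have mmg : measurable_fun setT ((fun x => m.+1%:R * g x) : plane R -> measurableTypeR R).
    exact: measurable_mulR.
  by apply: measurableI; [exact: measurable_leR|exact: measurable_ltR].
by apply/seteqP; split => x /= => [/andP[]|[-> ->]].
Qed.

Let fcell j : (area (cell j) < +oo)%E.
Proof.
apply: le_lt_trans fK; apply: le_measure; rewrite ?inE//; exact: subIsetl.
Qed.

Let tcell : trivIset setT cell.
Proof.
apply/trivIsetP => i j _ _; apply: contra_neqP => /eqP/set0P[x [[_ /= /andP[i1 i2]] [_ /= /andP[j1 j2]]]].
apply: val_inj => /=; apply/eqP; rewrite eqn_leq -ltnS -(@ltr_nat R) (le_lt_trans i1 j2)/=.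
by rewrite -ltnS -(@ltr_nat R) (le_lt_trans j1 i2).
Qed.

Let cellP x : K x -> exists j, cell j x.
Proof.
move=> Kx; have /andP[g0 g1] := g01 x.
have mg0 : 0 <= m.+1%:R * g x by rewrite mulr_ge0.
have /andP[t1 t2] := truncn_itv mg0.
have tm : (Num.truncn (m.+1%:R * g x) < m.+2)%N.
  by rewrite ltnS -(@ler_nat R) (le_trans t1)// ler_piMr.
by exists (Ordinal tm); split => //=; rewrite t1.
Qed.

Let low (j : 'I_m.+2) : R := j%:R / m.+1%:R.
Let high (j : 'I_m.+2) : R := Num.min 1 (j.+1%:R / m.+1%:R).

Let low01 j : 0 <= low j <= 1.
Proof. by rewrite divr_ge0//= ler_pdivrMr// mul1r ler_nat -ltnS. Qed.

Let high01 j : 0 <= high j <= 1.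
Proof. by rewrite ge_min lexx/= le_min ler01 divr_ge0. Qed.

Let low_le x : step_fun cell low x <= g x <= step_fun cell low x + m.+1%:R^-1 * \1_K x.
Proof.
have [Kx|Kx] := pselect (K x); last first.
  rewrite step_fun_out ?gK// => [|j []//].
  by rewrite indicE memNset// mulr0 addr0 lexx.
have [j jx] := cellP Kx; rewrite (step_fun_in low tcell jx).
case: jx => _ /= /andP[j1 j2]; rewrite indicE mem_set// mulr1 /low.
rewrite ler_pdivrMr// mulrC j1/= -[X in _ + X]mul1r -mulrDl ler_pdivlMr// mulrC.
by rewrite (le_trans (ltW j2))// -natr1.
Qed.

Let high_ge x : step_fun cell high x - m.+1%:R^-1 * \1_K x <= g x <= step_fun cell high x.
Proof.
have [Kx|Kx] := pselect (K x); last first.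
  rewrite step_fun_out ?gK// => [|j []//].
  by rewrite indicE memNset// mulr0 subr0 lexx.
have [j jx] := cellP Kx; rewrite (step_fun_in high tcell jx).
have /andP[g0 g1] := g01 x.
case: jx => _ /= /andP[j1 j2]; rewrite indicE mem_set// mulr1 /high.
apply/andP; split; last first.
  by rewrite le_min g1 ler_pdivlMr// mulrC ltW.
rewrite lerBlDr ge_min; apply/orP; right.
rewrite -[X in _ + X]mul1r -[g x](mulfK (_ : m.+1%:R != 0))// -mulrDl ler_pM2r ?invr_gt0//.
by rewrite -natr1 lerD2r mulrC.
Qed.

Let integral_step (c : 'I_m.+2 -> R) : (forall j, 0 <= c j <= 1) ->
  (\int[@area R]_x (1 - step_fun cell c x)%:E =
   (\sum_(j < m.+2) (1 - c j) * fine (area (cell j)))%:E)%E.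
Proof. exact: integral_one_sub_step_fun. Qed.

Let m1 : 0 <= m.+1%:R^-1 :> R. Proof. by rewrite invr_ge0. Qed.

Let mstep (c : 'I_m.+2 -> R) : measurable_fun setT (step_fun cell c).
Proof. exact: measurable_step_fun. Qed.

Let mindicK : measurable_fun setT (fun x => (m.+1%:R^-1 * \1_K x : R)%:E).
Proof. by apply/measurable_EFinP; apply: measurable_funM => //; exact: measurable_indic. Qed.

Let sum_low : \sum_(j < m.+2) (1 - low j) * fine (area (cell j)) <= I + m.+1%:R^-1 * k.
Proof.
rewrite -lee_fin -integral_step// EFinD -IE -(integral_indicK m1).
have g1 x : (0 <= (1 - g x)%:E)%E by rewrite lee_fin subr_ge0; have /andP[] := g01 x.
rewrite -ge0_integralD; last 5 first.
- by [].
- by move=> x _; exact: g1.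
- exact: m1g.
- by move=> x _; rewrite lee_fin mulr_ge0.
- exact: mindicK.
apply: ge0_le_integral.
- by [].
- by move=> x _; rewrite lee_fin subr_ge0 step_fun_le1.
- exact: m1g.
- by apply: emeasurable_funD => //; exact: m1g.
- move=> x _; rewrite -EFinD lee_fin; have /andP[_] := low_le x; set t := (X in _ + X); set u := step_fun _ _ _ => h.
  by change (1 - u <= 1 - g x + t); lra.
Qed.

Let sum_high : I <= \sum_(j < m.+2) (1 - high j) * fine (area (cell j)) + m.+1%:R^-1 * k.
Proof.
rewrite -lee_fin [leRHS]EFinD -integral_step// -IE -(integral_indicK m1).
have s1 x : (0 <= (1 - step_fun cell high x)%:E)%E.
  by rewrite lee_fin subr_ge0 step_fun_le1.
rewrite -ge0_integralD; last 5 first.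
- by [].
- by move=> x _; exact: s1.
- exact: m1g.
- by move=> x _; rewrite lee_fin mulr_ge0.
- exact: mindicK.
apply: ge0_le_integral.
- by [].
- by move=> x _; rewrite lee_fin subr_ge0; have /andP[] := g01 x.
- exact: m1g.
- by apply: emeasurable_funD => //; exact: m1g.
- move=> x _; rewrite -EFinD lee_fin; have /andP[+ _] := high_ge x; set t := (X in _ - X); set u := step_fun _ _ _ => h.
  by change (1 - g x <= 1 - u + t); lra.
Qed.

(** The step functions equal to the lower and to the upper ends of the level sets
    bound [g] within the mesh, on the set [K] of finite area. *)
Lemma poisson_pgfl_sandwich (l : \bar R) :
  (fun N => \int[P]_w (\prod_(i < N) g (X i w))%:E)%E @ \oo --> l ->
  ((expR (- (lambda * (I + m.+1%:R^-1 * k))))%:E <= l <=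
   (expR (- (lambda * (I - m.+1%:R^-1 * k))))%:E)%E.
Proof.
move=> gl.
have mprod (h : plane R -> R) N : measurable_fun setT h ->
    measurable_fun setT (fun w => (\prod_(i < N) h (X i w))%:E : \bar R).
  move=> mh; apply/measurable_EFinP; apply: measurable_prod => i _.
  exact: (measurableT_comp mh (mX i)).
have sumE (c : 'I_m.+2 -> R) : \sum_(j < m.+2) (1 - c j) * mean_count lambda (cell j) =
    lambda * \sum_(j < m.+2) (1 - c j) * fine (area (cell j)).
  by rewrite mulr_sumr; apply: eq_bigr => j _; rewrite mulrCA.
have lowcvg := step_pgfl lambda_ge0 X_poisson mcell fcell tcell low01.
have highcvg := step_pgfl lambda_ge0 X_poisson mcell fcell tcell high01.
have g0 x : 0 <= g x by have /andP[] := g01 x.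
have s0 x : 0 <= step_fun cell low x.
  by apply: step_fun_ge0 => j; have /andP[] := low01 j.
apply/andP; split.
- apply: (@le_trans _ _ (expR (- \sum_(j < m.+2) (1 - low j) * mean_count lambda (cell j)))%:E).
    by rewrite lee_fin ler_expR lerN2 sumE ler_wpM2l.
  apply: (lee_cvg_to lowcvg gl); apply: nearW => N; apply: ge0_le_integral => //.
  + by move=> w _; rewrite lee_fin prodr_ge0.
  + exact: mprod.
  + exact: mprod.
  + move=> w _; rewrite lee_fin; apply: ler_prod => i _.
    by rewrite s0/=; have /andP[] := low_le (X i w).
- apply: (@le_trans _ _ (expR (- \sum_(j < m.+2) (1 - high j) * mean_count lambda (cell j)))%:E); last first.
    by rewrite lee_fin ler_expR lerN2 sumE ler_wpM2l// lerBlDr.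
  apply: (lee_cvg_to gl highcvg); apply: nearW => N; apply: ge0_le_integral => //.
  + by move=> w _; rewrite lee_fin prodr_ge0.
  + exact: mprod.
  + exact: mprod.
  + move=> w _; rewrite lee_fin; apply: ler_prod => i _.
    by rewrite g0/=; have /andP[] := high_ge (X i w).
Qed.

End cells.

(** The generating functional of a Poisson process, for functions equal to [1] off
    a set of finite area. The partial products decrease, so they have a limit, and
    [poisson_pgfl_sandwich] identifies it as the mesh shrinks. *)
Lemma poisson_pgfl :
  (fun N => \int[P]_w (\prod_(i < N) g (X i w))%:E)%E @ \oo -->
  (expR (- (lambda * fine (\int[@area R]_x (1 - g x)%:E))))%:E.
Proof.
have g0 x : 0 <= g x by have /andP[] := g01 x.
have mprod N : measurable_fun setT (fun w => (\prod_(i < N) g (X i w))%:E : \bar R).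
  apply/measurable_EFinP; apply: measurable_prod => i _.
  exact: (measurableT_comp mg (mX i)).
have : cvgn (fun N => \int[P]_w (\prod_(i < N) g (X i w))%:E)%E.
  apply: ereal_nonincreasing_is_cvgn; apply/nonincreasing_seqP => N.
  apply: ge0_le_integral => //.
  - by move=> w _; rewrite lee_fin prodr_ge0.
  - move=> w _; rewrite lee_fin big_ord_recr/= ler_piMr ?prodr_ge0//.
    by have /andP[] := g01 (X N w).
set u := (fun N => _) => /cvg_ex[/= l ul].
suff <- : l = (expR (- (lambda * fine (\int[@area R]_x (1 - g x)%:E))))%:E by [].
have vlim : (fun m : nat => m.+1%:R^-1 * k) @ \oo --> (0 : R).
  by rewrite -[X in _ --> X](mul0r k); apply: cvgM; [exact: cvg_harmonic|exact: cvg_cst].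
have ecvg (f : nat -> R) : f @ \oo --> I ->
    (fun m => (expR (- (lambda * f m)))%:E) @ \oo --> (expR (- (lambda * I)))%:E.
  move=> fI; apply: cvg_EFin; first by apply: nearW.
  apply: continuous_cvg; first exact: continuous_expR.
  by apply: cvgN; apply: cvgM => //; exact: cvg_cst.
have low : (fun m => I + m.+1%:R^-1 * k) @ \oo --> I.
  by rewrite -[X in _ --> X]addr0; apply: cvgD => //; exact: cvg_cst.
have high : (fun m => I - m.+1%:R^-1 * k) @ \oo --> I.
  by rewrite -[X in _ --> X]subr0; apply: cvgB => //; exact: cvg_cst.
apply/eqP; rewrite eq_le; apply/andP; split.
- apply: (cvge_to_ge (ecvg _ high)).
  by apply: nearW => m; have /andP[] := poisson_pgfl_sandwich m ul.
- apply: (cvge_to_le (ecvg _ low)).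
  by apply: nearW => m; have /andP[] := poisson_pgfl_sandwich m ul.
Qed.

End poisson_pgfl.

(** * Averaging over one mark *)

Section independent_mark.
Context d (Omega : measurableType d) (R : realType) (P : probability Omega R).
Variables (X : nat -> {RV P >-> plane R}) (Theta : nat -> {RV P >-> measurableTypeR R}).
Hypotheses (Theta_iid : is_iid_uniform_angles Theta)
  (Theta_indep_X : independent2 P (sigma_seq X) (sigma_seq Theta)).
Variable k : nat.

(** A pi-system generating the sigma-algebra of all the positions and of all the
    marks but the [k]-th one. *)
Definition other_events : set_system Omega :=
  [set A | exists E (J : {fset nat}) (F : nat -> set Omega),
    [/\ sigma_seq X E, k \notin J, forall j, sigma_rv (Theta j) (F j) &
        A = E `&` \bigcap_(j in [set` J]) F j]].

Let sigma_seq_measurable d' (T' : measurableType d') (Y : nat -> {RV P >-> T'}) A :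
  sigma_seq Y A -> measurable A.
Proof.
apply: smallest_sub; first exact: sigma_algebra_measurable.
move=> B [i _ [C mC <-]]; exact: (measurable_funP (Y i) measurableT).
Qed.

Let sigma_rvI d' (T' : measurableType d') (Y : Omega -> T') A B :
  sigma_rv Y A -> sigma_rv Y B -> sigma_rv Y (A `&` B).
Proof.
move=> [C mC <-] [D mD <-]; exists (C `&` D); first exact: measurableI.
by rewrite preimage_setI setIACA setIid.
Qed.

Let sigma_rvT d' (T' : measurableType d') (Y : Omega -> T') : sigma_rv Y setT.
Proof. by exists setT => //; rewrite setTI preimage_setT. Qed.

Lemma other_events_setI : setI_closed other_events.
Proof.
move=> _ _ [E [J [F [XE kJ TF ->]]]] [E' [J' [F' [XE' kJ' TF' ->]]]].
pose G (J : {fset nat}) (F : nat -> set Omega) j := if j \in J then F j else setT.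
have TG J0 F0 j : (forall j, sigma_rv (Theta j) (F0 j)) -> sigma_rv (Theta j) (G J0 F0 j).
  by move=> h; rewrite /G; case: ifPn.
exists (E `&` E'), (J `|` J')%fset, (fun j => G J F j `&` G J' F' j); split.
- exact: (@measurableI _ (g_sigma_algebraType (\bigcup_i sigma_rv (X i)))).
- by rewrite in_fsetU negb_or kJ.
- by move=> j; apply: sigma_rvI; exact: TG.
rewrite setIACA; congr (_ `&` _); apply/seteqP; split => [w [h h'] j /= jJ|w h].
  by split; rewrite /G; case: ifPn => // jJ'; [exact: h|exact: h'].
split=> j /= jJ; have := h j.
  by rewrite /G/= in_fsetU jJ => /(_ isT) [].
by rewrite /G/= in_fsetU jJ orbT => /(_ isT) [].
Qed.

Lemma other_events_measurable A : other_events A -> measurable A.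
Proof.
move=> [E [J [F [XE kJ TF ->]]]]; apply: measurableI.
  exact: sigma_seq_measurable XE.
apply: fin_bigcap_measurable => // j _; have [C mC <-] := TF j.
exact: (measurable_funP (Theta j) measurableT).
Qed.

Lemma other_events_indep A B : other_events A -> sigma_rv (Theta k) B ->
  P (A `&` B) = (P A * P B)%E.
Proof.
move=> [E [J [F [XE kJ TF ->]]]] TB.
pose F' j := if j == k then B else F j.
have TF' j : sigma_rv (Theta j) (F' j) by rewrite /F'; case: eqP => // ->.
have sT (J0 : {fset nat}) (F0 : nat -> set Omega) : (forall j, sigma_rv (Theta j) (F0 j)) ->
    sigma_seq Theta (\bigcap_(j in [set` J0]) F0 j).
  move=> h; apply: (@fin_bigcap_measurable _ (g_sigma_algebraType (\bigcup_i sigma_rv (Theta i)))) => // j _.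
  by apply: sub_sigma_algebra; exists j.
have -> : E `&` \bigcap_(j in [set` J]) F j `&` B =
    E `&` \bigcap_(j in [set` (k |` J)%fset]) F' j.
  rewrite -setIA; congr (_ `&` _); apply/seteqP; split => [w [h Bw] j /=|w h].
    by rewrite in_fset1U /F' => /orP[/eqP ->|jJ]; [rewrite eqxx|case: ifPn => // _; exact: h].
  split=> [j /= jJ|].
    have := h j; rewrite /= in_fset1U jJ orbT /F' => /(_ isT).
    by rewrite ifN//; apply: contraNneq kJ => <-.
  by have := h k; rewrite /= in_fset1U eqxx /F' eqxx => /(_ isT).
have [indT _] := Theta_iid.
rewrite (Theta_indep_X XE (sT _ _ TF')) (Theta_indep_X XE (sT _ _ TF)).
rewrite (indT (k |` J)%fset F' (fun j _ => TF' j)) (indT J F (fun j _ => TF j)).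
rewrite big_fsetU1//= /F' eqxx -muleA; congr (_ * _)%E; rewrite muleC; congr (_ * _)%E.
apply: eq_big_seq => j jJ; rewrite ifN//; apply: contraNneq kJ => <-//.
Qed.

(** The sample space with this coarser sigma-algebra: a function measurable on it
    is one that does not depend on the [k]-th mark. *)
Definition others := g_sigma_algebraType other_events.

Let measurable_others (A : set others) : measurable A -> measurable (A : set Omega).
Proof.
apply: smallest_sub; first exact: sigma_algebra_measurable.
exact: other_events_measurable.
Qed.

Let measurable_id_others : measurable_fun setT (id : Omega -> others).
Proof. by move=> _ B mB; rewrite setTI preimage_id; exact: measurable_others. Qed.

(** Two finite measures that agree on a pi-system agree on the sigma-algebra that
    it generates: here [A |-> P (A `&` B)] and [P B] times [P]. *)
Lemma others_indep (A : set others) B : measurable A -> sigma_rv (Theta k) B ->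
  P (A `&` B) = (P A * P B)%E.
Proof.
move=> mA TB.
have mB : measurable B.
  have [C mC <-] := TB; exact: (measurable_funP (Theta k) measurableT).
have PB0 : 0 <= fine (P B) by rewrite fine_ge0.
have E : mrestr P mB A = mscale (NngNum PB0) P A.
  apply: (@g_sigma_algebra_measure_unique _ R Omega other_events _ (fun=> setT) _ _ _ _ other_events_setI _ _ _ mA).
  - exact: other_events_measurable.
  - move=> _; exists setT, fset0, (fun=> setT); split => //.
    - exact: (@measurableT _ (g_sigma_algebraType (\bigcup_i sigma_rv (X i)))).
    - by rewrite setTI; apply/seteqP; split.
  - by apply/seteqP; split => // w _; exists 0%N.
  - move=> C GC; transitivity (P C * P B)%E; first exact: other_events_indep.
    by rewrite muleC -[in LHS](@fineK _ (P B)) ?fin_num_measure.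
  - by move=> _; rewrite /mrestr/= (le_lt_trans (probability_le1 _ _))// ?ltry//; exact: measurableI.
by rewrite [RHS]muleC -[in RHS](@fineK _ (P B)) ?fin_num_measure.
Qed.

Lemma measurable_others_X i : measurable_fun setT (X i : others -> plane R).
Proof.
move=> _ B mB; rewrite setTI; apply: sub_sigma_algebra.
exists (X i @^-1` B), fset0, (fun=> setT); split => //.
- by apply: sub_sigma_algebra; exists i => //; exists B => //; rewrite setTI.
- by rewrite (_ : bigcap _ _ = setT) ?setIT//; apply/seteqP; split.
Qed.

Lemma measurable_others_Theta j : j != k ->
  measurable_fun setT (Theta j : others -> measurableTypeR R).
Proof.
move=> jk _ B mB; rewrite setTI; apply: sub_sigma_algebra.
exists setT, [fset j]%fset, (fun i => if i == j then Theta j @^-1` B else setT); split => //.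
- exact: (@measurableT _ (g_sigma_algebraType (\bigcup_i sigma_rv (X i)))).
- by rewrite in_fset1 eq_sym.
- by move=> i; case: eqP => // ->; exists B => //; rewrite setTI.
rewrite setTI; apply/seteqP; split => [w h i /=|w h].
  by rewrite in_fset1 => /eqP ->; rewrite eqxx.
by have := h j; rewrite /= in_fset1 eqxx => /(_ isT).
Qed.

Let idO_mixin := isMeasurableFun.Build _ _ _ _ _ measurable_id_others.
Let idO : {mfun Omega >-> others} := HB.pack (id : Omega -> others) idO_mixin.

Lemma measurable_pair_mark :
  measurable_fun setT (fun w : Omega => (w : others, Theta k w)).
Proof. exact: measurable_fun_pair. Qed.

(** By independence the pair formed by the outcome, seen in [others], and the [k]-th
    mark has a product law. *)
Lemma integral_independent_mark (f : others * measurableTypeR R -> \bar R) :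
  measurable_fun setT f -> (forall z, 0 <= f z)%E ->
  (\int[P]_w f (w, Theta k w) =
   \int[P]_w \int[uniform_prob (ltNpi_pi R)]_theta f (w, theta))%E.
Proof.
move=> mf f0.
rewrite -(ge0_integral_image_measure P measurable_pair_mark mf f0).
pose m1 : probability others R := distribution P idO.
pose m2 : probability (measurableTypeR R) R := uniform_prob (ltNpi_pi R).
rewrite (eq_measure_integral (m1 \x m2)%E); last first.
  move=> A mA _; apply/esym.
  apply: (@product_measure_unique _ _ _ _ _ m1 m2 (image_measure P measurable_pair_mark)) => // B C mB mC.
  have [_ TU] := Theta_iid; transitivity (P B * P (Theta k @^-1` C))%E; last first.
    by congr (_ * _)%E; exact: TU k C mC.
  by apply: others_indep => //; exists C => //; rewrite setTI.
rewrite (fubini_tonelli1 (m1 := m1) (m2 := m2) f mf f0).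
rewrite ge0_integral_pushforward//.
- exact: (measurable_fun_fubini_tonelli_F (m2 := m2) f mf f0).
- by move=> w _; apply: integral_ge0.
Qed.

End independent_mark.

(** * The static field seen from a moving user *)

Lemma integral_probability_cst d (T : measurableType d) (R : realType)
    (P : probability T R) (c : \bar R) : (\int[P]_x c = c)%E.
Proof.
rewrite integral_cst// -[RHS]mule1; congr (_ * _)%E; exact: (probability_setT P).
Qed.

(** Generating functionals determine the laws of point processes; this is the form
    in which the Poisson property passes from the [X i] to the rotated points. The
    infinite product is written as the limit of the partial products, and [g] is
    [1] off a disc. *)
Definition has_poisson_functional d (Omega : measurableType d) (R : realType)
    (P : probability Omega R) (lambda : R) (Y : nat -> Omega -> plane R) : Prop :=
  forall (g : plane R -> R) (rho : R), measurable_fun setT g ->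
  (forall x, 0 <= g x <= 1) -> 0 <= rho -> (forall x, ~ disc 0 rho x -> g x = 1) ->
  (fun N => \int[P]_w (\prod_(i < N) g (Y i w))%:E)%E @ \oo -->
  (expR (- (lambda * fine (\int[@area R]_x (1 - g x)%:E))))%:E.

Section static_points.
Context d (Omega : measurableType d) (R : realType) (P : probability Omega R).
Variables (lambda : R) (X : nat -> {RV P >-> plane R})
  (Theta : nat -> {RV P >-> measurableTypeR R}).
Hypotheses (lambda_ge0 : 0 <= lambda) (X_poisson : is_poisson_point_process lambda X)
  (Theta_iid : is_iid_uniform_angles Theta)
  (Theta_indep_X : independent2 P (sigma_seq X) (sigma_seq Theta)).
Local Notation mR := (measurableTypeR R).
Local Notation U := (uniform_prob (ltNpi_pi R)).

(** Rotating station [i] about the user makes it move along the first axis: its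
    distance to the user at time [s] is that of this fixed point to [(- s, 0)]. *)
Definition static_point (i : nat) (w : Omega) : plane R := rotate (Theta i w) (X i w).

Lemma measurable_rotate2 d' (T : measurableType d') (f : T -> mR) (g : T -> plane R) :
  measurable_fun setT f -> measurable_fun setT g ->
  measurable_fun setT (fun x => rotate (f x) (g x)).
Proof.
move=> mf mg.
have m1 : measurable_fun setT ((fun x => (g x).1) : T -> mR) by exact: (measurableT_comp measurable_fst mg).
have m2 : measurable_fun setT ((fun x => (g x).2) : T -> mR) by exact: (measurableT_comp measurable_snd mg).
have mc : measurable_fun setT ((fun x => cos (f x)) : T -> mR).
  by apply: measurableT_comp => //; apply: continuous_measurable_fun; exact: continuous_cos.
have ms : measurable_fun setT ((fun x => sin (f x)) : T -> mR).
  by apply: measurableT_comp => //; apply: continuous_measurable_fun; exact: continuous_sin.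
apply: measurable_fun_pair; apply: measurable_addR; apply: measurable_mulR => //.
exact: measurable_oppR.
Qed.

Lemma measurable_static_point i : measurable_fun setT (static_point i).
Proof. exact: measurable_rotate2. Qed.

Variables (g : plane R -> R).
Hypotheses (mg : measurable_fun setT g) (g01 : forall x, 0 <= g x <= 1).

Let g_rot (z : plane R * mR) : \bar R := (g (rotate z.2 z.1))%:E.

Let mg_rot : measurable_fun setT g_rot.
Proof.
apply/measurable_EFinP; apply: (measurableT_comp mg).
by apply: measurable_rotate2; [exact: measurable_snd|exact: measurable_fst].
Qed.

Let g_rot0 z : (0 <= g_rot z)%E.
Proof. by rewrite lee_fin; have /andP[] := g01 (rotate z.2 z.1). Qed.

Definition mark_average (x : plane R) : R :=
  fine (\int[U]_theta (g (rotate theta x))%:E).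

Let mg_rotx x : measurable_fun setT (fun theta : mR => (g (rotate theta x))%:E).
Proof. exact: (measurableT_comp mg_rot (pair1_measurable x)). Qed.

Lemma mark_averageE x :
  ((mark_average x)%:E = \int[U]_theta (g (rotate theta x))%:E)%E.
Proof.
rewrite fineK// ge0_fin_numE; last by apply: integral_ge0 => t _; exact: (g_rot0 (x, t)).
apply: (@le_lt_trans _ _ (\int[U]_theta (cst 1 theta))%E).
  apply: ge0_le_integral => //.
  - by move=> t _; exact: (g_rot0 (x, t)).
  - by move=> t _; rewrite lee_fin; have /andP[] := g01 (rotate t x).
by rewrite (integral_probability_cst U 1) ltry.
Qed.

Lemma mark_average01 x : 0 <= mark_average x <= 1.
Proof.
rewrite -!lee_fin mark_averageE; apply/andP; split.
  by apply: integral_ge0 => t _; exact: (g_rot0 (x, t)).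
apply: (@le_trans _ _ (\int[U]_theta (cst 1 theta))%E).
  apply: ge0_le_integral => //.
  - by move=> t _; exact: (g_rot0 (x, t)).
  - by move=> t _; rewrite lee_fin; have /andP[] := g01 (rotate t x).
by rewrite (integral_probability_cst U).
Qed.

Lemma measurable_mark_average : measurable_fun setT mark_average.
Proof.
apply/measurable_EFinP; rewrite (_ : _ \o _ = fun x => \int[U]_theta g_rot (x, theta))%E.
  exact: (measurable_fun_fubini_tonelli_F (m2 := U) g_rot mg_rot g_rot0).
by apply/funext => x /=; rewrite mark_averageE.
Qed.

(** The marks are averaged out one after the other, each being independent of all
    the rest. *)
Lemma integral_prod_static_point N :
  (\int[P]_w (\prod_(i < N) g (static_point i w))%:E =
   \int[P]_w (\prod_(i < N) mark_average (X i w))%:E)%E.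
Proof.
suff H k : (k <= N)%N -> (\int[P]_w (\prod_(i < N) g (static_point i w))%:E =
   \int[P]_w (\prod_(i < N) (if (i < k)%N then mark_average (X i w)
                             else g (static_point i w)))%:E)%E.
  rewrite (H N)//; apply: eq_integral => w _; congr EFin.
  by apply: eq_bigr => i _; rewrite ltn_ord.
elim: k => [//|k IH] kN; rewrite IH ?(ltnW kN)//.
pose i0 := Ordinal kN.
pose W (w : Omega) : R := \prod_(i < N | i != i0)
  (if (i < k)%N then mark_average (X i w) else g (static_point i w)).
have W0 w : 0 <= W w.
  apply: prodr_ge0 => i _; case: ifPn => _.
    by have /andP[] := mark_average01 (X i w).
  by have /andP[] := g01 (static_point i w).
have mW : measurable_fun setT (W : others X Theta k -> mR).
  rewrite /W; under eq_fun do rewrite big_mkcond/=.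
  apply: measurable_prod => i _; have [ii0|//] := boolP (i != i0); case: (i < k)%N.
    apply: (measurableT_comp measurable_mark_average); exact: measurable_others_X.
  apply: (measurableT_comp mg); apply: measurable_rotate2.
    exact: measurable_others_Theta.
  exact: measurable_others_X.
pose f (z : others X Theta k * mR) : \bar R := ((W z.1) * g (rotate z.2 (X k z.1)))%:E.
have mf : measurable_fun setT f.
  apply/measurable_EFinP; apply: measurable_mulR.
    exact: (measurableT_comp mW measurable_fst).
  apply: (measurableT_comp mg); apply: measurable_rotate2; first exact: measurable_snd.
  apply: (measurableT_comp _ measurable_fst); exact: measurable_others_X.
have f0 z : (0 <= f z)%E.
  by rewrite lee_fin mulr_ge0//; have /andP[] := g01 (rotate z.2 (X k z.1)).
transitivity (\int[P]_w f (w, Theta k w))%E.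
  apply: eq_integral => w _; rewrite /f/= (bigD1 i0)//= ltnn mulrC //.
rewrite (integral_independent_mark Theta_iid Theta_indep_X mf f0).
apply: eq_integral => w _; rewrite /f/=.
under eq_integral do rewrite EFinM.
rewrite ge0_integralZl; last 4 first.
- by [].
- exact: mg_rotx.
- by move=> t _; exact: (g_rot0 (X k w, t)).
- by rewrite lee_fin.
rewrite -mark_averageE -EFinM; congr EFin.
rewrite [RHS](bigD1 i0)//= ltnSn mulrC; congr (_ * _); apply: eq_bigr => i ii0.
have -> // : (i < k.+1)%N = (i < k)%N.
rewrite ltnS leq_eqVlt; case: eqP => // ik; case/eqP: ii0; exact: val_inj.
Qed.

(** Area is invariant under every rotation, hence under their average. *)
Lemma integral_one_sub_mark_average :
  (\int[@area R]_x (1 - mark_average x)%:E = \int[@area R]_x (1 - g x)%:E)%E.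
Proof.
pose h (z : plane R * mR) : \bar R := (1 - g (rotate z.2 z.1))%:E.
have mh : measurable_fun setT h.
  apply/measurable_EFinP; apply: measurable_funB => //.
  by apply/measurable_EFinP; exact: mg_rot.
have h0 z : (0 <= h z)%E by rewrite lee_fin subr_ge0; have /andP[] := g01 (rotate z.2 z.1).
transitivity (\int[@area R]_x \int[U]_t h (x, t))%E.
  apply: eq_integral => x _; apply/esym.
  have hx0 t : (0 <= h (x, t))%E by exact: h0.
  have : (\int[U]_t h (x, t) + \int[U]_t g_rot (x, t) = 1)%E.
    rewrite -ge0_integralD; last 5 first.
    - by [].
    - by move=> t _; exact: hx0.
    - exact: (measurableT_comp mh (pair1_measurable x)).
    - by move=> t _; exact: g_rot0.
    - exact: mg_rotx.
    under eq_integral do rewrite -EFinD subrK.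
    by rewrite (integral_probability_cst U).
  rewrite -[X in (_ + X)%E]mark_averageE EFinB => <-.
  by rewrite addeK.
rewrite (fubini_tonelli (m1 := @area R) (m2 := U) h mh h0).
transitivity (\int[U]_t (cst (\int[@area R]_x (1 - g x)%:E) t))%E.
  apply: eq_integral => t _.
  apply: (@ge0_integral_rotate R t (fun x => (1 - g x)%:E)).
    by apply/measurable_EFinP; exact: measurable_funB.
  by move=> x; rewrite lee_fin subr_ge0; have /andP[] := g01 x.
by rewrite (integral_probability_cst U).
Qed.

(** The rotated points form a Poisson process with the same intensity: averaging
    over the marks replaces [g] by [mark_average], which has the same integral
    against area and is still [1] off a disc centred at the origin. *)
Lemma static_point_pgfl (rho : R) : 0 <= rho ->
  (forall x, ~ disc 0 rho x -> g x = 1) ->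
  (fun N => \int[P]_w (\prod_(i < N) g (static_point i w))%:E)%E @ \oo -->
  (expR (- (lambda * fine (\int[@area R]_x (1 - g x)%:E))))%:E.
Proof.
move=> rho0 gD; rewrite -integral_one_sub_mark_average.
rewrite (_ : (fun N => _) =
    (fun N => \int[P]_w (\prod_(i < N) mark_average (X i w))%:E)%E); last first.
  by apply/funext => N; exact: integral_prod_static_point.
apply: (poisson_pgfl lambda_ge0 X_poisson measurable_mark_average mark_average01
  (measurable_disc 0 rho)).
  by rewrite area_disc ?ltry// expr0n addr0.
move=> x nx; apply/EFin_inj; rewrite mark_averageE.
rewrite (eq_integral (cst 1%E)).
  by rewrite (integral_probability_cst U).
move=> t _; congr EFin; apply: gD => /=; apply: contra_not nx.
rewrite /disc/= !mulr0 !mul0r !addr0; apply: le_lt_trans.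
rewrite le_eqVlt; apply/orP; left; apply/eqP.
rewrite -[LHS]mulr1 -(cos2Dsin2 t); ring.
Qed.

End static_points.

(** * Joint moments of disjoint counts *)

(** A sequence in [0, 1) that increases to [1]. *)
Definition nat_ratio (R : realType) (n : nat) : R := n%:R / n.+1%:R.

Section count_powers.
Context d (Omega : measurableType d) (R : realType).
Variable Y : nat -> Omega -> plane R.
Hypothesis mY : forall i, measurable_fun setT (Y i).

Lemma point_measure_cases B w :
  (exists k, count_eq Y B k w) \/
  (point_measure Y w B = +oo%E /\ first_points Y B w n @[n --> \oo] --> \oo).
Proof.
have nd := @nd_first_points _ _ _ Y B w.
have [[M bM]|unb] := pselect (exists M, forall n, (first_points Y B w n <= M)%N).
  left; have [k [[n0 n0k] kmax]] : exists k, (exists n, first_points Y B w n = k) /\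
      forall n, (first_points Y B w n <= k)%N.
    elim: M bM => [|M IH] bM.
      by exists 0%N; split => //; exists 0%N; apply/eqP; rewrite -leqn0 bM.
    have [[n nM]|nM] := pselect (exists n, first_points Y B w n = M.+1).
      by exists M.+1; split => //; exists n.
    apply: IH => n; rewrite -ltnS ltn_neqAle bM andbT; apply/eqP => h.
    by apply: nM; exists n.
  exists k; rewrite /count_eq/= point_measureE; apply/cvg_lim => //.
  apply: cvg_near_cst; exists n0 => // n /= n0n.
  rewrite -first_pointsE; congr (_%:R%:E); apply/eqP; rewrite eqn_leq kmax/=.
  by rewrite -n0k; exact: nd.
have fpy : first_points Y B w n @[n --> \oo] --> \oo.
  apply/cvgnyPge => M; apply: contrapT => h; apply: unb; exists M => n.
  rewrite leqNgt; apply/negP => Mn; apply: h; exists n => // m /= nm.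
  by rewrite (leq_trans (ltnW Mn))//; exact: nd.
right; split => //; rewrite point_measureE; apply/cvg_lim => //.
under eq_fun do rewrite -first_pointsE.
exact/cvgenyP.
Qed.

(** [t] to the power of the count of [B], which is [0] for an infinite count when
    [t < 1], and [1] when [t = 1]. *)
Definition powcount (t : R) (B : set (plane R)) (w : Omega) : R :=
  limn (fun n => t ^+ first_points Y B w n).

Lemma powcount_eq t B w k : count_eq Y B k w -> powcount t B w = t ^+ k.
Proof.
move=> /count_eq_near [n0 n0P]; apply/cvg_lim => //.
by apply: cvg_near_cst; exists n0 => // n /= /n0P ->.
Qed.

Lemma powcount_infty t B w : 0 <= t < 1 ->
  first_points Y B w n @[n --> \oo] --> \oo -> powcount t B w = 0.
Proof.
move=> /andP[t0 t1] fpy; apply/cvg_lim => //.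
apply: (cvg_comp _ _ fpy); apply: cvg_expr.
by rewrite ger0_norm.
Qed.

Lemma powcount1 B w : powcount 1 B w = 1.
Proof.
by rewrite /powcount; under eq_fun do rewrite expr1n; rewrite lim_cst.
Qed.

Lemma cvg_powcount (t : R) B w : 0 <= t <= 1 ->
  t ^+ first_points Y B w n @[n --> \oo] --> powcount t B w.
Proof.
move=> /andP[t0]; rewrite le_eqVlt => /predU1P[->|t1].
  rewrite powcount1; under eq_fun do rewrite expr1n; exact: cvg_cst.
have [[k kw]|[_ fpy]] := point_measure_cases B w.
  rewrite (powcount_eq _ kw); have [n0 n0P] := count_eq_near kw.
  by apply: cvg_near_cst; exists n0 => // n /= /n0P ->.
rewrite (powcount_infty _ fpy) ?t0//; apply: (cvg_comp _ _ fpy); apply: cvg_expr.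
by rewrite ger0_norm.
Qed.

Lemma powcount01 (t : R) B w : 0 <= t <= 1 -> 0 <= powcount t B w <= 1.
Proof.
move=> t01; have tc := @cvg_powcount t B w t01; have /andP[t0 t1] := t01.
apply/andP; split.
  by apply: (limr_ge (cvgP _ tc)); apply: nearW => n; exact: exprn_ge0.
by apply: (limr_le (cvgP _ tc)); apply: nearW => n; rewrite exprn_ile1.
Qed.

Lemma measurable_first_points_pow t B n : measurable B ->
  measurable_fun setT ((fun w => t ^+ first_points Y B w n) : Omega -> measurableTypeR R).
Proof.
move=> mB; rewrite (_ : (fun w => _) =
    (fun w => \prod_(i < n) (if Y i w \in B then t else 1))).
  apply: measurable_prod => i _; apply: measurable_fun_ifT => //.
  apply: (measurable_fun_bool true); rewrite setTI.
  rewrite (_ : _ @^-1` _ = Y i @^-1` B); last first.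
    by apply/seteqP; split => w /= h; [exact: set_mem h|exact: mem_set h].
  by rewrite -[X in measurable X]setTI; exact: mY.
apply/funext => w; rewrite /first_points big_mkord; elim: n => [|n IH].
  by rewrite !big_ord0.
by rewrite !big_ord_recr/= exprD IH; case: ifPn.
Qed.

Lemma measurable_powcount t B : 0 <= t <= 1 -> measurable B ->
  measurable_fun setT ((fun w => powcount t B w) : Omega -> measurableTypeR R).
Proof.
move=> t01 mB; apply: (measurable_fun_cvg (h := fun n w => t ^+ first_points Y B w n)) => //.
  by move=> n; exact: measurable_first_points_pow.
by move=> w _; exact: cvg_powcount.
Qed.

(** The sum of the powers [t ^+ i] for [i] below the count of [B]: it recovers the
    count as [t] increases to [1], monotonically. *)
Definition geomcount (t : R) (B : set (plane R)) (w : Omega) : R :=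
  (1 - powcount t B w) / (1 - t).

Lemma geomcount_eq t B w k : t != 1 -> count_eq Y B k w ->
  geomcount t B w = \sum_(i < k) t ^+ i.
Proof.
move=> t1 kw; rewrite /geomcount (powcount_eq _ kw).
rewrite -opprB -[in X in _ / X]opprB invrN mulrNN subrX1.
by rewrite mulrAC mulfV ?mul1r// subr_eq0.
Qed.

Local Notation tn := (@nat_ratio R).

Let tn01 n : 0 <= tn n < 1.
Proof. by rewrite /nat_ratio divr_ge0//= ltr_pdivrMr// mul1r ltr_nat. Qed.

Let nd_tn : {homo tn : m n / (m <= n)%N >-> m <= n}.
Proof.
move=> m n mn; rewrite /nat_ratio ler_pdivrMr// mulrAC ler_pdivlMr// -!natrM ler_nat.
by rewrite !mulnS mulnC leq_add2r.
Qed.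

Let oneBtn n : 1 - tn n = n.+1%:R^-1.
Proof. by rewrite /nat_ratio -natr1; field; rewrite natr1. Qed.

Let tn1 n : tn n != 1.
Proof. by have /andP[_] := tn01 n; rewrite lt_neqAle => /andP[]. Qed.

Let cvg_tn : tn @ \oo --> (1 : R).
Proof.
rewrite (_ : tn = fun n => 1 - n.+1%:R^-1); last first.
  by apply/funext => n; rewrite -oneBtn subKr.
rewrite -[X in _ --> X]subr0; apply: cvgB; [exact: cvg_cst|exact: cvg_harmonic].
Qed.

Let geomcount_infty B w n : first_points Y B w n @[n --> \oo] --> \oo ->
  geomcount (tn n) B w = n.+1%:R.
Proof.
by move=> fpy; rewrite /geomcount powcount_infty// subr0 oneBtn invrK mul1r.
Qed.

Lemma nd_geomcount B w : {homo (fun n => geomcount (tn n) B w) : m n / (m <= n)%N >-> m <= n}.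
Proof.
move=> m n mn; have [[k kw]|[_ fpy]] := point_measure_cases B w; last first.
  by rewrite !geomcount_infty// ler_nat.
rewrite !(geomcount_eq _ kw)//; apply: ler_sum => i _.
have /andP[m0 _] := tn01 m; have /andP[nn0 _] := tn01 n.
by apply: lerXn2r; rewrite ?nnegrE//; exact: nd_tn.
Qed.

Lemma geomcount_ge0 B w n : 0 <= geomcount (tn n) B w.
Proof.
have /andP[t0 t1] := tn01 n.
rewrite /geomcount divr_ge0 ?subr_ge0 ?(ltW t1)//.
have t01 : 0 <= tn n <= 1 by rewrite t0 ltW.
by have /andP[] := @powcount01 _ B w t01.
Qed.

Lemma cvg_geomcount B w :
  (geomcount (tn n) B w)%:E @[n --> \oo] --> point_measure Y w B.
Proof.
have [[k kw]|[-> fpy]] := point_measure_cases B w; last first.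
  under eq_fun do rewrite (geomcount_infty _ fpy).
  by apply/cvgenyP; apply/cvgnyPge => M; exists M => // n /= /leqW.
rewrite [X in _ --> X]kw; apply: cvg_EFin; first exact: nearW.
under eq_fun do rewrite (geomcount_eq (tn1 _) kw).
have cX i : (tn n ^+ i) @[n --> \oo] --> (1 : R).
  rewrite -[X in _ --> X](expr1n R i).
  exact: (continuous_cvg _ (@exprn_continuous _ i 1) cvg_tn).
elim: k {kw} => [|k IH].
  by under eq_fun do rewrite big_ord0; exact: cvg_cst.
by under eq_fun do rewrite big_ord_recr/=; rewrite -natr1; exact: cvgD.
Qed.

End count_powers.

(** Monotonicity excludes the indeterminate products: if one limit is [0], so is
    every term of that sequence. *)
Lemma cvg_emul_nd (R : realType) (u v : nat -> \bar R) (a b : \bar R) :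
  (forall n, 0 <= u n)%E -> (forall n, 0 <= v n)%E ->
  {homo u : m n / (m <= n)%N >-> (m <= n)%E} ->
  {homo v : m n / (m <= n)%N >-> (m <= n)%E} ->
  u @ \oo --> a -> v @ \oo --> b -> (u n * v n)%E @[n --> \oo] --> (a * b)%E.
Proof.
move=> u0 v0 ndu ndv ua vb.
have leu n : (u n <= a)%E.
  rewrite (cvg_unique (@ereal_hausdorff R) ua (ereal_nondecreasing_cvgn ndu)).
  by apply: ereal_sup_ubound; exists n.
have lev n : (v n <= b)%E.
  rewrite (cvg_unique (@ereal_hausdorff R) vb (ereal_nondecreasing_cvgn ndv)).
  by apply: ereal_sup_ubound; exists n.
have [a0|a0] := eqVneq a 0%E.
  rewrite a0 mul0e (_ : (fun _ => _) = cst 0%E); first exact: cvg_cst.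
  apply/funext => n; have -> : u n = 0%E by apply/eqP; rewrite eq_le u0 -a0 leu.
  by rewrite mul0e.
have [b0|b0] := eqVneq b 0%E.
  rewrite b0 mule0 (_ : (fun _ => _) = cst 0%E); first exact: cvg_cst.
  apply/funext => n; have -> : v n = 0%E by apply/eqP; rewrite eq_le v0 -b0 lev.
  by rewrite mule0.
by apply: cvgeM => //; rewrite mule_defE (negbTE a0) (negbTE b0).
Qed.

(** What [geomcount t] averages to when the count is Poisson of mean [x]. *)
Definition geommean (R : realType) (t x : R) : R :=
  (1 - expR (- ((1 - t) * x))) / (1 - t).

Lemma cvg_geommean (R : realType) (x : R) : 0 <= x ->
  geommean (nat_ratio R n) x @[n --> \oo] --> x.
Proof.
move=> x0.
have oneB n : 1 - nat_ratio R n = n.+1%:R^-1.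
  by rewrite /nat_ratio -natr1; field; rewrite natr1.
apply: (@squeeze_cvgr _ _ _ _ (fun n => x / (1 + n.+1%:R^-1 * x)) (cst x)); last exact: cvg_cst.
  apply: nearW => n; rewrite /geommean oneB /cst.
  set h : R := n.+1%:R^-1.
  have h0 : 0 < h by rewrite invr_gt0.
  have hx : 0 <= h * x by rewrite mulr_ge0// ltW.
  apply/andP; split; last first.
    by rewrite ler_pdivrMr//; have := expR_ge1Dx (- (h * x)); lra.
  have e1 : expR (- (h * x)) <= (1 + h * x)^-1.
    by rewrite expRN lef_pV2 ?posrE ?expR_gt0 ?expR_ge1Dx// ltr_pwDl.
  have -> : x / (1 + h * x) = (1 - (1 + h * x)^-1) / h.
    by field; rewrite !gt_eqF// ltr_pwDl.
  by rewrite ler_pM2r ?invr_gt0//; lra.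
rewrite -[X in _ --> X]divr1; apply: cvgM; first exact: cvg_cst.
apply: cvgV; first by rewrite oner_eq0.
rewrite -[X in _ --> X]addr0; apply: cvgD; first exact: cvg_cst.
rewrite -[X in _ --> X](mul0r x); apply: cvgM; [exact: cvg_harmonic|exact: cvg_cst].
Qed.

Section joint_counts.
Context d (Omega : measurableType d) (R : realType) (P : probability Omega R).
Variables (lambda : R) (Y : nat -> Omega -> plane R).
Hypotheses (lambda_ge0 : 0 <= lambda) (mY : forall i, measurable_fun setT (Y i)).
Hypothesis pgfl : has_poisson_functional P lambda Y.

Section disjoint_sets.
Variables (rho : R) (A C1 C2 : set (plane R)).
Hypotheses (rho0 : 0 <= rho) (mA : measurable A) (mC1 : measurable C1)
  (mC2 : measurable C2) (bA : A `<=` disc 0 rho) (bC1 : C1 `<=` disc 0 rho)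
  (bC2 : C2 `<=` disc 0 rho) (AC1 : A `&` C1 = set0) (AC2 : A `&` C2 = set0)
  (C12 : C1 `&` C2 = set0).

Local Notation m := (mean_count lambda).
Local Notation T := (powcount Y).

(** The joint generating function of three disjoint counts: apply the functional to
    the step function with values [t0], [t1], [t2]. *)
Lemma integral_powcount t0 t1 t2 : 0 <= t0 <= 1 -> 0 <= t1 <= 1 -> 0 <= t2 <= 1 ->
  (\int[P]_w (T t0 A w * T t1 C1 w * T t2 C2 w)%:E =
   (expR (- ((1 - t0) * m A)) * expR (- ((1 - t1) * m C1)) *
    expR (- ((1 - t2) * m C2)))%:E)%E.
Proof.
move=> t001 t101 t201.
pose K (j : 'I_3) := tnth [tuple A; C1; C2] j.
pose c (j : 'I_3) := tnth [tuple t0; t1; t2] j.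
have mK j : measurable (K j).
  by case: j => -[|[|[|//]]] ?; rewrite /K/= (tnth_nth set0)//=.
have bK j : K j `<=` disc 0 rho.
  by case: j => -[|[|[|//]]] ?; rewrite /K/= (tnth_nth set0)//=.
have tK : trivIset setT K.
  apply/trivIsetP => -[[|[|[|//]]] i3] -[[|[|[|//]]] j3] _ _ //= _;
  by rewrite /K !(tnth_nth set0)//= setIC.
have c01 j : 0 <= c j <= 1.
  by case: j => -[|[|[|//]]] ?; rewrite /c/= (tnth_nth 0)//=.
have gc := @pgfl (step_fun K c) rho (measurable_step_fun c mK tK) _ rho0 _.
have g01 x : 0 <= step_fun K c x <= 1.
  by rewrite step_fun_ge0 ?step_fun_le1// => j; have /andP[] := c01 j.
have gD x : ~ disc 0 rho x -> step_fun K c x = 1.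
  by move=> nD; apply: step_fun_out => j Kx; apply: nD; exact: bK Kx.
have {gc} := gc g01 gD.
rewrite integral_one_sub_step_fun//; last by move=> j; apply: area_bounded_lty (bK j).
rewrite /= !big_ord_recl big_ord0 addr0.
have -> : (expR (- (lambda * ((1 - c ord0) * fine (area (K ord0)) +
    ((1 - c (lift ord0 ord0)) * fine (area (K (lift ord0 ord0))) +
     (1 - c (lift ord0 (lift ord0 ord0))) * fine (area (K (lift ord0 (lift ord0 ord0)))))))))%:E =
  (expR (- ((1 - t0) * m A)) * expR (- ((1 - t1) * m C1)) * expR (- ((1 - t2) * m C2)))%:E.
  rewrite -!expRD /K /c !(tnth_nth set0) !(tnth_nth 0)/= /mean_count; congr (expR _)%:E; ring.
move=> cvg1.
have cvg2 : (fun N => \int[P]_w (\prod_(i < N) step_fun K c (Y i w))%:E)%E @ \oo -->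
   (\int[P]_w (T t0 A w * T t1 C1 w * T t2 C2 w)%:E)%E.
  have [] // := @dominated_convergence _ _ _ P setT measurableT
    (fun N w => (\prod_(i < N) step_fun K c (Y i w))%:E)
    (fun w => (T t0 A w * T t1 C1 w * T t2 C2 w)%:E) (fun=> 1%E).
  - move=> N; apply/measurable_EFinP; apply: measurable_prod => i _.
    exact: (measurableT_comp (measurable_step_fun c mK tK) (mY i)).
  - apply/measurable_EFinP; apply: measurable_mulR; first apply: measurable_mulR;
      exact: measurable_powcount.
  - apply: aeW => w _; apply: cvg_EFin; first exact: nearW.
    under eq_fun do rewrite prod_step_fun !big_ord_recl big_ord0 mulr1 mulrA.
    rewrite /K /c !(tnth_nth set0) !(tnth_nth 0)/=.
    apply: cvgM; first apply: cvgM; exact: cvg_powcount.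
  - exact: finite_measure_integrable_cst.
  - apply: aeW => w N _; rewrite lee_fin ger0_norm; last first.
      by apply: prodr_ge0 => i _; have /andP[] := g01 (Y i w).
    by apply: prodr_ile1 => i _.
exact: (cvg_unique _ cvg2 cvg1).
Qed.

(** Expand [(1 - T t C1) * (1 - T t C2)] and use [integral_powcount] on each term.
    The negative terms are moved to the other side, so that only nonnegative
    functions are integrated. *)
Lemma integral_geomcount t0 t : 0 <= t0 <= 1 -> 0 <= t < 1 ->
  (\int[P]_w (T t0 A w * (geomcount Y t C1 w * geomcount Y t C2 w))%:E =
   (expR (- ((1 - t0) * m A)) * (geommean t (m C1) * geommean t (m C2)))%:E)%E.
Proof.
move=> t001 /andP[tge0 tlt1].
have t01 : 0 <= t <= 1 by rewrite tge0 ltW.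
have one01 : 0 <= (1 : R) <= 1 by rewrite ler01 lexx.
have T01 s B w : 0 <= s <= 1 -> 0 <= T s B w <= 1 by exact: powcount01.
have mT s B : 0 <= s <= 1 -> measurable B ->
    measurable_fun setT ((fun w => T s B w) : Omega -> measurableTypeR R).
  exact: measurable_powcount.
have m1T s B : 0 <= s <= 1 -> measurable B ->
    measurable_fun setT ((fun w => 1 - T s B w) : Omega -> measurableTypeR R).
  by move=> s01 mB; apply: measurable_addR => //; apply: measurable_oppR; exact: mT.
pose f w := T t0 A w * (1 - T t C1 w) * (1 - T t C2 w).
have f0 w : 0 <= f w.
  by rewrite !mulr_ge0 ?subr_ge0//;
    [have /andP[] := T01 t0 A w t001|have /andP[] := T01 t C1 w t01|have /andP[] := T01 t C2 w t01].
have mf : measurable_fun setT (EFin \o f).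
  by apply/measurable_EFinP; apply: measurable_mulR;
    [apply: measurable_mulR; [exact: mT|exact: m1T]|exact: m1T].
pose g s1 s2 w := T t0 A w * T s1 C1 w * T s2 C2 w.
have g0 s1 s2 w : 0 <= s1 <= 1 -> 0 <= s2 <= 1 -> 0 <= g s1 s2 w.
  by move=> h1 h2; rewrite !mulr_ge0//;
    [have /andP[] := T01 t0 A w t001|have /andP[] := T01 s1 C1 w h1|have /andP[] := T01 s2 C2 w h2].
have mg s1 s2 : 0 <= s1 <= 1 -> 0 <= s2 <= 1 -> measurable_fun setT (EFin \o g s1 s2).
  by move=> h1 h2; apply/measurable_EFinP; apply: measurable_mulR;
    [apply: measurable_mulR|]; exact: mT.
have If : (\int[P]_w (f w)%:E = (expR (- ((1 - t0) * m A)) *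
    ((1 - expR (- ((1 - t) * m C1))) * (1 - expR (- ((1 - t) * m C2)))))%:E)%E.
  have : (\int[P]_w (f w)%:E + (\int[P]_w (g t 1 w)%:E + \int[P]_w (g 1 t w)%:E) =
      \int[P]_w (g 1 1 w)%:E + \int[P]_w (g t t w)%:E)%E.
    rewrite -(@ge0_integralD _ _ _ P setT measurableT (EFin \o g t 1) (EFin \o g 1 t)); last 4 first.
    - by move=> w _; rewrite lee_fin g0.
    - exact: mg.
    - by move=> w _; rewrite lee_fin g0.
    - exact: mg.
    rewrite -ge0_integralD; last 5 first.
    - by [].
    - by move=> w _; rewrite lee_fin.
    - exact: mf.
    - by move=> w _; rewrite adde_ge0 ?lee_fin ?g0.
    - by apply: emeasurable_funD; exact: mg.
    rewrite -ge0_integralD; last 5 first.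
    - by [].
    - by move=> w _; rewrite lee_fin g0.
    - exact: mg.
    - by move=> w _; rewrite lee_fin g0.
    - exact: mg.
    apply: eq_integral => w _; rewrite /= -!EFinD; congr EFin.
    by rewrite /f /g !powcount1; ring.
  rewrite !integral_powcount// -!EFinD !subrr !mul0r !oppr0 !expR0 !mulr1.
  set I := (\int[P]_w (f w)%:E)%E.
  set e0 := expR (- ((1 - t0) * m A)); set e1 := expR (- ((1 - t) * m C1)).
  set e2 := expR (- ((1 - t) * m C2)).
  case: I => [r| |//]; last by [].
  move=> [] h; congr EFin; apply: (addIr (e0 * e1 + e0 * e2)); rewrite h; ring.
have t1 : 0 < 1 - t by rewrite subr_gt0.
transitivity (\int[P]_w (((1 - t) ^- 2)%:E * (f w)%:E))%E.
  apply: eq_integral => w _; rewrite -EFinM /f /geomcount; congr EFin; field.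
  by rewrite gt_eqF.
rewrite ge0_integralZl; last 4 first.
- by [].
- exact: mf.
- by move=> w _; rewrite lee_fin.
- by rewrite lee_fin invr_ge0 exprn_ge0// ltW.
rewrite If -EFinM /geommean.
set e0 := expR (- ((1 - t0) * m A)); set e1 := expR (- ((1 - t) * m C1)).
set e2 := expR (- ((1 - t) * m C2)); congr EFin.
by field; rewrite gt_eqF.
Qed.

(** Monotone convergence as [t] increases to [1] in [integral_geomcount]. *)
Lemma integral_powcount_product t0 : 0 <= t0 <= 1 ->
  (\int[P]_w ((T t0 A w)%:E * (point_measure Y w C1 * point_measure Y w C2)) =
   (expR (- ((1 - t0) * m A)) * (m C1 * m C2))%:E)%E.
Proof.
move=> t001.
have tn01 n : 0 <= nat_ratio R n < 1.
  by rewrite /nat_ratio divr_ge0//= ltr_pdivrMr// mul1r ltr_nat.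
have T0 w : 0 <= T t0 A w by have /andP[] := powcount01 Y A w t001.
pose u n w := (T t0 A w * (geomcount Y (nat_ratio R n) C1 w * geomcount Y (nat_ratio R n) C2 w))%:E.
have mgeom n B : measurable B -> measurable_fun setT
    ((fun w => geomcount Y (nat_ratio R n) B w) : Omega -> measurableTypeR R).
  move=> mB; apply: measurable_mulR => //; apply: measurable_addR => //.
  apply: measurable_oppR; apply: measurable_powcount => //.
  by have /andP[-> /ltW ->] := tn01 n.
have mu n : measurable_fun setT (u n).
  apply/measurable_EFinP; apply: measurable_mulR; first exact: measurable_powcount.
  by apply: measurable_mulR; exact: mgeom.
have u0 n w : (0 <= u n w)%E by rewrite lee_fin; apply: mulr_ge0 => //; apply: mulr_ge0; exact: geomcount_ge0.
have ndu w : {homo u ^~ w : k l / (k <= l)%N >-> (k <= l)%E}.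
  move=> k l kl; rewrite lee_fin ler_wpM2l// ler_pM ?geomcount_ge0//; exact: nd_geomcount.
have ulim w : u n w @[n --> \oo] -->
    ((T t0 A w)%:E * (point_measure Y w C1 * point_measure Y w C2))%E.
  rewrite /u; under eq_fun do rewrite EFinM.
  apply: cvgeZl => //; under eq_fun do rewrite EFinM.
  apply: cvg_emul_nd; try exact: cvg_geomcount.
  - by move=> n; rewrite lee_fin geomcount_ge0.
  - by move=> n; rewrite lee_fin geomcount_ge0.
  - by move=> k l kl; rewrite lee_fin; exact: nd_geomcount.
  - by move=> k l kl; rewrite lee_fin; exact: nd_geomcount.
have := @cvg_monotone_convergence _ _ _ P setT measurableT u (fun n => mu n)
   (fun n w _ => u0 n w) (fun w _ => ndu w).
rewrite (eq_integral (fun w => (T t0 A w)%:E * (point_measure Y w C1 * point_measure Y w C2))%E);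
  last by move=> w _; exact: (cvg_lim _ (ulim w)).
move=> cvg1; apply: (cvg_unique (@ereal_hausdorff R) cvg1).
rewrite (_ : (fun n => _) = (fun n => (expR (- ((1 - t0) * m A)) *
    (geommean (nat_ratio R n) (m C1) * geommean (nat_ratio R n) (m C2)))%:E)); last first.
  by apply/funext => n; exact: integral_geomcount.
apply: cvg_EFin; first exact: nearW.
apply: cvgM; first exact: cvg_cst.
by apply: cvgM; apply: cvg_geommean; exact: mean_count_ge0.
Qed.

End disjoint_sets.
End joint_counts.

Lemma cvg_expR_quotient (R : realType) (x : R) : 0 <= x ->
  (expR (n.+1%:R^-1 * x) - 1) / n.+1%:R^-1 @[n --> \oo] --> x.
Proof.
move=> x0.
have hx : (fun n : nat => n.+1%:R^-1 * x) @ \oo --> (0 : R).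
  by rewrite -[X in _ --> X](mul0r x); apply: cvgM; [exact: cvg_harmonic|exact: cvg_cst].
apply: (@squeeze_cvgr _ _ _ _ (cst x) (fun n => x / (1 - n.+1%:R^-1 * x))).
- have : \forall n \near \oo, (n.+1%:R^-1 * x : R) < 1.
    by apply: (cvgr_lt _ hx); exact: ltr01.
  apply: filterS => n; set h : R := n.+1%:R^-1 => hx1.
  have h0 : 0 < h by rewrite invr_gt0.
  have d0 : 0 < 1 - h * x by rewrite subr_gt0.
  apply/andP; split.
    by rewrite ler_pdivlMr//; have := expR_ge1Dx (h * x); rewrite /cst; lra.
  have e1 : expR (h * x) <= (1 - h * x)^-1.
    rewrite -[leLHS]invrK lef_pV2 ?posrE ?invr_gt0 ?expR_gt0// -expRN.
    exact: expR_ge1Dx.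
  have -> : x / (1 - h * x) = ((1 - h * x)^-1 - 1) / h.
    by field; rewrite !gt_eqF.
  by rewrite ler_pM2r ?invr_gt0//; lra.
- exact: cvg_cst.
rewrite -[X in _ --> X]divr1; apply: cvgM; first exact: cvg_cst.
apply: cvgV; first by rewrite oner_eq0.
by rewrite -[X in _ --> X]subr0; apply: cvgB; first exact: cvg_cst.
Qed.

Section one_point_weight.
Context d (Omega : measurableType d) (R : realType) (P : probability Omega R).
Variables (lambda : R) (Y : nat -> Omega -> plane R).
Hypotheses (lambda_ge0 : 0 <= lambda) (mY : forall i, measurable_fun setT (Y i)).
Hypothesis pgfl : has_poisson_functional P lambda Y.
Variables (rho : R) (A C1 C2 : set (plane R)).
Hypotheses (rho0 : 0 <= rho) (mA : measurable A) (mC1 : measurable C1)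
  (mC2 : measurable C2) (bA : A `<=` disc 0 rho) (bC1 : C1 `<=` disc 0 rho)
  (bC2 : C2 `<=` disc 0 rho) (AC1 : A `&` C1 = set0) (AC2 : A `&` C2 = set0)
  (C12 : C1 `&` C2 = set0).

Local Notation m := (mean_count lambda).
Local Notation T := (powcount Y).
Let W w := (point_measure Y w C1 * point_measure Y w C2)%E.

Let TW t0 : 0 <= t0 <= 1 -> (\int[P]_w ((T t0 A w)%:E * W w) =
   (expR (- ((1 - t0) * m A)) * (m C1 * m C2))%:E)%E.
Proof.
exact: (integral_powcount_product lambda_ge0 mY pgfl rho0 mA mC1 mC2 bA bC1 bC2 AC1 AC2 C12).
Qed.

Let W0 w : (0 <= W w)%E.
Proof. by rewrite mule_ge0. Qed.

Let mW : measurable_fun setT W.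
Proof. by apply: emeasurable_funM; exact: measurable_point_measure. Qed.

Lemma integral_count_product :
  (\int[P]_w (point_measure Y w C1 * point_measure Y w C2) = (m C1 * m C2)%:E)%E.
Proof.
have h1 : 0 <= (1 : R) <= 1 by rewrite ler01 lexx.
have := TW h1; rewrite subrr mul0r oppr0 expR0 mul1r => <-.
by apply: eq_integral => w _; rewrite powcount1 mul1e.
Qed.

Let tn (n : nat) : R := n.+2%:R^-1.
Let tn0 n : 0 < tn n. Proof. by rewrite invr_gt0. Qed.
Let tn01 n : 0 <= tn n <= 1.
Proof. by rewrite ltW//= invf_le1// ler1n. Qed.

(** The difference quotient at [0] of [t |-> T t A w]. Its limit is the coefficient
    of degree 1, the indicator that the count of [A] is 1. *)
Let c n w : R := (T (tn n) A w - T 0 A w) / tn n.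

Let z01 : 0 <= (0 : R) <= 1. Proof. by rewrite lexx ler01. Qed.

Let c_eq n w k : count_eq Y A k.+1 w -> c n w = tn n ^+ k.
Proof.
move=> kw; rewrite /c !(powcount_eq _ kw) expr0n subr0 exprSr mulfK//.
by rewrite gt_eqF.
Qed.

Let c_eq0 n w : count_eq Y A 0 w \/ first_points Y A w n @[n --> \oo] --> \oo ->
  c n w = 0.
Proof.
move=> [kw|fpy]; first by rewrite /c !(powcount_eq _ kw) subrr mul0r.
have h1 : 0 <= tn n < 1 by rewrite ltW//= invf_lt1// ltr1n.
have h0 : 0 <= (0 : R) < 1 by rewrite lexx ltr01.
by rewrite /c (powcount_infty h1 fpy) (powcount_infty h0 fpy) subrr mul0r.
Qed.

Let cases w : (exists k, count_eq Y A k.+1 w) \/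
  (~ count_eq Y A 1 w /\ forall n, c n w = 0).
Proof.
have [[[|k] kw]|[inf fpy]] := point_measure_cases Y A w.
- right; split; last by move=> n; apply: c_eq0; left.
  by rewrite /count_eq/= kw => -[] /eqP; rewrite eqr_nat.
- by left; exists k.
- right; split; last by move=> n; apply: c_eq0; right.
  by rewrite /count_eq/= inf.
Qed.

Let c_lim w : c n w @[n --> \oo] --> (\1_(count_eq Y A 1) w : R).
Proof.
have tn_cvg : tn @ \oo --> (0 : R).
  by have := @cvg_harmonic R; rewrite -cvg_shiftS.
have [[k kw]|[n1 cn0]] := cases w; last first.
  rewrite indicE memNset//; under eq_fun do rewrite cn0; exact: cvg_cst.
under eq_fun do rewrite (c_eq _ kw).
case: k kw => [|k] kw.
  by under eq_fun do rewrite expr0; rewrite indicE mem_set//; exact: cvg_cst.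
rewrite indicE memNset; last first.
  by rewrite /count_eq/= kw => -[] /eqP; rewrite eqr_nat.
have -> : false%:R = 0 ^+ k.+1 :> R by rewrite expr0n.
exact: (continuous_cvg _ (@exprn_continuous _ k.+1 0) tn_cvg).
Qed.

Let c01 n w : 0 <= c n w <= 1.
Proof.
have [[k kw]|[_ ->]] := cases w; last by rewrite lexx ler01.
by rewrite (c_eq _ kw) exprn_ge0 ?exprn_ile1 ?(ltW (tn0 n))//; have /andP[] := tn01 n.
Qed.

Let mc n : measurable_fun setT ((fun w => c n w) : Omega -> measurableTypeR R).
Proof.
apply: measurable_mulR => //; apply: measurable_addR; first exact: measurable_powcount.
by apply: measurable_oppR; exact: measurable_powcount.
Qed.

Let cW n : (\int[P]_w ((c n w)%:E * W w) =
  ((expR (- ((1 - tn n) * m A)) - expR (- m A)) / tn n * (m C1 * m C2))%:E)%E.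
Proof.
have : (\int[P]_w ((T (tn n) A w)%:E * W w) =
    \int[P]_w ((T 0 A w)%:E * W w) + (tn n)%:E * \int[P]_w ((c n w)%:E * W w))%E.
  have p0 t : 0 <= t <= 1 -> forall w, (0 <= (T t A w)%:E * W w)%E.
    by move=> t01 w; rewrite mule_ge0 ?lee_fin//; have /andP[] := powcount01 Y A w t01.
  have cw0 w : (0 <= (c n w)%:E * W w)%E.
    by rewrite mule_ge0 ?lee_fin//; have /andP[] := c01 n w.
  have mcW : measurable_fun setT (fun w => (c n w)%:E * W w)%E.
    by apply: emeasurable_funM => //; apply/measurable_EFinP; exact: mc.
  rewrite -ge0_integralZl; last 4 first.
  - by [].
  - exact: mcW.
  - by move=> w _.
  - by rewrite lee_fin ltW.
  rewrite -ge0_integralD; last 5 first.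
  - by [].
  - by move=> w _; exact: p0.
  - by apply: emeasurable_funM => //; apply/measurable_EFinP; exact: measurable_powcount.
  - by move=> w _; rewrite mule_ge0// lee_fin ltW.
  - exact: measurable_funeM.
  apply: eq_integral => w _; rewrite [X in (_ + X)%E]muleA -EFinM -ge0_muleDl; last 2 first.
  - by rewrite lee_fin; have /andP[] := powcount01 Y A w z01.
  - by rewrite lee_fin mulr_ge0 ?(ltW (tn0 n))//; have /andP[] := c01 n w.
  rewrite -EFinD; congr (_%:E * _)%E; rewrite /c mulrC divfK ?gt_eqF//.
  by rewrite addrC subrK.
rewrite !TW// subr0 mul1r.
set I := (\int[P]_w _)%E; set e1 := expR _; set e0 := expR (- m A); set M := m C1 * m C2.
have t0 := tn0 n.
case: I => [r| |]; last 2 first.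
- by rewrite gt0_muley ?lte_fin.
- by rewrite gt0_muleNy ?lte_fin.
rewrite -EFinM -EFinD => -[] h; congr EFin.
apply: (mulfI (lt0r_neq0 t0)); apply: (addrI (e0 * M)); rewrite -h.
by field; rewrite gt_eqF.
Qed.

(** Dominated convergence in the difference quotient at [t0 = 0] of
    [integral_powcount_product]. *)
Lemma integral_one_point_weight :
  (\int[P]_w ((\1_(count_eq Y A 1) w)%:E *
     (point_measure Y w C1 * point_measure Y w C2)) =
   (m A * expR (- m A) * (m C1 * m C2))%:E)%E.
Proof.
have iW : P.-integrable setT W.
  apply/integrableP; split=> //; under eq_integral do rewrite gee0_abs//.
  by rewrite /W integral_count_product ltry.
have [] // := @dominated_convergence _ _ _ P setT measurableT
  (fun n w => (c n w)%:E * W w)%E (fun w => (\1_(count_eq Y A 1) w)%:E * W w)%E W.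
- by move=> n; apply: emeasurable_funM => //; apply/measurable_EFinP; exact: mc.
- apply: emeasurable_funM => //; apply/measurable_EFinP; apply: measurable_indic.
  exact: measurable_count_eq.
- have := integrable_ae measurableT iW; apply: filterS => w /(_ Logic.I) finW _.
  rewrite muleC; under eq_fun do rewrite muleC.
  by apply: cvgeZl => //; apply: cvg_EFin; [exact: nearW|exact: c_lim].
- apply: aeW => w n _; have /andP[c0 c1] := c01 n w.
  rewrite gee0_abs; last by rewrite mule_ge0 ?lee_fin.
  by rewrite -[leRHS]mul1e lee_wpmul2r ?lee_fin.
move=> _ _ cvg1; apply: (cvg_unique (@ereal_hausdorff R) cvg1).
rewrite (_ : [sequence _]_n = (fun n => ((expR (- ((1 - tn n) * m A)) - expR (- m A)) /
    tn n * (m C1 * m C2))%:E)); last by apply/funext => n; exact: cW.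
apply: cvg_EFin; first exact: nearW.
apply: cvgM; last exact: cvg_cst.
rewrite [X in _ --> X]mulrC.
rewrite (_ : (fun n => _) = (fun n => expR (- m A) * ((expR (n.+2%:R^-1 * m A) - 1) / n.+2%:R^-1))).
  apply: cvgM; first exact: cvg_cst.
  by have := cvg_expR_quotient (mean_count_ge0 lambda_ge0 A); rewrite -cvg_shiftS.
apply/funext => n; rewrite mulrA mulrBr mulr1 -expRD -/(tn n).
by congr ((expR _ - _) / _); ring.
Qed.

End one_point_weight.

(** * The pair measure of the field *)

(** Rectangles form a pi-system that generates the product sigma-algebra. *)
Lemma measure_rectangle_unique d1 d2 (T1 : measurableType d1) (T2 : measurableType d2)
    (R : realType) (m1 m2 : {measure set (T1 * T2) -> \bar R}) :
  (m1 setT < +oo)%E ->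
  (forall A B, measurable A -> measurable B -> m1 (A `*` B) = m2 (A `*` B)) ->
  forall C, measurable C -> m1 C = m2 C.
Proof.
move=> fin1 m12; pose G := [set A `*` B | A in (@measurable _ T1) & B in (@measurable _ T2)].
apply: (measure_unique G (fun=> setT)).
- by rewrite measurable_prod_measurableType.
- move=> _ _ [A mA [B mB <-]] [A' mA' [B' mB' <-]]; rewrite -setXI.
  by exists (A `&` A'); [exact: measurableI|exists (B `&` B') => //; exact: measurableI].
- by move=> _; exists setT => //; exists setT => //; rewrite setXTT.
- by apply/seteqP; split => // x _; exists 0%N.
- by move=> _ [A mA [B mB <-]]; exact: m12.
- by [].
Qed.

Section campbell_measure.
Context d (Omega : measurableType d) (R : realType) (P : probability Omega R).
Variables (Y : nat -> Omega -> plane R).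
Hypothesis (mY : forall i, measurable_fun setT (Y i)).

Let located i j w := ((Y i w, Y j w), w).

Let mlocated i j : measurable_fun setT (located i j).
Proof. by apply: measurable_fun_pair => //; exact: measurable_fun_pair. Qed.

(** The mean number of ordered pairs of indices [(i, j)] such that the two points,
    together with the outcome, lie in a given set. Keeping the outcome as a
    component allows conditions on the whole configuration. *)
Definition campbell : set (plane R * plane R * Omega) -> \bar R :=
  mseries (fun i => mseries (fun j => image_measure P (mlocated i j)) 0) 0.

HB.instance Definition _ := Measure.on campbell.

Lemma campbellE E : campbell E =
  (\sum_(0 <= i <oo) \sum_(0 <= j <oo) P [set w | E ((Y i w, Y j w), w)])%E.
Proof. by []. Qed.

Lemma campbell_rectangle B1 B2 G : measurable B1 -> measurable B2 -> measurable G ->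
  campbell ((B1 `*` B2) `*` G) =
  (\int[P]_w ((\1_G w)%:E * (point_measure Y w B1 * point_measure Y w B2)))%E.
Proof.
move=> mB1 mB2 mG; rewrite campbellE.
have m1 i := measurable_indic_point mY i mB1.
have m2 j := measurable_indic_point mY j mB2.
have mIG : measurable_fun setT (fun w => (\1_G w : R)%:E).
  by apply/measurable_EFinP; exact: measurable_indic.
have PE i j : P [set w | ((B1 `*` B2) `*` G) ((Y i w, Y j w), w)] =
    (\int[P]_w ((\1_G w)%:E * ((\1_B1 (Y i w))%:E * (\1_B2 (Y j w))%:E)))%E.
  set S := [set w | _].
  have mS : measurable S.
    rewrite (_ : S = Y i @^-1` B1 `&` Y j @^-1` B2 `&` G)//.
    apply: measurableI => //; apply: measurableI; rewrite -[X in measurable X]setTI; exact: mY.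
  transitivity (\int[P]_w (\1_S w)%:E)%E; first by rewrite integral_indic// setIT.
  apply: eq_integral => w _; rewrite -!EFinM; congr EFin.
  rewrite !indicE; case: (boolP (w \in G)) => [/set_mem wG|/negP wG]; last first.
    by rewrite mul0r memNset// => -[_ /= wG']; apply: wG; exact: mem_set.
  rewrite mul1r; case: (boolP (Y i w \in B1)) => [/set_mem w1|/negP w1]; last first.
    by rewrite mul0r memNset// => -[[/= w1' _] _]; apply: w1; exact: mem_set.
  rewrite mul1r; case: (boolP (Y j w \in B2)) => [/set_mem w2|/negP w2]; last first.
    by rewrite memNset// => -[[/= _ w2'] _]; apply: w2; exact: mem_set.
  by rewrite mem_set.
transitivity (\sum_(0 <= i <oo) \int[P]_w ((\1_G w)%:E * ((\1_B1 (Y i w))%:E * point_measure Y w B2)))%E.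
  apply: eq_eseriesr => i _; under eq_eseriesr do rewrite PE.
  rewrite -integral_nneseries; last 3 first.
  - by [].
  - by move=> j; apply: emeasurable_funM => //; exact: emeasurable_funM.
  - by move=> j w _; rewrite !mule_ge0 ?lee_fin.
  apply: eq_integral => w _; rewrite nneseries_mull; last 2 first.
  - by rewrite lee_fin.
  - by move=> m; rewrite mule_ge0 ?lee_fin.
  by rewrite nneseries_mull// => m; rewrite lee_fin.
rewrite -integral_nneseries; last 3 first.
- by [].
- move=> j; apply: emeasurable_funM => //; apply: emeasurable_funM => //.
  exact: measurable_point_measure.
- by move=> j w _; rewrite !mule_ge0 ?lee_fin.
apply: eq_integral => w _; rewrite nneseries_mull//; last first.
  by move=> m; rewrite !mule_ge0 ?lee_fin.
congr (_ * _)%E; rewrite [RHS]muleC.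
under eq_eseriesr do rewrite muleC.
by rewrite nneseries_mull// => m; rewrite lee_fin.
Qed.

(** Proportionality to area squared on the rectangles inside [D1 `*` D2] extends to
    all measurable subsets of [D1 `*` D2]. *)
Lemma campbell_sub_rectangle (D1 D2 : set (plane R)) (G : set Omega) (kappa : R) :
  measurable D1 -> measurable D2 -> measurable G -> 0 <= kappa ->
  (area D1 < +oo)%E -> (area D2 < +oo)%E ->
  (forall B1 B2, measurable B1 -> measurable B2 -> B1 `<=` D1 -> B2 `<=` D2 ->
    \int[P]_w ((\1_G w)%:E * (point_measure Y w B1 * point_measure Y w B2)) =
    (kappa * (fine (area B1) * fine (area B2)))%:E)%E ->
  forall C, measurable C -> C `<=` D1 `*` D2 ->
  campbell (C `*` G) = (kappa%:E * (@area R \x @area R) C)%E.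
Proof.
move=> mD1 mD2 mG k0 f1 f2 H C mC CD.
have mDG : measurable ((D1 `*` D2) `*` G) by apply: measurableX => //; exact: measurableX.
have mD : measurable (D1 `*` D2) by exact: measurableX.
pose m1 := image_measure (mrestr campbell mDG) measurable_fst.
pose m2 := mscale (NngNum k0) (mrestr (@area R \x @area R)%E mD).
have m2E E : m2 E = (kappa%:E * (@area R \x @area R) (E `&` (D1 `*` D2)))%E by [].
have fin (B D : set (plane R)) : measurable B -> measurable D -> (area D < +oo)%E -> (area (B `&` D) < +oo)%E.
  move=> mB mD' fD; apply: le_lt_trans fD; apply: le_measure; rewrite ?inE//; exact: measurableI.
have rect A B : measurable A -> measurable B -> m1 (A `*` B) = m2 (A `*` B).
  move=> mA mB.
  transitivity (campbell (((A `&` D1) `*` (B `&` D2)) `*` G)).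
    rewrite /m1 /image_measure/= /pushforward /mrestr; congr campbell.
    by apply/seteqP; split => -[[x y] w] /=; tauto.
  have mAD : measurable (A `&` D1) by exact: measurableI.
  have mBD : measurable (B `&` D2) by exact: measurableI.
  rewrite campbell_rectangle// H//.
  rewrite m2E EFinM; congr (_ * _)%E.
  have -> : (A `*` B) `&` (D1 `*` D2) = (A `&` D1) `*` (B `&` D2).
    by apply/seteqP; split => -[x y] /=; tauto.
  rewrite (product_measure1E (@area R) (@area R) mAD mBD) EFinM.
  have f1' : area (A `&` D1) \is a fin_num by rewrite (ge0_fin_numE (measure_ge0 (@area R) _)); exact: (fin _ _ mA mD1 f1).
  have f2' : area (B `&` D2) \is a fin_num by rewrite (ge0_fin_numE (measure_ge0 (@area R) _)); exact: (fin _ _ mB mD2 f2).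
  by rewrite !fineK.
have f1C : (m1 setT < +oo)%E.
  rewrite -setXTT rect// m2E setXTT.
  rewrite setTI product_measure1E//.
  by rewrite lte_mul_pinfty// lte_mul_pinfty// ge0_fin_numE.
transitivity (m1 C); last first.
  transitivity (m2 C); last by rewrite m2E (setIidl CD).
  exact: (measure_rectangle_unique f1C rect mC).
rewrite /m1 /image_measure/= /pushforward /mrestr.
by congr campbell; apply/seteqP; split => -[z w] /= [Cz Gw]; [split=> //; split=> //; exact: CD|split=> //; case: Gw].
Qed.

End campbell_measure.

Section unique_point.
Context d (Omega : measurableType d) (R : realType).
Variable Y : nat -> Omega -> plane R.

Lemma first_points_ord B w n :
  first_points Y B w n = (\sum_(i < n) (Y i w \in B))%N.
Proof. by rewrite /first_points big_mkord. Qed.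

Lemma count_eq1P B w : count_eq Y B 1 w <-> exists! i, B (Y i w).
Proof.
split=> [|[i [Bi iu]]]; last first.
  rewrite /count_eq/= point_measureE; apply/cvg_lim => //.
  apply: cvg_near_cst; exists i.+1 => // n /= ni.
  rewrite -first_pointsE first_points_ord; congr (_%:R%:E).
  rewrite (bigD1 (Ordinal ni))//= mem_set// big1 ?addn0// => j ji.
  rewrite memNset// => Bj; move/negP: ji; apply.
  by apply/eqP/val_inj => /=; rewrite (iu _ Bj).
move=> /count_eq_near [n0 h].
have [i Bi] : exists i, B (Y i w).
  have := h n0 (leqnn _); rewrite first_points_ord => s1.
  apply: contrapT => nB; move: s1; rewrite big1// => i _.
  by rewrite memNset// => Bi; apply: nB; exists i.
exists i; split=> // j Bj; apply: contrapT => /eqP ij.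
pose n := (maxn n0 (maxn i j).+1).
have iN : (i < n)%N by rewrite /n leq_max ltnS leq_maxl orbT.
have jN : (j < n)%N by rewrite /n leq_max ltnS leq_maxr orbT.
have := h n (leq_maxl _ _); rewrite first_points_ord.
rewrite (bigD1 (Ordinal iN))//= (bigD1 (Ordinal jN))/=; last first.
  by apply: contra ij => /eqP [->].
by rewrite !mem_set.
Qed.

Lemma count_eq1_near (A_ : nat -> set (plane R)) w :
  {homo A_ : m n / (m <= n)%N >-> m `<=` n} ->
  \forall n \near \oo, count_eq Y (A_ n) 1 w <-> count_eq Y (\bigcup_n A_ n) 1 w.
Proof.
move=> ndA.
have [[i [n0 _ Ai]]|noA] := pselect (exists i, (\bigcup_n A_ n) (Y i w)); last first.
  apply: nearW => n; rewrite !count_eq1P; split=> -[i [Ai _]].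
    by exfalso; apply: noA; exists i; exists n.
  by exfalso; apply: noA; exists i.
have [[j [ij [n1 _ Aj]]]|nj] := pselect (exists j, i <> j /\ (\bigcup_n A_ n) (Y j w)).
  exists (maxn n0 n1) => // n /=; rewrite geq_max => /andP[n0n n1n].
  rewrite !count_eq1P; split=> -[k [_ ku]]; exfalso; apply: ij.
    exact: etrans (esym (ku i (ndA _ _ n0n _ Ai))) (ku j (ndA _ _ n1n _ Aj)).
  by apply: etrans (esym (ku i _)) (ku j _); [exists n0|exists n1].
exists n0 => // n /= n0n; rewrite !count_eq1P; split=> _; exists i; split.
- by exists n0.
- by move=> j Aj; apply: contrapT => ij; apply: nj; exists j.
- exact: ndA Ai.
- by move=> j Aj; apply: contrapT => ij; apply: nj; exists j; split=> //; exists n.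
Qed.

End unique_point.

Lemma one_point_mass_le1 (R : realType) (m : R) : 0 <= m -> one_point_mass m <= 1.
Proof.
move=> m0; rewrite /one_point_mass ger0_norm// expRN ler_pdivrMr ?expR_gt0//.
by rewrite mul1r; have := expR_ge1Dx m; lra.
Qed.

Lemma one_point_mass_ge0 (R : realType) (m : R) : 0 <= one_point_mass m.
Proof. by rewrite mulr_ge0// expR_ge0. Qed.

Lemma continuous_one_point_mass (R : realType) : continuous (@one_point_mass R).
Proof.
move=> m; apply: continuousM; first exact: norm_continuous.
apply: continuous_comp; last exact: continuous_expR.
exact: opp_continuous.
Qed.

Section campbell_one_point.
Context d (Omega : measurableType d) (R : realType) (P : probability Omega R).
Variables (lambda : R) (Y : nat -> Omega -> plane R).
Hypotheses (lambda_ge0 : 0 <= lambda) (mY : forall i, measurable_fun setT (Y i)).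
Hypothesis pgfl : has_poisson_functional P lambda Y.
Variables (rho : R) (D1 D2 : set (plane R)).
Hypotheses (rho0 : 0 <= rho) (mD1 : measurable D1)
  (mD2 : measurable D2) (bD1 : D1 `<=` disc 0 rho)
  (bD2 : D2 `<=` disc 0 rho) (D12 : D1 `&` D2 = set0).

Local Notation m := (mean_count lambda).
Local Notation Q := (campbell P mY).

(** For disjoint sets the indices [i = j] do not contribute. *)
Lemma campbell_setT C : measurable C -> C `<=` D1 `*` D2 ->
  Q (C `*` setT) = ((lambda ^+ 2)%:E * (@area R \x @area R) C)%E.
Proof.
move=> mC CD; apply: (campbell_sub_rectangle mY mD1 mD2 measurableT (sqr_ge0 _) (area_bounded_lty mD1 bD1) (area_bounded_lty mD2 bD2)) => //.
move=> B1 B2 mB1 mB2 B1D B2D.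
have B12 : B1 `&` B2 = set0.
  by apply/seteqP; split => // x [x1 x2]; rewrite -D12; split; [exact: B1D|exact: B2D].
rewrite (_ : (lambda ^+ 2 * _) = m B1 * m B2); last by rewrite /mean_count; ring.
rewrite -(integral_count_product lambda_ge0 mY pgfl rho0 (@measurable0 _ (plane R)) mB1 mB2 (@sub0set _ _) (subset_trans B1D bD1) (subset_trans B2D bD2) (set0I _) (set0I _) B12)//.
by apply: eq_integral => w _; rewrite indicE in_setT mul1e.
Qed.

(** A pair of points off [A] is independent of the configuration in [A]. *)
Lemma campbell_count_eq1 C A r : measurable C -> C `<=` D1 `*` D2 ->
  measurable A -> A `<=` disc 0 r ->
  (forall z, C z -> ~ A z.1 /\ ~ A z.2) ->
  Q (C `*` count_eq Y A 1) =
  ((lambda ^+ 2 * one_point_mass (m A))%:E * (@area R \x @area R) C)%E.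
Proof.
move=> mC CD mA bA CA; pose r' := Num.max rho r.
have disc_le (x : R) : x <= r' -> disc 0 x `<=` disc (0 : R) r'.
  by move=> xr y; rewrite /disc/= => h; exact: lt_le_trans xr.
have bD1' : D1 `<=` disc 0 r' by apply: (subset_trans bD1); apply: disc_le; rewrite le_max lexx.
have bD2' : D2 `<=` disc 0 r' by apply: (subset_trans bD2); apply: disc_le; rewrite le_max lexx.
have bA' : A `<=` disc 0 r' by apply: (subset_trans bA); apply: disc_le; rewrite le_max lexx orbT.
have r'0 : 0 <= r' by rewrite le_max rho0.
have mD1A : measurable (D1 `\` A) by exact: measurableD.
have mD2A : measurable (D2 `\` A) by exact: measurableD.
apply: (campbell_sub_rectangle mY (D1 := D1 `\` A) (D2 := D2 `\` A)) => //.
- exact: measurable_count_eq.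
- by apply: mulr_ge0; [exact: sqr_ge0|exact: one_point_mass_ge0].
- by apply: (area_bounded_lty mD1A); exact: subset_trans bD1'.
- by apply: (area_bounded_lty mD2A); exact: subset_trans bD2'.
- move=> B1 B2 mB1 mB2 B1D B2D.
  have B12 : B1 `&` B2 = set0.
    apply/seteqP; split => // x [x1 x2]; rewrite -D12.
    by split; [exact: (B1D _ x1).1|exact: (B2D _ x2).1].
  rewrite (integral_one_point_weight lambda_ge0 mY pgfl r'0 mA mB1 mB2 bA' _ _ _ _ B12).
  - rewrite /one_point_mass ger0_norm ?mean_count_ge0// /mean_count; congr EFin; ring.
  - by move=> x /B1D [/bD1'].
  - by move=> x /B2D [/bD2'].
  - by apply/seteqP; split => // x [Ax /B1D []].
  - by apply/seteqP; split => // x [Ax /B2D []].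
- by move=> z Cz; have [? ?] := CA z Cz; have [? ?] := CD z Cz; split; split.
Qed.

End campbell_one_point.

(** * Regions that depend on the pair *)

Section campbell_random_region.
Context d (Omega : measurableType d) (R : realType) (P : probability Omega R).
Variables (lambda : R) (Y : nat -> Omega -> plane R).
Hypotheses (lambda_ge0 : 0 <= lambda) (mY : forall i, measurable_fun setT (Y i)).
Hypothesis pgfl : has_poisson_functional P lambda Y.
Variables (rho : R) (D1 D2 : set (plane R)).
Hypotheses (rho0 : 0 <= rho) (mD1 : measurable D1)
  (mD2 : measurable D2) (bD1 : D1 `<=` disc 0 rho)
  (bD2 : D2 `<=` disc 0 rho) (D12 : D1 `&` D2 = set0).
Variables (C : set (plane R * plane R)) (idx : nat -> plane R * plane R -> nat)
  (a : nat -> nat -> set (plane R)).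
Hypotheses (mC : measurable C) (CD : C `<=` D1 `*` D2)
  (midx : forall n k, measurable (idx n @^-1` [set k]))
  (ma : forall n k, measurable (a n k))
  (ba : forall n k, exists r, a n k `<=` disc 0 r).

Local Notation m := (mean_count lambda).
Local Notation Q := (campbell P mY).
Local Notation aa := (@area R \x @area R)%E.

Let cell n z := a n (idx n z).
Let A z := \bigcup_n cell n z.

Hypotheses (ndA : forall z, C z -> {homo cell^~ z : n m / (n <= m)%N >-> n `<=` m})
  (missA : forall z, C z -> ~ A z z.1 /\ ~ A z z.2)
  (bA : forall z, C z -> exists r, A z `<=` disc 0 r).

Let E n := [set u : plane R * plane R * Omega | C u.1 /\ count_eq Y (cell n u.1) 1 u.2].

Let piece n k := (C `&` idx n @^-1` [set k]) `*` count_eq Y (a n k) 1.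

Let E_piece n : E n = \bigcup_k piece n k.
Proof.
apply/seteqP; split => [[z w] /= [Cz h]|[z w] [k _ [/= [Cz zk] h]]].
  by exists (idx n z).
by split => //=; rewrite /cell zk.
Qed.

Let mpiece n k : measurable (piece n k).
Proof. by apply: measurableX; [exact: measurableI|exact: measurable_count_eq]. Qed.

Let mE n : measurable (E n).
Proof. by rewrite E_piece; exact: bigcupT_measurable. Qed.

Let weight B : R := lambda ^+ 2 * one_point_mass (m B).

Let weight_ge0 B : 0 <= weight B.
Proof. by apply: mulr_ge0; [exact: sqr_ge0|exact: one_point_mass_ge0]. Qed.

Let mweight n : measurable_fun setT (fun z => (weight (cell n z))%:E).
Proof.
apply/measurable_EFinP => _ B mB; rewrite setTI.
rewrite (_ : _ @^-1` B = \bigcup_(k in [set k | B (weight (a n k))]) idx n @^-1` [set k]).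
  by apply: bigcup_measurable => k _; exact: midx.
apply/seteqP; split => [z Bz|z [k /= Bk zk]]; first by exists (idx n z).
by rewrite /cell/= zk.
Qed.

Let level n : Q (E n) = (\int[aa]_(z in C) (weight (cell n z))%:E)%E.
Proof.
rewrite E_piece measure_bigcup//; last first.
  apply/trivIsetP => k l _ _ /eqP kl; apply/seteqP; split => // -[z w] [[/= [_ zk] _] [/= [_ zl] _]].
  by apply: kl; rewrite -zk -zl.
have CE : C = \bigcup_k (C `&` idx n @^-1` [set k]).
  by apply/seteqP; split => [z Cz|z [k _ []]]//; exists (idx n z).
rewrite [in RHS]CE ge0_integral_bigcup; last 4 first.
- by move=> k; exact: measurableI.
- by apply: measurable_funTS; exact: mweight.
- by move=> z _; rewrite lee_fin.
- apply/trivIsetP => k l _ _ /eqP kl; apply/seteqP; split => // z [[_ zk] [_ zl]].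
  by apply: kl; rewrite -zk -zl.
rewrite (eq_eseriesl (Q := xpredT)); last by move=> k; rewrite in_setT.
apply: eq_eseriesr => k _.
have [r ar] := ba n k.
have mCk : measurable (C `&` idx n @^-1` [set k]) by exact: measurableI.
have CkD : C `&` idx n @^-1` [set k] `<=` D1 `*` D2 by apply: subset_trans CD; exact: subIsetl.
have missk z : (C `&` idx n @^-1` [set k]) z -> ~ a n k z.1 /\ ~ a n k z.2.
  move=> [Cz zk]; have [n1 n2] := missA Cz.
  by split => h; [apply: n1|apply: n2]; exists n => //; rewrite /cell zk.
transitivity ((weight (a n k))%:E * aa (C `&` idx n @^-1` [set k]))%E.
  exact: (campbell_count_eq1 lambda_ge0 mY pgfl rho0 mD1 mD2 bD1 bD2 D12 mCk CkD (ma n k) ar missk).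
by rewrite -(integral_cst aa mCk); apply: eq_integral => z /set_mem[_ <-].
Qed.

Let Elim := [set u : plane R * plane R * Omega | C u.1 /\ count_eq Y (A u.1) 1 u.2].

Let cvg_indic_E u : (\1_(E n) u : R) @[n --> \oo] --> (\1_Elim u : R).
Proof.
have [Cu|nCu] := pselect (C u.1); last first.
  by rewrite indicE memNset => [|[]//]; apply: cvg_near_cst; apply: nearW => n;
    rewrite indicE memNset// => -[].
apply: cvg_near_cst; have := count_eq1_near Y u.2 (ndA Cu).
apply: filterS => n h; rewrite !indicE; congr ((nat_of_bool _)%:R); apply/idP/idP => /set_mem [_ k];
  apply/mem_set; split => //; exact/h.
Qed.

Let mElim : measurable Elim.
Proof.
have mI : measurable_fun setT (\1_Elim : _ -> R).
  by apply: measurable_fun_cvg => [n|u _]; [exact: measurable_indic (mE n)|exact: cvg_indic_E].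
rewrite (_ : Elim = \1_Elim @^-1` [set (1 : R)]); last first.
  apply/seteqP; split => u; rewrite /= indicE; first by move=> h; rewrite mem_set.
  by case: (boolP (u \in Elim)) => [/set_mem//|_] /esym/eqP; rewrite oner_eq0.
by rewrite -[X in measurable X]setTI; exact: (mI measurableT _ (measurable_set1 _)).
Qed.

Let aaC : (aa C < +oo)%E.
Proof.
apply: (@le_lt_trans _ _ (aa (D1 `*` D2))).
  by apply: le_measure; rewrite ?inE//; exact: measurableX.
rewrite (product_measure1E (@area R) (@area R) mD1 mD2).
have f1 := area_bounded_lty mD1 bD1; have f2 := area_bounded_lty mD2 bD2.
by apply: lte_mul_pinfty => //; rewrite (ge0_fin_numE (measure_ge0 (@area R) _)).
Qed.

Let mA z : measurable (A z).
Proof. by apply: bigcupT_measurable => n; exact: ma. Qed.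

Let cvg_weight z : C z -> (weight (cell n z))%:E @[n --> \oo] --> (weight (A z))%:E.
Proof.
move=> Cz; apply: cvg_EFin; first exact: nearW.
apply: cvgM; first exact: cvg_cst.
apply: (cvg_comp (fun n => m (cell n z)) (@one_point_mass R)); last exact: continuous_one_point_mass.
apply: cvgM; first exact: cvg_cst.
apply: fine_cvg; rewrite fineK; last first.
  have [r Ar] := bA Cz.
  by rewrite (ge0_fin_numE (measure_ge0 (@area R) _)); exact: area_bounded_lty (mA z) Ar.
apply: (nondecreasing_cvg_mu (mu := @area R) (F := cell^~ z)) => //.
- by move=> n; exact: ma.
- exact: mA.
- by move=> p q pq; apply/subsetPset; exact: ndA.
Qed.

(** In the Campbell formula with a region [A z] that depends on the pair [z], the
    region is the increasing union of regions [cell n z] taking countably many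
    values. At level [n], [campbell_count_eq1] applies on each set of pairs where
    the region is constant. A count of exactly one point passes to the limit by
    [count_eq1_near], and both sides by dominated convergence. *)
Lemma campbell_random_region : measurable Elim /\
  Q Elim = (\int[aa]_(z in C) (weight (A z))%:E)%E.
Proof.
split; first exact: mElim.
have QC : (Q (C `*` setT) < +oo)%E.
  rewrite (campbell_setT lambda_ge0 mY pgfl rho0 mD1 mD2 bD1 bD2 D12 mC CD).
  by apply: lte_mul_pinfty => //; rewrite lee_fin sqr_ge0.
have mCT : measurable (C `*` @setT Omega) by exact: measurableX.
have QE : (fun n => Q (E n)) @ \oo --> Q Elim.
  have [] // := @dominated_convergence _ _ _ Q setT measurableT (fun n u => (\1_(E n) u)%:E)
    (fun u => (\1_Elim u)%:E) (fun u => (\1_(C `*` setT) u)%:E).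
  - by move=> n; apply/measurable_EFinP; exact: measurable_indic.
  - by apply/measurable_EFinP; exact: measurable_indic.
  - by apply: aeW => u _; apply: cvg_EFin; [exact: nearW|exact: cvg_indic_E].
  - apply/integrableP; split; first by apply/measurable_EFinP; exact: measurable_indic.
    under eq_integral do rewrite gee0_abs ?lee_fin//.
    by rewrite integral_indic// setIT.
  - apply: aeW => u n _; rewrite gee0_abs ?lee_fin// !indicE.
    case: (boolP (u \in E n)) => // /set_mem[Cu _]; by rewrite mem_set.
  rewrite (_ : (fun n => Q (E n)) = fun n => \int[Q]_u (\1_(E n) u)%:E)%E; last first.
    by apply/funext => n; rewrite integral_indic// setIT.
  by rewrite integral_indic// setIT.
apply: (cvg_unique (@ereal_hausdorff R) QE).
rewrite (_ : (fun n => Q (E n)) = fun n => \int[aa]_(z in C) (weight (cell n z))%:E)%E; last first.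
  by apply/funext => n; exact: level.
have [] // := @dominated_convergence _ _ _ aa C mC (fun n z => (weight (cell n z))%:E)
    (fun z => (weight (A z))%:E) (cst (lambda ^+ 2)%:E).
- by move=> n; apply: measurable_funTS; exact: mweight.
- apply: (emeasurable_fun_cvg (fun n z => (weight (cell n z))%:E)) => [n|z Cz].
    by apply: measurable_funTS; exact: mweight.
  exact: cvg_weight.
- by apply: aeW => z Cz; exact: cvg_weight.
- apply/integrableP; split; first exact: measurable_cst.
  under eq_integral do rewrite gee0_abs ?lee_fin ?sqr_ge0//.
  rewrite integral_cst//; apply: lte_mul_pinfty => //; by rewrite lee_fin sqr_ge0.
apply: aeW => z n Cz; rewrite gee0_abs ?lee_fin//.
by rewrite /weight ler_piMr ?sqr_ge0// one_point_mass_le1// mean_count_ge0.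
Qed.

End campbell_random_region.

Section dyadic_grid.
Context (R : realType).
Implicit Types (x s rho : R) (n : nat) (i j : int).

Definition dyadic n i : R := i%:~R / 2 ^+ n.

Definition dyadic_index n x : int := Num.floor (2 ^+ n * x).

Let pow2_gt0 n : 0 < 2 ^+ n :> R. Proof. by rewrite exprn_gt0. Qed.

Lemma dyadic_le n x : dyadic n (dyadic_index n x) <= x.
Proof. by rewrite /dyadic ler_pdivrMr// mulrC -floor_ge_int. Qed.

Lemma dyadic_gt n x : x < dyadic n (dyadic_index n x + 1).
Proof. by rewrite /dyadic ltr_pdivlMr// mulrC -floor_lt_int ltrDl. Qed.

Lemma dyadicD1 n i : dyadic n (i + 1) = dyadic n i + (2 ^+ n)^-1.
Proof. by rewrite /dyadic intrD mulrDl mul1r. Qed.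

Lemma dyadicS n i : dyadic n i = dyadic n.+1 (2 * i).
Proof. by rewrite /dyadic intrM exprS -mulf_div divff ?mul1r// pnatr_eq0. Qed.

Lemma dyadic_mono n i j : (i <= j)%R -> dyadic n i <= dyadic n j.
Proof. by move=> ij; rewrite /dyadic ler_pM2r ?invr_gt0// ler_int. Qed.

Lemma dyadic_index_nested n x :
  dyadic n (dyadic_index n x) <= dyadic n.+1 (dyadic_index n.+1 x) /\
  dyadic n.+1 (dyadic_index n.+1 x + 1) <= dyadic n (dyadic_index n x + 1).
Proof.
have h1 := dyadic_le n x; have h2 := dyadic_gt n x.
split; rewrite (dyadicS n); apply: dyadic_mono.
  rewrite /dyadic_index floor_ge_int exprS -mulrA intrM ler_pM2l//.
  by rewrite -floor_ge_int.
rewrite lezD1 {1}/dyadic_index floor_lt_int exprS -mulrA intrM ltr_pM2l//.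
by rewrite -floor_lt_int ltrDl.
Qed.

(** Intersecting the discs at the two ends of a dyadic interval containing [s], and
    rounding [rho] down, gives a subset of [disc s rho] because the defining
    condition is affine in the parameters ([disc_bracket]); both choices are
    monotone in [n]. Indices are encoded as natural numbers. *)
Definition dyadic_region n (k : nat) : set (plane R) :=
  if (choice.unpickle k : option (int * int)) is Some (i, j) then
    disc (dyadic n i) (dyadic n j) `&` disc (dyadic n (i + 1)) (dyadic n j)
  else set0.

Definition region_index n s rho : nat := choice.pickle (dyadic_index n s, dyadic_index n rho).

Lemma dyadic_regionE n s rho : dyadic_region n (region_index n s rho) =
  disc (dyadic n (dyadic_index n s)) (dyadic n (dyadic_index n rho)) `&`
  disc (dyadic n (dyadic_index n s + 1)) (dyadic n (dyadic_index n rho)).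
Proof. by rewrite /dyadic_region /region_index choice.pickleK. Qed.

Lemma measurable_dyadic_region n k : measurable (dyadic_region n k).
Proof.
rewrite /dyadic_region; case: choice.unpickle => [[i j]|//].
by apply: measurableI; exact: measurable_disc.
Qed.

Lemma disc_bounded s rho : exists r, disc s rho `<=` disc 0 r.
Proof.
exists (2 * rho + 4 * s ^+ 2) => y; rewrite /disc/= => h.
have := sqr_ge0 (y.1 + 2 * s); have := sqr_ge0 y.2; nra.
Qed.

Lemma dyadic_region_bounded n k : exists r, dyadic_region n k `<=` disc 0 r.
Proof.
rewrite /dyadic_region; case: choice.unpickle => [[i j]|]; last by exists 0.
by have [r h] := disc_bounded (dyadic n i) (dyadic n j); exists r => y [/h].
Qed.

Lemma disc_bracket (a b s c c' : R) : a <= s -> s <= b -> c <= c' ->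
  disc a c `&` disc b c `<=` disc s c'.
Proof.
move=> sa sb cc y []; rewrite /disc/= => h1 h2.
have [y0|/ltW y0] := leP 0 y.1.
  by have := ler_wpM2l y0 sb; lra.
by have := ler_wnM2l y0 sa; lra.
Qed.

Lemma nd_dyadic_region s rho :
  {homo (fun n => dyadic_region n (region_index n s rho)) : n m / (n <= m)%N >-> n `<=` m}.
Proof.
have step n : dyadic_region n (region_index n s rho) `<=`
    dyadic_region n.+1 (region_index n.+1 s rho).
  rewrite !dyadic_regionE.
  have [l1 l2] := dyadic_index_nested n s; have [c1 _] := dyadic_index_nested n rho.
  have m1 : dyadic n.+1 (dyadic_index n.+1 s) <= dyadic n.+1 (dyadic_index n.+1 s + 1).
    by apply: dyadic_mono; rewrite lerDl.
  move=> y h; split; apply: disc_bracket c1 _ h => //.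
    exact: le_trans m1 l2.
  exact: le_trans l1 m1.
move=> n m; elim: m => [|m IH]; first by rewrite leqn0 => /eqP ->; exact: subset_refl.
rewrite leq_eqVlt => /predU1P[->|]; [exact: subset_refl|]; rewrite ltnS => /IH h.
exact: subset_trans (step m).
Qed.

(** The defining inequality of the disc is strict at each of its points, and the
    rounding changes both sides by at most a multiple of [2 ^- n]. *)
Lemma bigcup_dyadic_region s rho :
  \bigcup_n dyadic_region n (region_index n s rho) = disc s rho.
Proof.
apply/seteqP; split => [y [n _]|y].
  rewrite dyadic_regionE; apply: disc_bracket; [exact: dyadic_le|exact/ltW/dyadic_gt|exact: dyadic_le].
rewrite /disc/= => h; pose g := rho - (y.1 ^+ 2 + y.2 ^+ 2 + 2 * s * y.1).
have g0 : 0 < g by rewrite subr_gt0.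
have [n _ hn] := near_infty_natSinv_expn_lt (PosNum (divr_gt0 g0 (ltr_wpDl (normr_ge0 (2 * y.1)) (ltr01)))).
have := hn n (leqnn n); rewrite [X in X -> _]/= div1r => hn'.
exists n; [exact: Logic.I|move: hn'].
set e := (2 ^+ n)^-1; have e0 : 0 < e by rewrite invr_gt0.
rewrite ltr_pdivlMr; last by rewrite ltr_wpDl.
rewrite dyadic_regionE dyadicD1 -/e.
have l1 := dyadic_le n s; have l2 := dyadic_gt n s.
have c1 := dyadic_le n rho; have c2 := dyadic_gt n rho.
move: l2 c2; rewrite !dyadicD1 -/e => l2 c2.
have n1 := ler_norm (2 * y.1); have n2 := ler_norm (- (2 * y.1)); rewrite normrN in n2.
move: n1 n2 l1 l2 c1 c2; rewrite /g.
set a := dyadic n _; set c := dyadic n _; set N := `|_| => n1 n2 l1 l2 c1 c2 he.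
have N0 : 0 <= N by exact: normr_ge0.
have p1 : 0 <= (N + 2 * y.1) * (s - a) by apply: mulr_ge0; lra.
have p2 : 0 <= (N - 2 * y.1) * (a + e - s) by apply: mulr_ge0; lra.
have p3 : 0 <= N * (s - a) by apply: mulr_ge0; lra.
have p4 : 0 <= N * (a + e - s) by apply: mulr_ge0; lra.
by split; rewrite /disc/=; nra.
Qed.

Lemma measurable_region_index d (T : measurableType d) (f g : T -> measurableTypeR R) n k :
  measurable_fun setT f -> measurable_fun setT g ->
  measurable ((fun z => region_index n (f z) (g z)) @^-1` [set k]).
Proof.
move=> mf mg.
have mfl (h : T -> measurableTypeR R) (i : int) : measurable_fun setT h ->
    measurable [set z | dyadic_index n (h z) = i].
  move=> mh; rewrite (_ : [set _ | _] = [set z | (i%:~R : measurableTypeR R) <= 2 ^+ n * h z] `&`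
      [set z | 2 ^+ n * h z < ((i + 1)%:~R : measurableTypeR R)]).
    by apply: measurableI; [apply: measurable_leR|apply: measurable_ltR] => //; apply: measurable_mulR.
  apply/seteqP; split => z /=.
    by rewrite /dyadic_index => <-; rewrite -floor_ge_int -floor_lt_int lexx ltrDl.
  rewrite -floor_ge_int -floor_lt_int -/(dyadic_index n (h z)) ltzD1 => -[h1 h2].
  by apply/eqP; rewrite eq_le h1 h2.
have [[[i j] kij]|none] := pselect (exists p : int * int, choice.pickle p = k).
  rewrite (_ : _ @^-1` _ = [set z | dyadic_index n (f z) = i] `&` [set z | dyadic_index n (g z) = j]).
    by apply: measurableI; exact: mfl.
  apply/seteqP; split => z /=; rewrite /region_index.
    by rewrite -kij => /(pcan_inj choice.pickleK) [-> ->].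
  by move=> [-> ->].
rewrite (_ : _ @^-1` _ = set0)//; apply/seteqP; split => // z /= h; apply: none.
by eexists; exact: h.
Qed.

End dyadic_grid.

(** * The mean number of crossings *)

Section closer_disc.
Context (R : realType).
Implicit Types y z : plane R.

(** The points closer to the user than [y] and [z] when these are equidistant from
    it. *)
Definition closer_disc y z : set (plane R) :=
  disc (crossing_time y z) (crossing_sqdist y z - crossing_time y z ^+ 2).

Lemma crossing_equidistant y z : y.1 != z.1 ->
  (z.1 + crossing_time y z) ^+ 2 + z.2 ^+ 2 = crossing_sqdist y z.
Proof.
rewrite -subr_eq0 => yz; rewrite /crossing_sqdist /crossing_time /sqnorm.
by field; rewrite -oppr_eq0 opprB.
Qed.

Lemma closer_disc_miss y z : y.1 != z.1 -> ~ closer_disc y z y /\ ~ closer_disc y z z.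
Proof.
move=> yz; have := crossing_equidistant yz.
rewrite /closer_disc /disc/= => e; split; last by rewrite -e; lra.
by rewrite /crossing_sqdist; lra.
Qed.

Lemma crossing_sqdist_ge0 y z : 0 <= crossing_sqdist y z.
Proof. by rewrite addr_ge0 ?sqr_ge0. Qed.

Lemma mean_count_closer_disc (lambda : R) y z :
  mean_count lambda (closer_disc y z) = lambda * pi * crossing_sqdist y z.
Proof.
rewrite /mean_count /closer_disc area_disc; last by rewrite subrK crossing_sqdist_ge0.
by rewrite /= subrK mulrA.
Qed.

End closer_disc.

Section campbell_crossing.
Context d (Omega : measurableType d) (R : realType) (P : probability Omega R).
Variables (lambda : R) (Y : nat -> Omega -> plane R).
Hypotheses (lambda_gt0 : 0 < lambda) (mY : forall i, measurable_fun setT (Y i)).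
Hypothesis pgfl : has_poisson_functional P lambda Y.

Local Notation mR := (measurableTypeR R).
Local Notation Q := (campbell P mY).
Local Notation aa := (@area R \x @area R)%E.

Let lambda_ge0 : 0 <= lambda. Proof. exact: ltW. Qed.

Let ct (z : plane R * plane R) : mR := crossing_time z.1 z.2.
Let cq (z : plane R * plane R) : mR := crossing_sqdist z.1 z.2.

Let mct : measurable_fun setT ct.
Proof. by apply: measurable_crossing_time; [exact: measurable_fst|exact: measurable_snd]. Qed.

Let mcq : measurable_fun setT cq.
Proof. by apply: measurable_crossing_sqdist; [exact: measurable_fst|exact: measurable_snd]. Qed.

Let single (C : set (plane R * plane R)) :=
  [set u : plane R * plane R * Omega | C u.1 /\ count_eq Y (closer_disc u.1.1 u.1.2) 1 u.2].

Let weight (z : plane R * plane R) : R := lambda ^+ 2 * one_point_mass (lambda * pi * cq z).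

Let campbell_bounded rho D1 D2 C : 0 <= rho -> measurable D1 -> measurable D2 ->
  D1 `<=` disc 0 rho -> D2 `<=` disc 0 rho -> D1 `&` D2 = set0 ->
  measurable C -> C `<=` D1 `*` D2 -> (forall z, C z -> z.1.1 != z.2.1) ->
  measurable (single C) /\ Q (single C) = (\int[aa]_(z in C) (weight z)%:E)%E.
Proof.
move=> rho0 mD1 mD2 bD1 bD2 D12 mC CD Cneq.
pose rz z := cq z - ct z ^+ 2.
have mrz : measurable_fun setT (rz : _ -> mR).
  by apply: measurable_addR => //; apply: measurable_oppR; exact: measurable_expnR.
pose idx n z := region_index n (ct z) (rz z).
have bigA z : \bigcup_n @dyadic_region R n (idx n z) = closer_disc z.1 z.2.
  exact: bigcup_dyadic_region.
have [||||||E1 E2] := @campbell_random_region d Omega R P lambda Y lambda_ge0 mY pgfl rho D1 D2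
  rho0 mD1 mD2 bD1 bD2 D12 C idx (@dyadic_region R) mC CD.
- by move=> n k; exact: measurable_region_index.
- by move=> n k; exact: measurable_dyadic_region.
- by move=> n k; exact: dyadic_region_bounded.
- by move=> z _; exact: nd_dyadic_region.
- by move=> z Cz; rewrite bigA; exact: closer_disc_miss (Cneq _ Cz).
- by move=> z Cz; rewrite bigA; exact: disc_bounded.
have singleE : single C = [set u : plane R * plane R * Omega | C u.1 /\
    count_eq Y (\bigcup_n @dyadic_region R n (idx n u.1)) 1 u.2].
  by apply/seteqP; split => u /=; rewrite bigA.
rewrite singleE; split; first exact: E1.
rewrite [LHS]E2; apply: eq_integral => z _.
by rewrite bigA mean_count_closer_disc.
Qed.

Variable S : set mR.
Hypothesis mS : measurable S.

Let C := [set z : plane R * plane R | z.1.1 < z.2.1] `&` ct @^-1` S.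

Let mC : measurable C.
Proof.
apply: measurableI; last by rewrite -[X in measurable X]setTI; exact: mct.
apply: measurable_ltR.
  exact: (measurableT_comp measurable_fst measurable_fst).
exact: (measurableT_comp measurable_fst measurable_snd).
Qed.

(** Pairs ordered by abscissa are covered by countably many products of disjoint
    bounded sets, separated by a vertical line of rational abscissa. *)
Let left_part (M : nat) (c : R) := disc 0 M%:R `&` [set y : plane R | y.1 < c].
Let right_part (M : nat) (c : R) := disc 0 M%:R `&` [set y : plane R | c <= y.1].

Let F (k : nat) : set (plane R * plane R) :=
  if (choice.unpickle k : option (nat * rat)) is Some (M, c) then
    C `&` (left_part M (ratr c) `*` right_part M (ratr c))
  else set0.

Let mleft M c : measurable (left_part M c).
Proof.
apply: measurableI; first exact: measurable_disc.
by apply: measurable_ltR => //; exact: measurable_fst.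
Qed.

Let mright M c : measurable (right_part M c).
Proof.
apply: measurableI; first exact: measurable_disc.
by apply: measurable_leR => //; exact: measurable_fst.
Qed.

Let mF k : measurable (F k).
Proof.
rewrite /F; case: choice.unpickle => [[M c]|//].
by apply: measurableI => //; apply: measurableX.
Qed.

Let C_F : C = \bigcup_k F k.
Proof.
apply/seteqP; split => [z Cz|z [k _]]; last first.
  by rewrite /F; case: choice.unpickle => [[M c] []|].
have [/rat_in_itvoo [c cz] _] := Cz; move: cz; rewrite in_itv/= => /andP[c1 c2].
pose b := Num.max (sqnorm z.1) (sqnorm z.2).
pose M := Num.bound `|b|.
have bM : b < M%:R by apply: le_lt_trans (ler_norm _) _; apply: archi_boundP.
exists (choice.pickle (M, c)) => //; rewrite /F choice.pickleK; split => //.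
move: bM; rewrite /b gt_max => /andP[b1 b2].
by split; split; rewrite /= /disc/= ?mulr0 ?mul0r ?addr0// ltW.
Qed.

Let singleU (A_ : nat -> set (plane R * plane R)) :
  single (\bigcup_k A_ k) = \bigcup_k single (A_ k).
Proof.
apply/seteqP; split => [u [[k _ Ak] h]|u [k _ [Ak h]]]; first by exists k.
by split => //; exists k.
Qed.

(** The mean number of pairs whose crossing time is in [S], with exactly one point of
    the field in the disc of closer points. *)
Lemma campbell_crossing :
  measurable (single C) /\
  Q (single C) = ((6 * Num.sqrt lambda / pi)%:E * @lebesgue_measure R S)%E.
Proof.
have CU : C = \bigcup_k seqDU F k by rewrite -seqDU_bigcup_eq C_F.
have mFU k : measurable (seqDU F k) by exact: seqDU_measurable.
have Fk k : measurable (single (seqDU F k)) /\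
    Q (single (seqDU F k)) = (\int[aa]_(z in seqDU F k) (weight z)%:E)%E.
  have sub : seqDU F k `<=` F k by exact: subset_seqDU.
  have subC : seqDU F k `<=` C by apply: (subset_trans sub) => z Fz; rewrite C_F; exists k.
  have neq z : seqDU F k z -> z.1.1 != z.2.1 by move=> /subC[/lt_eqF ->].
  move: sub; rewrite {2}/F; case: choice.unpickle => [[M c]|] sub.
    apply: (campbell_bounded (ler0n R M) (mleft M (ratr c)) (mright M (ratr c))) => //.
    - by move=> y [].
    - by move=> y [].
    - by apply/seteqP; split => // y [[_ /= h1] [_ /= h2]]; move: h1; rewrite ltNge h2.
    - by move=> z /sub[].
  apply: (campbell_bounded (ler0n R 0) measurable0 measurable0) => //; first by rewrite set0I.
  by move=> z /sub.
have mU : measurable (single C).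
  by rewrite CU singleU; apply: bigcupT_measurable => k; exact: (Fk k).1.
split => //.
transitivity (\int[aa]_(z in C) (weight z)%:E)%E.
  rewrite CU singleU measure_bigcup; last 2 first.
  - by move=> k _; exact: (Fk k).1.
  - have := trivIset_seqDU F => /trivIsetP h; apply/trivIsetP => i j _ _ ij.
    apply/seteqP; split => // u [[ui _] [uj _]].
    by have := h i j Logic.I Logic.I ij; rewrite -subset0 => /(_ u.1); apply.
  rewrite ge0_integral_bigcup//.
  - rewrite (eq_eseriesl (Q := xpredT)); last by move=> k; rewrite in_setT.
    by apply: eq_eseriesr => k _; exact: (Fk k).2.
  - rewrite -CU; apply: measurable_funTS; apply/measurable_EFinP.
    apply: measurable_mulR => //; apply: measurable_mulR.
      by apply: measurable_normR; exact: measurable_mulR.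
    apply: (measurableT_comp (f := expR : mR -> mR)); first exact: measurable_expR.
    by apply: measurable_oppR; exact: measurable_mulR.
  - by move=> z _; rewrite lee_fin; apply: mulr_ge0; [exact: sqr_ge0|exact: one_point_mass_ge0].
have lp : 0 < lambda * pi :> R by rewrite mulr_gt0// pi_gt0.
pose H z : R := \1_[set x : R | 0 < x] (z.2.1 - z.1.1) *
  (\1_S (ct z) * one_point_mass (lambda * pi * cq z)).
have HC z : ((weight z)%:E * (\1_C z)%:E = (lambda ^+ 2)%:E * (H z)%:E)%E.
  rewrite -!EFinM; congr EFin; rewrite /H /weight -[LHS]mulrA; congr (_ * _).

  have -> : \1_C z = \1_[set x : R | 0 < x] (z.2.1 - z.1.1) * \1_S (ct z) :> R.
    rewrite /C indicI/= !indicE; congr (_%:R * _%:R).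
    by congr nat_of_bool; apply/idP/idP => /set_mem h; apply/mem_set; move: h; rewrite /= subr_gt0.
  by rewrite [LHS]mulrC -[LHS]mulrA.
have mH : measurable_fun setT (fun z => (H z)%:E).
  apply/measurable_EFinP; apply: measurable_mulR.
    apply: (measurableT_comp (f := \1_[set x : R | 0 < x] : mR -> mR)).
      by apply: measurable_indic; exact: measurable_ltR.
    apply: measurable_addR; last apply: measurable_oppR.
      exact: (measurableT_comp measurable_fst measurable_snd).
    exact: (measurableT_comp measurable_fst measurable_fst).
  apply: measurable_mulR.
    by apply: (measurableT_comp (f := \1_S : mR -> mR)); first exact: measurable_indic.
  apply: measurable_mulR; first by apply: measurable_normR; exact: measurable_mulR.
  apply: (measurableT_comp (f := expR : mR -> mR)); first exact: measurable_expR.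
  by apply: measurable_oppR; exact: measurable_mulR.
rewrite integral_mkcond epatch_indic.
transitivity (\int[aa]_z ((lambda ^+ 2)%:E * (H z)%:E))%E.
  by apply: eq_integral => z _; exact: HC.
rewrite ge0_integralZl; last 4 first.
- by [].
- exact: mH.
- by move=> z _; rewrite lee_fin; apply: mulr_ge0 => //; apply: mulr_ge0 => //; exact: one_point_mass_ge0.
- by rewrite lee_fin sqr_ge0.
rewrite (crossing_intensity lp mS) muleA -EFinM; congr (_%:E * _)%E.
have sp : Num.sqrt pi != 0 :> R by rewrite sqrtr_eq0 -ltNge pi_gt0.
have sl : Num.sqrt lambda != 0 :> R by rewrite sqrtr_eq0 -ltNge.
have p0 : pi != 0 :> R by rewrite gt_eqF// pi_gt0.
have l0 : lambda != 0 by rewrite gt_eqF.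
rewrite sqrtrM//; set q := Num.sqrt lambda; rewrite -{1 2}[lambda](sqr_sqrtr lambda_ge0) -/q.
move: sp p0 sl; rewrite -/q; move: pi q => p q sp p0 sl.
by field; rewrite p0 sl sp.
Qed.

End campbell_crossing.

(** * Null coincidences *)

Lemma measurable_eqR d (T : measurableType d) (R : realType) (f g : T -> measurableTypeR R) :
  measurable_fun setT f -> measurable_fun setT g -> measurable [set x | f x = g x].
Proof.
move=> mf mg; rewrite (_ : [set _ | _] = [set x | f x <= g x] `&` [set x | g x <= f x]).
  by apply: measurableI; exact: measurable_leR.
apply/seteqP; split => [x /= ->|x /= [h1 h2]]; first by rewrite lexx.
by apply/eqP; rewrite eq_le h1 h2.
Qed.

(** The abscissa of the rotated point takes the value [c] at finitely many angles: the
    cosine of such an angle is a root of a quadratic polynomial with leading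
    coefficient [a ^+ 2 + b ^+ 2]. *)
Lemma trigonometric_level_null (R : realType) (x : plane R) (c : R) : x != (0, 0) ->
  @lebesgue_measure R ([set theta | (rotate theta x).1 = c] `&` `[- pi, pi]) = 0%E.
Proof.
case: x => a b ab; apply: countable_lebesgue_measure0; apply: finite_set_countable.
have n0 : 0 < a ^+ 2 + b ^+ 2.
  rewrite lt_neqAle addr_ge0 ?sqr_ge0// andbT eq_sym paddr_eq0 ?sqr_ge0//.
  by rewrite !sqrf_eq0; apply: contra ab => /andP[/eqP -> /eqP ->].
pose n := a ^+ 2 + b ^+ 2; pose r := Num.sqrt ((a * c) ^+ 2 - n * (c ^+ 2 - b ^+ 2)).
pose u1 := (a * c + r) / n; pose u2 := (a * c - r) / n.
apply: (@sub_finite_set _ _ [set acos u1; - acos u1; acos u2; - acos u2]); last first.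
  by rewrite !finite_setU; do !split; exact: finite_set1.
move=> t /= [] /= h; rewrite in_itv/= => /andP[t1 t2].
have rt : `|n * cos t - a * c| = r.
  rewrite /r -sqrtr_sqr; congr Num.sqrt; rewrite -h /n.
  transitivity (b ^+ 2 * ((a ^+ 2 + b ^+ 2) * (cos t ^+ 2 + sin t ^+ 2) - (a * cos t + b * sin t) ^+ 2)).
    by ring.
  by rewrite cos2Dsin2; ring.
have tE : t = acos (cos t) \/ t = - acos (cos t).
  have [t0|/ltW t0] := leP 0 t.
    by left; rewrite cosK// in_itv/= t0.
  by right; rewrite -cosN cosK ?opprK// in_itv/= oppr_ge0 t0 lerNl.
have [c1|c1] : cos t = u1 \/ cos t = u2.
  have [p0|/ltW p0] := leP 0 (n * cos t - a * c).
    by left; rewrite /u1 -rt ger0_norm//; field; rewrite gt_eqF.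
  by right; rewrite /u2 -rt ler0_norm//; field; rewrite gt_eqF.
- by move: tE; rewrite c1 => -[] ->; [do 3 left|do 2 left; right].
- by move: tE; rewrite c1 => -[] ->; [left; right|right].
Qed.

Section mark_avoids.
Context d (Omega : measurableType d) (R : realType) (P : probability Omega R).
Variables (lambda : R) (X : nat -> {RV P >-> plane R})
  (Theta : nat -> {RV P >-> measurableTypeR R}).
Hypotheses (X_poisson : is_poisson_point_process lambda X)
  (Theta_iid : is_iid_uniform_angles Theta)
  (Theta_indep_X : independent2 P (sigma_seq X) (sigma_seq Theta)).
Local Notation mR := (measurableTypeR R).

Lemma point_not_origin k : P [set w | X k w = (0, 0)] = 0%E.
Proof.
have sE : [set (0, 0)] = [set (0 : R)] `*` [set (0 : R)].
  by apply/seteqP; split => [_ ->//|[x y] /= [-> ->]].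
have mO : measurable ([set (0, 0)] : set (plane R)).
  by rewrite sE; apply: measurableX; exact: measurable_set1.
have aO : area ([set (0, 0)] : set (plane R)) = 0%E.
  rewrite sE /area (product_measure1E (@lebesgue_measure R) (@lebesgue_measure R));
    [|exact: measurable_set1|exact: measurable_set1].
  by rewrite [X in (X * _)%E](_ : _ = 0%E) ?mul0e//; exact: lebesgue_measure_set1.
have [] := X_poisson => /(_ _ mO); rewrite aO => /(_ (ltry _) 0%N) /=.
rewrite mulr0 oppr0 expR0 expr0 fact0 divr1 mulr1 => P1 _.
have m0 : measurable (count_eq (fun i => X i) [set (0, 0)] 0) by exact: (@measurable_count_eq _ _ _ (fun i => X i) (fun i => measurable_funP (X i)) _ 0%N mO).
apply/eqP; rewrite eq_le measure_ge0 andbT.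
apply: (@le_trans _ _ (P (~` count_eq (fun i => X i) [set (0, 0)] 0))).
  apply: le_measure; rewrite ?inE.
  - have := @measurable_funP _ _ _ _ _ (X k) measurableT _ mO.
    by rewrite setTI.
  - exact: measurableC.
  move=> w /= Xk h.
  have := first_points_le (fun i => X i) [set (0, 0)] w k.+1.
  rewrite h lee_fin ler_nat leqn0 first_points_ord (bigD1 ord_max)//= mem_set//.
by rewrite probability_setC// [X in (1 - X)%E]P1 subee.
Qed.

Variable k : nat.
Local Notation others := (others X Theta k).

(** Given everything but the [k]-th mark, the abscissa of the [k]-th rotated point has
    a diffuse law, unless [X k] is the origin, an event of probability zero. *)
Lemma static_point_avoids (h : others -> mR) : measurable_fun setT h ->
  P.-negligible [set w | (static_point X Theta k w).1 = h w].
Proof.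
move=> mh.
pose B := [set z : others * mR | (rotate z.2 (X k z.1)).1 = h z.1 /\ X k z.1 <> (0, 0)].
have mXk : measurable_fun setT (fun z : others * mR => X k z.1).
  by apply: (measurableT_comp _ measurable_fst); exact: measurable_others_X.
have mO : measurable ([set (0, 0)] : set (plane R)).
  rewrite (_ : [set _] = [set (0 : R)] `*` [set (0 : R)]).
    by apply: measurableX; exact: measurable_set1.
  by apply/seteqP; split => [_ ->//|[x y] /= [-> ->]].
have mB : measurable B.
  apply: measurableI.
    apply: measurable_eqR; last exact: (measurableT_comp mh measurable_fst).
    apply: (measurableT_comp measurable_fst).
    by apply: measurable_rotate2 => //; exact: measurable_snd.
  have mX0 : measurable ((fun z : others * mR => X k z.1) @^-1` [set (0, 0)]).
    by rewrite -[X in measurable X]setTI; exact: mXk.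
  exact: (measurableC mX0).
have mI : measurable_fun setT (fun z => (\1_B z)%:E : \bar R).
  by apply/measurable_EFinP; exact: measurable_indic.
have B0 z : (0 <= (\1_B z)%:E :> \bar R)%E by rewrite lee_fin.
pose G := [set w | B (w, Theta k w)].
have mG : measurable G.
  have := @measurable_pair_mark _ _ _ _ X Theta k measurableT _ mB.
  by rewrite setTI.
have PG : P G = 0%E.
  transitivity (\int[P]_w (\1_G w)%:E)%E; first by rewrite integral_indic// setIT.
  transitivity (\int[P]_w (\1_B ((w : others), Theta k w))%:E)%E.
    by apply: eq_integral => w _; rewrite !indicE.
  rewrite (integral_independent_mark Theta_iid Theta_indep_X mI B0).
  apply: integral0_eq => w _.
  have [Xw|/eqP Xw] := pselect (X k w = (0, 0)).
    by apply: integral0_eq => t _; rewrite indicE memNset// => -[].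
  rewrite integral_uniform//; last by exact: (measurableT_comp mI (pair1_measurable _)).
  rewrite [X in (_ * X)%E](_ : _ = 0%E) ?mule0//.
  have mL : measurable [set theta : mR | (rotate theta (X k w)).1 = h w].
    apply: measurable_eqR => //; apply: (measurableT_comp measurable_fst).
    exact: measurable_rotate2.
  rewrite -[RHS](trigonometric_level_null (h w) Xw) -integral_indic//.
  apply: eq_integral => t _; rewrite !indicE; congr (_%:R%:E).
  by congr nat_of_bool; apply/idP/idP => /set_mem; [move=> []/= ? _|move=> /= ?]; apply/mem_set => //; split => //; exact/eqP.
apply: (@negligibleS _ _ _ _ (G `|` [set w | X k w = (0, 0)])).
  by move=> w /= e; have [?|n0] := pselect (X k w = (0, 0)); [right|left; split].
apply: negligibleU; apply/negligibleP => //.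
  have := @measurable_funP _ _ _ _ _ (X k) measurableT _ mO.
  by rewrite setTI.
exact: point_not_origin.
Qed.

End mark_avoids.

(** * Handovers along one path *)

Section handovers_of_a_path.
Context (R : realType).
Variable y : nat -> plane R.

Definition moving_sqdist (z : plane R) (s : R) : R := (z.1 + s) ^+ 2 + z.2 ^+ 2.

Lemma moving_sqdist_ge0 z s : 0 <= moving_sqdist z s.
Proof. by rewrite addr_ge0 ?sqr_ge0. Qed.

Lemma bs_distanceE (x : plane R) (theta s : R) :
  bs_distance 1 x theta s = Num.sqrt (moving_sqdist (rotate theta x) s).
Proof.
rewrite /bs_distance /euclidean_norm /bs_position /moving_sqdist /rotate /=; congr Num.sqrt.
rewrite mul1r; have c2 := cos2Dsin2 theta.
transitivity (x.1 ^+ 2 + x.2 ^+ 2 + 2 * s * (x.1 * cos theta + x.2 * sin theta)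
   + s ^+ 2 * (cos theta ^+ 2 + sin theta ^+ 2)); first by ring.
rewrite c2; transitivity ((x.1 ^+ 2 + x.2 ^+ 2) * (cos theta ^+ 2 + sin theta ^+ 2) +
   2 * s * (x.1 * cos theta + x.2 * sin theta) + s ^+ 2); last by ring.
by rewrite c2; ring.
Qed.

Lemma moving_sqdist_crossing (a b : plane R) (s : R) : a.1 != b.1 ->
  moving_sqdist a s = moving_sqdist b s <-> s = crossing_time a b.
Proof.
move=> ab; split=> [e|->]; last by rewrite [RHS](crossing_equidistant ab).
have ba : 2 * (b.1 - a.1) != 0 by rewrite mulf_neq0 ?pnatr_eq0// subr_eq0 eq_sym.
apply: (mulIf ba); rewrite /crossing_time divfK//.
by move: e; rewrite /moving_sqdist /sqnorm; lra.
Qed.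

Let closer (a b z : plane R) : a.1 != b.1 ->
  closer_disc a b z <-> moving_sqdist z (crossing_time a b) < crossing_sqdist a b.
Proof.
by move=> ab; rewrite /closer_disc /disc/= /moving_sqdist; split; lra.
Qed.

(** Ordering the pair by abscissa picks one of its two orderings. *)
Definition handover_pair (S : set R) i j :=
  [/\ (y i).1 < (y j).1, S (crossing_time (y i) (y j)) &
      exists! l, closer_disc (y i) (y j) (y l)].

Hypothesis abscissa_inj : forall i j, i != j -> (y i).1 != (y j).1.

Local Notation V :=
  (interference_handovers (fun i s => Num.sqrt (moving_sqdist (y i) s))).

Let sqrt_lt (a b : R) : 0 <= a -> (Num.sqrt a < Num.sqrt b) = (a < b) :> bool.
Proof. by move=> a0; rewrite !ltNge ler_sqrt. Qed.

Let sqrt_inj (a b : R) : 0 <= a -> 0 <= b -> Num.sqrt a = Num.sqrt b -> a = b :> R.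
Proof. by move=> a0 b0 ab; rewrite -(sqr_sqrtr a0) -(sqr_sqrtr b0) ab. Qed.

Lemma interference_handoversE :
  V = [set s | exists i j, handover_pair [set s] i j].
Proof.
apply/seteqP; split => [s [i [j [h [ij di dj hl]]]]|s [i [j [ij /= ts hl]]]]; last first.
  have nij : (y i).1 != (y j).1 by rewrite lt_eqF.
  exists i, j, (Num.sqrt (crossing_sqdist (y i) (y j))); split.
  - by apply: contraTneq ij => ->; rewrite ltxx.
  - by rewrite -ts.
  - by rewrite -ts /moving_sqdist (crossing_equidistant nij).
  case: hl => l [hl1 hl2]; exists l; split => [|l'].
    by rewrite sqrt_lt ?moving_sqdist_ge0// -ts; exact/closer.
  by rewrite sqrt_lt ?moving_sqdist_ge0// -ts => /(closer _ nij) /hl2.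
wlog lij : i j ij di dj / (y i).1 < (y j).1 => [W|].
  have /lt_total/orP[/W|/W] := abscissa_inj ij; first by apply.
  by apply => //; rewrite eq_sym.
have nij := abscissa_inj ij.
have ts : s = crossing_time (y i) (y j).
  apply/(moving_sqdist_crossing _ nij).
  by apply: sqrt_inj; rewrite ?moving_sqdist_ge0// di dj.
exists i, j; split => //.
have cE l : closer_disc (y i) (y j) (y l) <-> Num.sqrt (moving_sqdist (y l) s) < h.
  by rewrite -di sqrt_lt ?moving_sqdist_ge0// ts; exact: closer.
by case: hl => l [hl1 hl2]; exists l; split => [|l' /cE/hl2]//; exact/cE.
Qed.

Hypothesis no_triple : forall i j k, i != j -> k != i -> k != j ->
  crossing_time (y i) (y j) != 0 ->
  moving_sqdist (y k) (crossing_time (y i) (y j)) != crossing_sqdist (y i) (y j).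

(** Two handover pairs at the same time are at the same distance from the user,
    otherwise both points of the nearer pair would be closer than the farther pair,
    which has only one closer point. Hence a second pair would produce a third
    point at that distance. *)
Lemma handover_pair_inj S i j i' j' : handover_pair S i j -> handover_pair S i' j' ->
  crossing_time (y i) (y j) = crossing_time (y i') (y j') ->
  crossing_time (y i) (y j) != 0 -> i = i' /\ j = j'.
Proof.
move=> [ij _ [l [hl1 hl2]]] [ij' _ [l' [hl1' hl2']]] tt t0.
have nij : (y i).1 != (y j).1 by rewrite lt_eqF.
have nij' : (y i').1 != (y j').1 by rewrite lt_eqF.
have iNj : i != j by apply: contraTneq ij => ->; rewrite ltxx.
have iNj' : i' != j' by apply: contraTneq ij' => ->; rewrite ltxx.
set s := crossing_time (y i) (y j) in tt t0.
have ei : moving_sqdist (y i) s = crossing_sqdist (y i) (y j) by [].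
have ej : moving_sqdist (y j) s = crossing_sqdist (y i) (y j) by exact: crossing_equidistant.
have ei' : moving_sqdist (y i') s = crossing_sqdist (y i') (y j') by rewrite tt.
have ej' : moving_sqdist (y j') s = crossing_sqdist (y i') (y j').
  by rewrite tt; exact: crossing_equidistant.
have hh : crossing_sqdist (y i) (y j) = crossing_sqdist (y i') (y j').
  apply/eqP; rewrite eq_le !leNgt; apply/andP; split; apply/negP => lt.
  - have /hl2 h1 : closer_disc (y i) (y j) (y i') by apply/closer => //; rewrite ei'.
    have /hl2 h2 : closer_disc (y i) (y j) (y j') by apply/closer => //; rewrite ej'.
    by move: iNj'; rewrite -h1 -h2 eqxx.
  - have /hl2' h1 : closer_disc (y i') (y j') (y i) by apply/closer => //; rewrite -tt ei.
    have /hl2' h2 : closer_disc (y i') (y j') (y j) by apply/closer => //; rewrite -tt ej.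
    by move: iNj; rewrite -h1 -h2 eqxx.
have mem k : moving_sqdist (y k) s = crossing_sqdist (y i) (y j) -> k = i \/ k = j.
  move=> e; have [->|ki] := eqVneq k i; first by left.
  have [->|kj] := eqVneq k j; first by right.
  by have := no_triple iNj ki kj t0; rewrite -/s e eqxx.
have := mem i' (etrans ei' (esym hh)); have := mem j' (etrans ej' (esym hh)).
by case=> j'E [] i'E; subst i' j' => //; move: ij' iNj' (lt_asym (y i).1 (y j).1); rewrite ?eqxx// ij => ->.
Qed.

Local Notation mR := (measurableTypeR R).

Hypothesis no_pair_at0 : forall i j, ~ handover_pair [set 0] i j.

(** The set of handover times is the union over all pairs of sets with at most one
    element, pairwise disjoint by [handover_pair_inj]; the counting measure is
    additive. *)
Lemma counting_handovers (S : set R) :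
  counting (V `&` S) =
  (\sum_(0 <= i <oo) \sum_(0 <= j <oo) (`[< handover_pair S i j >]%:R)%:E)%E :> \bar R.
Proof.
pose W i j : set mR := [set s | handover_pair S i j /\ s = crossing_time (y i) (y j)].
have VE : V `&` S = \bigcup_i \bigcup_j W i j.
  rewrite interference_handoversE; apply/seteqP; split => [s [[i [j [ij /= ts hl]]] Ss]|].
    by exists i => //; exists j => //; split => //; split => //; rewrite ts.
  move=> _ [i _ [j _ [[ij Ss hl] ->]]]; split => //; by exists i, j.
have WE i j : W i j = if `[< handover_pair S i j >] then [set crossing_time (y i) (y j)] else set0.
  case: ifP => /asboolP h; apply/seteqP; split => s //=; first by case.
  by move=> [].
have mW i j : measurable (W i j).
  by rewrite WE; case: ifP => // _; exact: measurable_set1.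
have cW i j : counting (W i j) = (`[< handover_pair S i j >]%:R)%:E :> \bar R.
  rewrite WE; case: ifP => _; last by rewrite (measure0 (@counting mR R)).
  by rewrite /counting asboolT ?fset_set1 ?cardfs1//; exact: finite_set1.
have Winj i j i' j' s : W i j s -> W i' j' s -> i = i' /\ j = j'.
  move=> [p ->] [p' tt]; apply: (handover_pair_inj (p) (p') tt).
  by apply/eqP => t0; case: p => a _ b; exact: (@no_pair_at0 i j).
rewrite VE.
transitivity (@counting mR R (\bigcup_i \bigcup_j W i j)); first by [].
rewrite measure_bigcup; last 2 first.
- by move=> i _; exact: bigcupT_measurable.
- apply/trivIsetP => i i' _ _ /eqP ii; apply/seteqP; split => // s [[j _ h] [j' _ h']].
  by have [] := Winj _ _ _ _ _ h h'.
rewrite (eq_eseriesl (Q := xpredT)); last by move=> k; rewrite in_setT.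
apply: eq_eseriesr => i _; rewrite measure_bigcup; last 2 first.
- by [].
- apply/trivIsetP => j j' _ _ /eqP jj; apply/seteqP; split => // s [h h'].
  by have [] := Winj _ _ _ _ _ h h'.
rewrite (eq_eseriesl (Q := xpredT)); last by move=> k; rewrite in_setT.
by apply: eq_eseriesr => j _; exact: cW.
Qed.

End handovers_of_a_path.

(** * The intensity *)

(** The integral of a nonnegative function, measurable or not, is a supremum over the
    simple functions below it. *)
Lemma le_integral_pointwise d (T : measurableType d) (R : realType)
    (mu : {measure set T -> \bar R}) (f g : T -> \bar R) :
  (forall x, 0 <= f x)%E -> (forall x, f x <= g x)%E ->
  (\int[mu]_x f x <= \int[mu]_x g x)%E.
Proof.
move=> f0 fg; have g0 x : (0 <= g x)%E by exact: le_trans (fg x).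
rewrite !ge0_integralTE//; apply: le_ereal_sup => _ [h hf <-].
by exists h => // x; exact: le_trans (fg x).
Qed.

(** [f], possibly not measurable, lies between two measurable functions with the same
    integral as [g]: on [N] they are [0] and infinite. *)
Lemma integral_eq_off_null d (T : measurableType d) (R : realType)
    (mu : {measure set T -> \bar R}) (f g : T -> \bar R) (N : set T) :
  measurable N -> mu N = 0%E -> measurable_fun setT g ->
  (forall x, 0 <= f x)%E -> (forall x, 0 <= g x)%E ->
  (forall x, ~ N x -> f x = g x) -> (\int[mu]_x f x = \int[mu]_x g x)%E.
Proof.
move=> mN N0 mg f0 g0 fg.
pose k x : \bar R := (+oo * (\1_N x)%:E)%E.
have mk : measurable_fun setT k.
  by apply: emeasurable_funM => //; apply/measurable_EFinP; exact: measurable_indic.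
have k0 x : (0 <= k x)%E by rewrite mule_ge0// lee_fin.
have kN x : N x -> k x = +oo%E by move=> Nx; rewrite /k indicE mem_set// mule1.
have k_off x : ~ N x -> k x = 0%E by move=> Nx; rewrite /k indicE memNset// mule0.
have absorb (h : T -> \bar R) : measurable_fun setT h -> (forall x, 0 <= h x)%E ->
    (\int[mu]_x (h x + k x) = \int[mu]_x h x)%E.
  move=> mh h0; rewrite ge0_integralD; last 5 first.
  - exact: measurableT.
  - by move=> x _.
  - exact: mh.
  - by move=> x _.
  - exact: mk.
  rewrite ge0_integralZl; last 4 first.
  - exact: measurableT.
  - by apply/measurable_EFinP; exact: measurable_indic.
  - by move=> x _; rewrite lee_fin.
  - by [].
  by rewrite integral_indic// setIT N0 mule0 adde0.
pose g1 x : \bar R := (g x * (\1_(~` N) x)%:E)%E.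
have mg1 : measurable_fun setT g1.
  by apply: emeasurable_funM => //; apply/measurable_EFinP; apply: measurable_indic; exact: measurableC.
have g10 x : (0 <= g1 x)%E by rewrite mule_ge0// lee_fin.
apply/eqP; rewrite eq_le; apply/andP; split.
  rewrite -(absorb g mg g0); apply: le_integral_pointwise => // x.
  have [Nx|Nx] := pselect (N x); first by rewrite (kN _ Nx) addey ?leey// gt_eqF// (lt_le_trans _ (g0 x)).
  by rewrite fg// leeDl.
apply: (@le_trans _ _ (\int[mu]_x g1 x)%E).
  rewrite -(absorb g1 mg1 g10); apply: le_integral_pointwise => // x.
  have [Nx|Nx] := pselect (N x); first by rewrite (kN _ Nx) addey ?leey// gt_eqF// (lt_le_trans _ (g10 x)).
  by rewrite /g1 indicE mem_set// mule1 leeDl.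
apply: le_integral_pointwise => // x; have [Nx|Nx] := pselect (N x).
  by rewrite /g1 indicE memNset ?mule0//= => /(_ Nx).
by rewrite /g1 indicE mem_set// mule1 fg.
Qed.

Lemma sqnorm_rotate (R : realType) (theta : R) (x : plane R) :
  sqnorm (rotate theta x) = sqnorm x.
Proof.
rewrite /sqnorm /rotate /=; transitivity ((x.1 ^+ 2 + x.2 ^+ 2) * (cos theta ^+ 2 + sin theta ^+ 2)).
  by ring.
by rewrite cos2Dsin2 mulr1.
Qed.

Section handover_intensity.
Context d (Omega : measurableType d) (R : realType) (P : probability Omega R).
Variables (lambda : R) (X : nat -> {RV P >-> plane R})
  (Theta : nat -> {RV P >-> measurableTypeR R}).
Hypotheses (lambda_gt0 : 0 < lambda) (X_poisson : is_poisson_point_process lambda X)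
  (Theta_iid : is_iid_uniform_angles Theta)
  (Theta_indep_X : independent2 P (sigma_seq X) (sigma_seq Theta)).
Local Notation mR := (measurableTypeR R).
Local Notation Y := (static_point X Theta).
Local Notation path w := (fun i => Y i w).

Let mY i : measurable_fun setT (Y i). Proof. exact: measurable_static_point. Qed.

Let pair_event (S : set mR) i j := [set w | handover_pair (path w) S i j].

(** The Campbell measure of the event is the sum over the pairs of indices. *)
Lemma sum_handover_pairs (S : set mR) : measurable S ->
  (forall i j, measurable (pair_event S i j)) /\
  (\sum_(0 <= i <oo) \sum_(0 <= j <oo) P (pair_event S i j) =
   (6 * Num.sqrt lambda / pi)%:E * @lebesgue_measure R S)%E.
Proof.
move=> mS.
have [mE QE] := campbell_crossing (P := P) lambda_gt0 mY (fun g rho mg g01 rho0 =>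
  static_point_pgfl (ltW lambda_gt0) X_poisson Theta_iid Theta_indep_X mg g01 rho0) mS.
set E := [set u | _] in mE QE.
have EE i j : pair_event S i j = [set w | E ((Y i w, Y j w), w)].
  apply/seteqP; split => w /=.
    by move=> [ij Ss /count_eq1P hl].
  by move=> [[ij Ss] /count_eq1P hl].
split => [i j|].
  rewrite EE -[X in measurable X]setTI.
  have mL : measurable_fun setT (fun w => ((Y i w, Y j w), w)).
    by apply: measurable_fun_pair => //; exact: measurable_fun_pair.
  exact: (mL measurableT _ mE).
rewrite -QE campbellE; apply: eq_eseriesr => i _; apply: eq_eseriesr => j _.
by rewrite EE.
Qed.

Let measurable_others_Y k i : i != k ->
  measurable_fun setT (Y i : others X Theta k -> plane R).
Proof.
move=> ik; apply: measurable_rotate2; first exact: measurable_others_Theta.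
exact: measurable_others_X.
Qed.

Lemma abscissa_inj_negligible i j : i != j ->
  P.-negligible [set w | (Y i w).1 = (Y j w).1].
Proof.
move=> ij; apply: (static_point_avoids X_poisson Theta_iid Theta_indep_X (k := i) (h := fun w => (Y j w).1)).
by apply: (measurableT_comp measurable_fst); apply: measurable_others_Y; rewrite eq_sym.
Qed.

(** The squared distance to the [k]-th point at the crossing time of the two others is
    affine in its abscissa, with slope twice that time; its norm does not depend on
    the [k]-th mark. *)
Lemma no_triple_negligible i j k : i != k -> j != k ->
  P.-negligible [set w | crossing_time (Y i w) (Y j w) != 0 /\
    moving_sqdist (Y k w) (crossing_time (Y i w) (Y j w)) = crossing_sqdist (Y i w) (Y j w)].
Proof.
move=> ik jk.
pose t (w : others X Theta k) : mR := crossing_time (Y i w) (Y j w).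
pose q (w : others X Theta k) : mR := crossing_sqdist (Y i w) (Y j w).
have mYi := measurable_others_Y ik; have mYj := measurable_others_Y jk.
have mt : measurable_fun setT t by exact: measurable_crossing_time.
have mq : measurable_fun setT q by exact: measurable_crossing_sqdist.
pose h (w : others X Theta k) : mR := (q w - t w ^+ 2 - sqnorm (X k w)) * (2 * t w)^-1.
have mh : measurable_fun setT h.
  apply: measurable_mulR; last by apply: measurable_invR; exact: measurable_mulR.
  apply: measurable_addR; last first.
    by apply: measurable_oppR; apply: measurable_sqnorm; exact: measurable_others_X.
  by apply: measurable_addR => //; apply: measurable_oppR; exact: measurable_expnR.
apply: negligibleS (static_point_avoids X_poisson Theta_iid Theta_indep_X mh) => w /= [t0 e].
rewrite /h -(sqnorm_rotate (Theta k w)) -/(Y k w) /q -e -/(t w) /moving_sqdist /sqnorm.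
change ((Y k w).1 = (((Y k w).1 + t w) ^+ 2 + (Y k w).2 ^+ 2 - t w ^+ 2 -
  ((Y k w).1 ^+ 2 + (Y k w).2 ^+ 2)) / (2 * t w)).
have {}t0 : t w != 0 by exact: t0.
move: (Y k w) (t w) t0 => z s s0; by field.
Qed.

(** Coincidences at time 0 are excluded by [sum_handover_pairs] at [S = [set 0]], whose
    measure is zero; the other ones by the two negligibility lemmas. *)
Lemma intensity_tropical_interference :
  intensity P (tropical_interference_process 1 X Theta) = (6 * Num.sqrt lambda / pi)%:E.
Proof.
pose S0 : set mR := [set 0]; pose S : set R := `[0%R, 1%R]%classic.
have [m0 s0] := sum_handover_pairs (measurable_set1 0 : measurable S0).
have [m1 s1] := sum_handover_pairs (measurable_itv `[0%R, 1%R] : measurable (S : set mR)).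
have P0 i j : P (pair_event S0 i j) = 0%E.
  apply/eqP; rewrite eq_le measure_ge0 andbT.
  have := s0; rewrite [X in (_ * X)%E](_ : _ = 0%E) ?mule0; last exact: lebesgue_measure_set1.
  move=> <-; have term (u : nat -> \bar R) k : (forall n, 0 <= u n)%E ->
      (u k <= \sum_(0 <= n <oo) u n)%E.
    move=> u0; rewrite (@nneseriesD1 _ _ k)// leeDl//.
    by apply: nneseries_ge0.
  apply: le_trans (term _ i _); last by move=> k; apply: nneseries_ge0.
  by apply: (term (fun j => P (pair_event S0 i j))) => k.
pose bad1 i j := [set w | i != j /\ (Y i w).1 = (Y j w).1].
pose bad2 i j k := [set w | [/\ i != j, k != i & k != j] /\
  (crossing_time (Y i w) (Y j w) != 0 /\
   moving_sqdist (Y k w) (crossing_time (Y i w) (Y j w)) = crossing_sqdist (Y i w) (Y j w))].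
pose bad i j k := pair_event S0 i j `|` (bad1 i j `|` bad2 i j k).
have [N [mN PN badN]] : P.-negligible (\bigcup_i \bigcup_j \bigcup_k bad i j k).
  apply: negligible_bigcup => i; apply: negligible_bigcup => j.
  apply: negligible_bigcup => k; apply: negligibleU.
    apply/negligibleP; last exact: P0.
    exact: m0.
  apply: negligibleU.
    have [ij|ij] := boolP (i != j).
      by apply: negligibleS (abscissa_inj_negligible ij) => w [].
    by apply: negligibleS (negligible_set0 P) => w []; rewrite (negbTE ij).
  have [/and3P[ij ki kj]|h] := boolP [&& i != j, k != i & k != j].
    apply: negligibleS (no_triple_negligible (i := i) (j := j) (k := k) _ _) => [w []//||];
      by rewrite eq_sym.
  by apply: negligibleS (negligible_set0 P) => w [[ij ki kj]]; move/negP: h; case; apply/and3P.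
pose g w : \bar R := (\sum_(0 <= i <oo) \sum_(0 <= j <oo) (\1_(pair_event S i j) w)%:E)%E.
have mI i j : measurable_fun setT (fun w => (\1_(pair_event S i j) w)%:E : \bar R).
  by apply/measurable_EFinP; exact: measurable_indic.
have mIs i : measurable_fun setT (fun w => \sum_(0 <= j <oo) (\1_(pair_event S i j) w)%:E : \bar R)%E.
  apply: ge0_emeasurable_sum => [j w _|j _]; first by rewrite lee_fin.
exact (mI i j).
have gi0 w i : (0 <= \sum_(0 <= j <oo) (\1_(pair_event S i j) w)%:E :> \bar R)%E.
  by apply: nneseries_ge0 => j _ _; rewrite lee_fin.
have mg : measurable_fun setT g.
  by apply: ge0_emeasurable_sum => [i w _ _|i _]; [exact: gi0|exact: mIs].
rewrite /intensity (integral_eq_off_null (g := g) mN PN mg); last 3 first.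
- by move=> w; exact: measure_ge0 (@counting mR R) _.
- by move=> w; apply: nneseries_ge0 => i _ _.
- move=> w Nw.
  have notbad i j k : ~ bad i j k w.
    by move=> h; apply: Nw; apply: badN; exists i => //; exists j => //; exists k.
  have -> : tropical_interference_process 1 X Theta w =
      interference_handovers (fun i s => Num.sqrt (moving_sqdist (Y i w) s)).
    rewrite /tropical_interference_process; congr interference_handovers.
    by apply/funext => i; apply/funext => s; exact: bs_distanceE.
  rewrite (@counting_handovers _ (path w)).
  - apply: eq_eseriesr => i _; apply: eq_eseriesr => j _; rewrite indicE; congr (_%:R%:E).
  - move=> i j ij; apply/eqP => e; apply: (notbad i j 0%N); right; left; split => //.
  - move=> i j k ij ki kj t0; apply/eqP => e; apply: (notbad i j k); right; right; split => //.
  - by move=> i j h; apply: (notbad i j 0%N); left.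
rewrite /g integral_nneseries; last 3 first.
- exact: measurableT.
- exact: mIs.
- by move=> i w _; exact: gi0.
transitivity (\sum_(0 <= i <oo) \sum_(0 <= j <oo) P (pair_event S i j))%E.
  apply: eq_eseriesr => i _; rewrite integral_nneseries; last 3 first.
  - exact: measurableT.
  - exact: mI.
  - by move=> j w _; rewrite lee_fin.
  by apply: eq_eseriesr => j _; rewrite integral_indic// setIT.
rewrite s1; have -> : @lebesgue_measure R S = 1%E.
  by rewrite lebesgue_measure_itv/= lte_fin ltr01 oppr0 adde0.
by rewrite mule1.
Qed.

End handover_intensity.

Theorem lemma2 (R : realType) (d : measure_display) (Omega : measurableType d)
    (P : probability Omega R) (lambda : R)
    (X : nat -> {RV P >-> plane R})
    (Theta : nat -> {RV P >-> measurableTypeR R})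
    (lambda_gt0 : 0 < lambda)
    (X_poisson : is_poisson_point_process lambda X)
    (Theta_iid : is_iid_uniform_angles Theta)
    (Theta_indep_X : independent2 P (sigma_seq X) (sigma_seq Theta)) :
  intensity P (tropical_interference_process 1 X Theta) =
  (6 * Num.sqrt lambda / pi)%:E.
Proof. exact: intensity_tropical_interference. Qed.
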